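(* Let $q\in[1,\infty]$, and for $F\in L^1_{loc}(\mathbf R^{2d})$ consider the map $$(f,g)\mapsto T_F(f,g),\qquad T_F(f,g)(\xi)=\int F(\xi,\eta)f(\eta)g(\xi-\eta)\,d\eta,\qquad(\ast)$$ from $C_0^\infty(\mathbf R^d)\times C_0^\infty(\mathbf R^d)$ to $\mathscr S'(\mathbf R^d)$. Then the following is true: (1) If $F\in L^{\infty,q'}_2(\mathbf R^{2d})$, then the map $(\ast)$ extends uniquely to a continuous mapping from $L^q(\mathbf R^d)\times L^q(\mathbf R^d)$ to $L^q(\mathbf R^d)$. Furthermore $$\|T_F(f,g)\|_{L^q}\le\|F\|_{L^{\infty,q'}_2}\|f\|_{L^q}\|g\|_{L^q}$$ for every $F\in L^{\infty,q'}_2(\mathbf R^{2d})$ and $f,g\in L^q(\mathbf R^d)$. (2) If $q>2$, $F\in L^{q,\infty}_1(\mathbf R^{2d})$ and $r>d(1-2/q)$, then the map $(\ast)$ extends uniquely to a continuous mapping from $L^q(\mathbf R^d)\times L^q_r(\mathbf R^d)$ to $L^q(\mathbf R^d)$. Furthermore $$\|T_F(f,g)\|_{L^q}\le C\|F\|_{L^{q,\infty}_1}\|f\|_{L^q}\|g\|_{L^q_r},$$ for some constant $C$ which is independent of $F\in L^{q,\infty}_1(\mathbf R^{2d})$, $f\in L^q(\mathbf R^d)$ and $g\in L^q_r(\mathbf R^d)$. (3) If $1\le q\le 2$ and $F\in L^{q',\infty}_1(\mathbf R^{2d})$, then the map $(\ast)$ extends uniquely to a continuous mapping from $L^q(\mathbf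 R^d)\times L^q(\mathbf R^d)$ to $L^q(\mathbf R^d)$. Furthermore $$\|T_F(f,g)\|_{L^q}\le\|F\|_{L^{q',\infty}_1}\|f\|_{L^q}\|g\|_{L^q}$$ for every $F\in L^{q',\infty}_1(\mathbf R^{2d})$ and $f,g\in L^q(\mathbf R^d)$.
   Context: $1/q+1/q'=1$; $\langle x\rangle=(1+|x|^2)^{1/2}$. $L^q_r(\mathbf R^d)$ is the space of measurable $g$ with $\|g\|_{L^q_r}=\|g\langle\cdot\rangle^r\|_{L^q}<\infty$. For $p,q\in[1,\infty]$, $L^{p,q}_1(\mathbf R^{2d})$ is the space of $F\in L^1_{loc}(\mathbf R^{2d})$ with finite norm $$\|F\|_{L^{p,q}_1}=\Big(\int\Big(\int|F(\xi,\eta)|^p\,d\xi\Big)^{q/p}d\eta\Big)^{1/q},$$ and $L^{p,q}_2(\mathbf R^{2d})$ is the space of $F\in L^1_{loc}(\mathbf R^{2d})$ with finite norm $$\|F\|_{L^{p,q}_2}=\Big(\int\Big(\int|F(\xi,\eta)|^q\,d\eta\Big)^{p/q}d\xi\Big)^{1/p},$$ with the usual modifications when $p=\infty$ or $q=\infty$.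
   Formalization: For q=∞ uniqueness among norm-continuous extensions is false (C_0^∞ is not dense in L^∞); there the extension is also shown separately sequentially weak-* continuous, and uniqueness is claimed only among norm-continuous extensions with that property. *)

(* Defs.v *)
From HB Require Import structures.
From mathcomp Require Import all_boot all_order all_algebra.
From mathcomp Require Import all_classical all_reals all_analysis.
From mathcomp Require Import complex.
Set Implicit Arguments.
Unset Strict Implicit.
Unset Printing Implicit Defensive.
Import Order.TTheory GRing.Theory Num.Theory.
Import numFieldNormedType.Exports.
Import ComplexField.Normc.
Local Open Scope classical_set_scope.
Local Open Scope ring_scope.
Local Open Scope complex_scope.

Definition rV_display : measure_display.
Proof. exact: default_measure_display. Qed.

Section rV_measurable.
Context (R : realType) (d : nat).

Definition coord (i : 'I_d) (x : 'rV[R]_d) : R := x ord0 i.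

Let coord_set0 : g_sigma_preimage coord set0.
Proof. exact: sigma_algebra0. Qed.

Let coord_setC A : g_sigma_preimage coord A -> g_sigma_preimage coord (~` A).
Proof. exact: sigma_algebraC. Qed.

Let coord_bigcup (F : (set 'rV[R]_d)^nat) :
  (forall i, g_sigma_preimage coord (F i)) ->
  g_sigma_preimage coord (\bigcup_i (F i)).
Proof. exact: sigma_algebra_bigcup. Qed.

(* Generated by the coordinate maps; since R is second countable, this is the
   Borel sigma-algebra of the topology of 'rV[R]_d. *)
HB.instance Definition _ := @isMeasurable.Build rV_display
  'rV[R]_d (g_sigma_preimage coord) coord_set0 coord_setC coord_bigcup.

Lemma measurable_coord (i : 'I_d) : measurable_fun [set: 'rV[R]_d] (coord i).
Proof.
move=> _ B mB; apply: sub_sigma_algebra.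
by rewrite (bigD1 i)//=; left; exists B.
Qed.

Lemma measurable_fun_coordP d1 (T : measurableType d1) (f : T -> 'rV[R]_d) :
  (forall i, measurable_fun [set: T] (coord i \o f)) ->
  measurable_fun [set: T] f.
Proof.
move=> mf; apply: (measurability
  (\big[setU/set0]_(i < d) preimage_set_system setT (coord i) measurable)) => //.
move=> _ [B + <-].
elim/big_ind : _ => [//|S1 S2 h1 h2 [/h1|/h2]//|i _ [C mC <-]].
by rewrite [X in _ `&` (_ @^-1` X)]setTI; exact: (mf i).
Qed.

End rV_measurable.

(** Lebesgue measure on R^d, by iterated products along
    R^(d+1) = R x R^d. *)
Section lebesgue_rV.
Context (R : realType).

Definition rV_cons d (p : R * 'rV[R]_d) : 'rV[R]_d.+1 :=
  row_mx (p.1%:M : 'rV_1) p.2.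

Definition rV_uncons d (x : 'rV[R]_d.+1) : R * 'rV[R]_d :=
  (coord ord0 x, \row_i coord (lift ord0 i) x).

Lemma coord_cons0 d (p : R * 'rV[R]_d) : coord ord0 (rV_cons p) = p.1.
Proof.
rewrite /coord /rV_cons.
have -> : (ord0 : 'I_d.+1) = lshift d (ord0 : 'I_1) by exact: val_inj.
by rewrite (row_mxEl (p.1%:M : 'rV_1)) mxE eqxx.
Qed.

Lemma coord_consS d (p : R * 'rV[R]_d) i :
  coord (lift ord0 i) (rV_cons p) = coord i p.2.
Proof.
rewrite /coord /rV_cons.
have -> : (lift ord0 i : 'I_d.+1) = rshift 1 i by exact: val_inj.
by rewrite (row_mxEr (p.1%:M : 'rV_1)).
Qed.

Lemma rV_consK d : cancel (@rV_cons d) (@rV_uncons d).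
Proof.
move=> p; rewrite /rV_uncons coord_cons0 [RHS]surjective_pairing.
by congr pair; apply/rowP => i; rewrite mxE coord_consS.
Qed.

Lemma measurable_rV_cons d : measurable_fun setT (@rV_cons d).
Proof.
apply: measurable_fun_coordP => i; case: (unliftP ord0 i) => [j|] ->.
  rewrite (_ : _ \o _ = @coord R d j \o snd); last first.
    by apply/funext => p /=; rewrite coord_consS.
  apply: measurableT_comp; [exact: measurable_coord|exact: measurable_snd].
rewrite (_ : _ \o _ = fst); first exact: measurable_fst.
by apply/funext => p /=; rewrite coord_cons0.
Qed.

Lemma measurable_rV_uncons d : measurable_fun setT (@rV_uncons d).
Proof.
apply/measurable_fun_pairP; split; first exact: measurable_coord.
apply: measurable_fun_coordP => i.
rewrite (_ : _ \o _ = @coord R d.+1 (lift ord0 i)); first exact: measurable_coord.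
by apply/funext => x; rewrite /coord /= mxE.
Qed.

Section step.
Context d (mu : {sigma_finite_measure set 'rV[R]_d -> \bar R}).

Definition leb_cons : set 'rV[R]_d.+1 -> \bar R :=
  pushforward (@lebesgue_measure R \x mu)%E (@rV_cons d).

Let leb_cons0 : leb_cons set0 = 0%E.
Proof. by rewrite /leb_cons /pushforward preimage_set0 measure0. Qed.

Let leb_cons_ge0 A : (0 <= leb_cons A)%E.
Proof. exact: (@measure_ge0 _ _ _ (@lebesgue_measure R \x mu)%E). Qed.

Let leb_cons_sigma_additive : semi_sigma_additive leb_cons.
Proof.
move=> F mF tF mUF; rewrite /leb_cons /pushforward preimage_bigcup.
apply: measure_semi_sigma_additive.
- by move=> n; rewrite -[X in measurable X]setTI; exact: measurable_rV_cons.
- apply/trivIsetP => i j _ _ ij; rewrite -preimage_setI.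
  by move/trivIsetP : tF => /(_ _ _ _ _ ij) ->//; rewrite preimage_set0.
- by rewrite -preimage_bigcup -[X in measurable X]setTI;
    exact: measurable_rV_cons.
Qed.

HB.instance Definition _ := isMeasure.Build _ _ _ leb_cons
  leb_cons0 leb_cons_ge0 leb_cons_sigma_additive.

Let leb_cons_sigma_finite : sigma_finite setT leb_cons.
Proof.
have /sigma_finiteP[F [TF ndF Foo]] := sigma_finiteT (@lebesgue_measure R).
have /sigma_finiteP[G [TG ndG Goo]] := sigma_finiteT mu.
exists (fun n => @rV_uncons d @^-1` (F n `*` G n)).
  rewrite -preimage_bigcup [X in _ @^-1` X](_ : _ = setT) ?preimage_setT//.
  apply/seteqP; split=> // -[x y] _.
  have [n _ Fnx] : (\bigcup_n F n) x by rewrite -TF.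
  have [k _ Gky] : (\bigcup_n G n) y by rewrite -TG.
  exists (maxn n k) => //; split.
  - by move: x Fnx; exact/subsetPset/ndF/leq_maxl.
  - by move: y Gky; exact/subsetPset/ndG/leq_maxr.
move=> n; have [mF Fn] := Foo n; have [mG Gn] := Goo n; split.
  rewrite -[X in measurable X]setTI; apply: measurable_rV_uncons => //.
  exact: measurableX.
rewrite /leb_cons /pushforward -comp_preimage.
rewrite (_ : _ \o _ = id); last by apply/funext => p; exact: rV_consK.
rewrite preimage_id [ltLHS](product_measure1E (@lebesgue_measure R) mu)//.
by rewrite lte_mul_pinfty// ge0_fin_numE.
Qed.

HB.instance Definition _ := Measure_isSigmaFinite.Build _ _ _ leb_cons
  leb_cons_sigma_finite.

End step.

Fixpoint leb (d : nat) : {sigma_finite_measure set 'rV[R]_d -> \bar R} :=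
  match d with
  | 0 => \d_(0 : 'rV[R]_0)
  | d'.+1 => leb_cons (leb d')
  end.

End lebesgue_rV.

Section function_spaces.
Context (R : realType) (d : nat).
Notation V := 'rV[R]_d.
Notation leb := (@leb R d).

Definition cmeasurable d1 (T : measurableType d1) (f : T -> R[i]) : Prop :=
  measurable_fun setT (fun x => complex.Re (f x)) /\
  measurable_fun setT (fun x => complex.Im (f x)).

Definition cintegral (f : V -> R[i]) : R[i] :=
  (\int[leb]_x complex.Re (f x)) +i* (\int[leb]_x complex.Im (f x)).

Definition partial (i : 'I_d) (f : V -> R) : V -> R :=
  fun x => 'D_(delta_mx ord0 i) f x.

Definition smooth (f : V -> R) : Prop := forall s : seq 'I_d,
  continuous (foldr partial f s) /\
  forall i x, derivable (foldr partial f s) x (delta_mx ord0 i).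

Definition test_function (f : V -> R[i]) : Prop :=
  [/\ smooth (fun x => complex.Re (f x)), smooth (fun x => complex.Im (f x)) &
      compact (closure [set x | f x != 0])].

Definition japanese (x : V) : R :=
  Num.sqrt (1 + \sum_(i < d) (x ord0 i) ^+ 2).

Definition normLq (q : \bar R) (f : V -> R[i]) : \bar R :=
  Lnorm leb q (fun x => (normc (f x))%:E).

Definition normLqr (q : \bar R) (r : R) (g : V -> R[i]) : \bar R :=
  normLq q (fun x => g x * (japanese x `^ r)%:C).

Definition Lq (q : \bar R) (f : V -> R[i]) : Prop :=
  cmeasurable f /\ (normLq q f < +oo)%E.

Definition Lqr (q : \bar R) (r : R) (g : V -> R[i]) : Prop :=
  cmeasurable g /\ (normLqr q r g < +oo)%E.

Definition L1loc (F : V * V -> R[i]) : Prop :=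
  cmeasurable F /\
  forall K : set (V * V), compact K ->
    (\int[leb \x leb]_(z in K) (normc (F z))%:E < +oo)%E.

Definition normL1 (p q : \bar R) (F : V * V -> R[i]) : \bar R :=
  Lnorm leb q (fun eta => Lnorm leb p (fun xi => (normc (F (xi, eta)))%:E)).

Definition normL2 (p q : \bar R) (F : V * V -> R[i]) : \bar R :=
  Lnorm leb p (fun xi => Lnorm leb q (fun eta => (normc (F (xi, eta)))%:E)).

Definition L1pq (p q : \bar R) (F : V * V -> R[i]) : Prop :=
  L1loc F /\ (normL1 p q F < +oo)%E.

Definition L2pq (p q : \bar R) (F : V * V -> R[i]) : Prop :=
  L1loc F /\ (normL2 p q F < +oo)%E.

Definition TF (F : V * V -> R[i]) (f g : V -> R[i]) : V -> R[i] :=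
  fun xi => cintegral (fun eta => F (xi, eta) * f eta * g (xi - eta)).

Definition ae_equal (f g : V -> R[i]) : Prop :=
  {ae leb, forall x, f x = g x}.

(* Maps between Lebesgue spaces are represented on functions. Continuity for
   the (semi)norms, as stated here, already forces [T] to respect equality
   almost everywhere, so [T] descends to the spaces of classes. *)
Definition norm_continuous (q : \bar R) (r : R)
    (T : (V -> R[i]) -> (V -> R[i]) -> V -> R[i]) : Prop :=
  forall f g, Lq q f -> Lqr q r g -> forall e : R, 0 < e ->
  exists2 delta : R, 0 < delta &
    forall f' g', Lq q f' -> Lqr q r g' ->
      (normLq q (fun x => f' x - f x)%R < delta%:E)%E ->
      (normLqr q r (fun x => g' x - g x)%R < delta%:E)%E ->
      (normLq q (fun x => T f' g' x - T f g x)%R < e%:E)%E.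

(* Weak-* convergence in L^oo_r, the dual of L^1_(-r). *)
Definition weakstar_cvg (r : R) (u : (V -> R[i])^nat) (v : V -> R[i]) : Prop :=
  forall h, Lqr 1 (- r) h ->
    (fun n => normc (cintegral (fun x => u n x * h x) -
                     cintegral (fun x => v x * h x))) @ \oo --> (0 : R).

Definition weakstar_continuous (r : R)
    (T : (V -> R[i]) -> (V -> R[i]) -> V -> R[i]) : Prop :=
  (forall (u : (V -> R[i])^nat) f g, (forall n, Lq +oo (u n)) -> Lq +oo f ->
     Lqr +oo r g -> weakstar_cvg 0 u f ->
     weakstar_cvg 0 (fun n => T (u n) g) (T f g)) /\
  (forall f (u : (V -> R[i])^nat) g, Lq +oo f -> (forall n, Lqr +oo r (u n)) ->
     Lqr +oo r g -> weakstar_cvg r u g ->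
     weakstar_cvg 0 (fun n => T f (u n)) (T f g)).

(* [T] is a continuous map L^q x L^q_r -> L^q extending
   (f, g) |-> TF F f g from C_0^oo x C_0^oo; r = 0 gives L^q_0 = L^q.
   For q = +oo the test functions are not norm dense, and norm continuity alone
   does not determine an extension; they are weak-* dense, so in this case
   (sequential) weak-* continuity in each variable is also required. *)
Definition continuous_extension (q : \bar R) (r : R) (F : V * V -> R[i])
    (T : (V -> R[i]) -> (V -> R[i]) -> V -> R[i]) : Prop :=
  [/\ forall f g, Lq q f -> Lqr q r g -> Lq q (T f g),
      norm_continuous q r T,
      q = +oo%E -> weakstar_continuous r T &
      forall f g, test_function f -> test_function g ->
        ae_equal (T f g) (TF F f g)].

Definition unique_continuous_extension (q : \bar R) (r : R)
    (F : V * V -> R[i])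
    (T : (V -> R[i]) -> (V -> R[i]) -> V -> R[i]) : Prop :=
  continuous_extension q r F T /\
  forall T', continuous_extension q r F T' ->
    forall f g, Lq q f -> Lqr q r g -> ae_equal (T' f g) (T f g).

End function_spaces.

(* Main.v *)
Require Import Defs.
From mathcomp Require Import all_boot all_order all_algebra.
From mathcomp Require Import all_classical all_reals all_analysis.
From mathcomp Require Import measurable_realfun ess_sup_inf complex ring lra.

(** The operator itself is the extension. Put
      N(f, g)(xi) = int |F(xi, eta)| |f(eta)| |g(xi - eta)| d eta.
    If N is bounded from L^q x L^q_r to L^q ([bounded_kernel]), then the integral
    that defines TF F f g converges for almost every xi whenever f is in L^q and
    g is in L^q_r, its norm obeys the same bound, and it is bilinear up to null
    sets, hence norm continuous. Therefore the proposition splits into a bound on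
    N in each of the three cases and a statement about extensions that knows F
    only through this bound.

    Bounds. Write a = |F|, b = |f|, c = |g(xi - .)|, p for a finite exponent and
    p' for its conjugate. All three are Hoelder's inequality in eta followed by
    Tonelli's theorem and the invariance of Lebesgue measure under xi - eta
    ([ge0_integral_reflect]).
    In the first case (int a b c)^p <= (int a^p')^(p/p') int b^p c^p, and the last
    integral is a convolution of b^p and c^p ([trilinear_le_fiber]).
    In the second, (int a b c)^p <= (int a^p b^p) (int c^p')^(p/p'), and the
    first factor is integrated in xi first ([trilinear_le_hoelder]). The p'-norm
    of g is controlled by its weighted p-norm because a power of <x> that decays
    faster than |x|^-d is integrable ([integral_weighted_embedding]).
    In the third, for 1 < p < 2, the splitting
      a b c = (a^p' b^p)^(1/p') (b^p c^p)^((2 - p)/p) (c^p)^(1/p')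
    leaves two functions of xi, one bounded as in the second case and the other a
    convolution. Raised to the power p they carry the exponents p - 1 and 2 - p,
    whose sum is 1, so that a further application of Hoelder's inequality in xi
    closes the estimate ([trilinear_le_hoelder3]). The exponents 1, 2 and oo are
    limiting cases.

    Weak-* continuity for q = oo. By Fubini's theorem the pairing of TF F f g with
    h in L^1 equals the pairing of f with k(eta) = int F(xi, eta) g(xi - eta)
    h(xi) d xi, and the bound on N puts k in the predual of the space of f
    ([TF_weakstar_continuous]). The substitution eta -> xi - eta exchanges the
    roles of f and g and gives the other variable.

    Uniqueness. Every function of L^q_r is obtained from smooth functions of
    compact support by iterated pointwise limits with a majorant in L^q_r
    ([dominated_density]). Such limits converge in norm for q < oo and weak-* for
    q = oo, so two continuous extensions that agree on test functions agree
    everywhere, one variable after the other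
    ([TF_unique_continuous_extension]). *)

Set Implicit Arguments.
Unset Strict Implicit.
Unset Printing Implicit Defensive.
Import Order.TTheory GRing.Theory Num.Theory.
Import numFieldNormedType.Exports.
Import ComplexField.Normc.
(* Restores [coord] to its meaning as a coordinate of a row vector. *)
Import Defs.
Local Open Scope classical_set_scope.
Local Open Scope ring_scope.

(** * Modulus and measurability of complex functions *)

Section complex_basics.
Context {R : realType}.
Implicit Types z w : R[i].

Lemma complex_ReD z w : complex.Re (z + w) = complex.Re z + complex.Re w.
Proof. by case: z => a b; case: w. Qed.
Lemma complex_ImD z w : complex.Im (z + w) = complex.Im z + complex.Im w.
Proof. by case: z => a b; case: w. Qed.
Lemma complex_ReN z : complex.Re (- z) = - complex.Re z.
Proof. by case: z. Qed.
Lemma complex_ImN z : complex.Im (- z) = - complex.Im z.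
Proof. by case: z. Qed.
Lemma complex_ReM z w : complex.Re (z * w) =
  complex.Re z * complex.Re w - complex.Im z * complex.Im w.
Proof. by case: z => a b; case: w. Qed.
Lemma complex_ImM z w : complex.Im (z * w) =
  complex.Re z * complex.Im w + complex.Im z * complex.Re w.
Proof. by case: z => a b; case: w. Qed.

Lemma complex_eqP z w : complex.Re z = complex.Re w ->
  complex.Im z = complex.Im w -> z = w.
Proof. by case: z => a b; case: w => c e /= -> ->. Qed.

Lemma normcE2 z : normc z = Num.sqrt (complex.Re z ^+ 2 + complex.Im z ^+ 2).
Proof. by case: z. Qed.

Lemma normc_ge0 z : 0 <= normc z.
Proof. by rewrite normcE2 sqrtr_ge0. Qed.

Lemma normcD_le z w : normc (z + w) <= normc z + normc w.
Proof. exact: (@le_normcD R). Qed.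

Lemma normc_opp z : normc (- z) = normc z.
Proof. exact: (@normcN R). Qed.

Lemma normcB z w : normc (z - w) = normc (w - z).
Proof. by rewrite -normc_opp opprB. Qed.

Lemma normc_eq0 z : (normc z == 0) = (z == 0).
Proof.
by apply/eqP/eqP => [/eq0_normc//|->]; rewrite normc0.
Qed.

Lemma normr_Re_le z : `|complex.Re z| <= normc z.
Proof. by rewrite normcE2 -sqrtr_sqr ler_wsqrtr// lerDl sqr_ge0. Qed.

Lemma normr_Im_le z : `|complex.Im z| <= normc z.
Proof. by rewrite normcE2 -sqrtr_sqr ler_wsqrtr// lerDr sqr_ge0. Qed.

Lemma normc_le z : normc z <= `|complex.Re z| + `|complex.Im z|.
Proof.
rewrite -(@ler_pXn2r _ 2) ?nnegrE ?normc_ge0 ?addr_ge0//.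
rewrite normcE2 sqr_sqrtr ?addr_ge0 ?sqr_ge0// sqrrD !real_normK ?num_real//.
by rewrite lerD2r lerDl mulrn_wge0// mulr_ge0.
Qed.

Lemma normc_real (x : R) : normc (x%:C)%C = `|x|.
Proof. by rewrite /= expr0n/= addr0 sqrtr_sqr. Qed.

(** Every complex number is turned into its modulus by a factor of modulus at
    most one, which is how the triangle inequality for the integral reduces
    to real integrals. *)
Lemma normc_rotation z : exists2 c : R[i], normc c <= 1 &
  c * z = ((normc z)%:C)%C.
Proof.
have [->|z0] := eqVneq z 0.
  by exists 0; rewrite ?normc0 ?mulr0.
exists ((normc z)%:C%C / z).
  by rewrite normcM normcV normc_real ger0_norm ?normc_ge0// divff// normc_eq0.
by rewrite divfK.
Qed.

End complex_basics.

Section cmeasurable_theory.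
Context {R : realType} d1 (T : measurableType d1).
Implicit Types f g : T -> R[i].

Lemma cmeasurableD f g : cmeasurable f -> cmeasurable g ->
  cmeasurable (fun x => f x + g x).
Proof.
move=> [f1 f2] [g1 g2]; split.
  by under eq_fun do rewrite complex_ReD; exact: measurable_funD.
by under eq_fun do rewrite complex_ImD; exact: measurable_funD.
Qed.

Lemma cmeasurableN f : cmeasurable f -> cmeasurable (fun x => - f x).
Proof.
move=> [f1 f2]; split.
  by under eq_fun do rewrite complex_ReN; exact: measurableT_comp.
by under eq_fun do rewrite complex_ImN; exact: measurableT_comp.
Qed.

Lemma cmeasurableB f g : cmeasurable f -> cmeasurable g ->
  cmeasurable (fun x => f x - g x).
Proof. by move=> mf mg; apply: cmeasurableD => //; exact: cmeasurableN. Qed.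

Lemma cmeasurableM f g : cmeasurable f -> cmeasurable g ->
  cmeasurable (fun x => f x * g x).
Proof.
move=> [f1 f2] [g1 g2]; split.
  under eq_fun do rewrite complex_ReM.
  by apply: measurable_funB; exact: measurable_funM.
under eq_fun do rewrite complex_ImM.
by apply: measurable_funD; exact: measurable_funM.
Qed.

Lemma cmeasurable_cst (c : R[i]) : cmeasurable (fun _ : T => c).
Proof. by split; exact: measurable_cst. Qed.

Lemma cmeasurable_real (f : T -> R) : measurable_fun setT f ->
  cmeasurable (fun x => ((f x)%:C)%C).
Proof. by move=> mf; split => //=; exact: measurable_cst. Qed.

Lemma cmeasurable_comp d2 (S : measurableType d2) (h : S -> T) f :
  cmeasurable f -> measurable_fun setT h -> cmeasurable (fun x => f (h x)).
Proof.
move=> [f1 f2] mh; split.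
  exact: (measurableT_comp f1 mh).
exact: (measurableT_comp f2 mh).
Qed.

Lemma measurable_normc f : cmeasurable f ->
  measurable_fun setT (fun x => normc (f x)).
Proof.
move=> [f1 f2]; under eq_fun do rewrite normcE2.
apply: (@measurableT_comp _ _ _ _ _ _ (@Num.sqrt R)).
  exact: (continuous_measurable_fun (@sqrt_continuous R)).
by apply: measurable_funD; apply: (measurableT_comp (exprn_measurable _)).
Qed.

Lemma emeasurable_normc f : cmeasurable f ->
  measurable_fun setT (fun x => (normc (f x))%:E).
Proof. by move=> mf; apply/measurable_EFinP; exact: measurable_normc. Qed.

End cmeasurable_theory.

(** * Integration of complex functions *)

Section cintegral_theory.
Context {R : realType} {d : nat}.
Notation V := 'rV[R]_d.
Notation leb := (@leb R d).
Implicit Types f g : V -> R[i].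

Definition cintegrable f : Prop :=
  cmeasurable f /\ (\int[leb]_x (normc (f x))%:E < +oo)%E.

Lemma integrable_of_normc f (u : V -> R) : cintegrable f ->
  measurable_fun setT u -> (forall x, `|u x| <= normc (f x)) ->
  leb.-integrable setT (EFin \o u).
Proof.
move=> [mf If] mu uf; apply/integrableP; split; first exact/measurable_EFinP.
apply: le_lt_trans If; apply: ge0_le_integral => //.
- by apply/measurable_EFinP; exact: measurableT_comp.
- exact: emeasurable_normc.
- by move=> x _; rewrite /= lee_fin.
Qed.

Lemma cintegrable_Re f : cintegrable f ->
  leb.-integrable setT (EFin \o (fun x => complex.Re (f x))).
Proof.
move=> If; apply: (integrable_of_normc If); first by case: If => -[].
by move=> x; exact: normr_Re_le.
Qed.

Lemma cintegrable_Im f : cintegrable f ->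
  leb.-integrable setT (EFin \o (fun x => complex.Im (f x))).
Proof.
move=> If; apply: (integrable_of_normc If); first by case: If => -[].
by move=> x; exact: normr_Im_le.
Qed.

Lemma cintegrableZ (c : R[i]) f : cintegrable f ->
  cintegrable (fun x => c * f x).
Proof.
move=> [mf If]; split; first by apply: cmeasurableM => //; exact: cmeasurable_cst.
under eq_integral do rewrite normcM EFinM.
rewrite ge0_integralZl//.
- by rewrite lte_mul_pinfty// lee_fin normc_ge0.
- exact: emeasurable_normc.
- by move=> x _; rewrite lee_fin normc_ge0.
- by rewrite lee_fin normc_ge0.
Qed.

Lemma cintegrableN f : cintegrable f -> cintegrable (fun x => - f x).
Proof.
move=> If; rewrite (_ : (fun x => _) = fun x => (-1) * f x).
  exact: cintegrableZ.
by apply/funext => x; rewrite mulN1r.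
Qed.

Lemma cintegralD f g : cintegrable f -> cintegrable g ->
  cintegral (fun x => f x + g x) = cintegral f + cintegral g.
Proof.
move=> If Ig; apply: complex_eqP.
  rewrite complex_ReD /=; under eq_Rintegral do rewrite complex_ReD.
  by rewrite RintegralD//; exact: cintegrable_Re.
rewrite complex_ImD /=; under eq_Rintegral do rewrite complex_ImD.
by rewrite RintegralD//; exact: cintegrable_Im.
Qed.

Lemma cintegralZ (c : R[i]) f : cintegrable f ->
  cintegral (fun x => c * f x) = c * cintegral f.
Proof.
move=> If; have Ir := cintegrable_Re If; have Ii := cintegrable_Im If.
have IZ (a : R) (u : V -> R) : leb.-integrable setT (EFin \o u) ->
    leb.-integrable setT (EFin \o (fun x => a * u x)).
  move=> Iu; rewrite (_ : _ \o _ = (fun x => a%:E * (EFin \o u) x)%E)//.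
  exact: integrableZl.
apply: complex_eqP.
  rewrite complex_ReM /=; under eq_Rintegral do rewrite complex_ReM.
  by rewrite RintegralB ?RintegralZl//; exact: IZ.
rewrite complex_ImM /=; under eq_Rintegral do rewrite complex_ImM.
by rewrite RintegralD ?RintegralZl//; exact: IZ.
Qed.

Lemma cintegralB f g : cintegrable f -> cintegrable g ->
  cintegral (fun x => f x - g x) = cintegral f - cintegral g.
Proof.
move=> If Ig; rewrite cintegralD//; last exact: cintegrableN.
congr (_ + _); rewrite -mulN1r -cintegralZ//.
by congr cintegral; apply/funext => x; rewrite mulN1r.
Qed.

(** The integral is rotated onto the positive real axis, after which only real
    parts matter. *)
Lemma normc_cintegral_le f : cmeasurable f ->
  ((normc (cintegral f))%:E <= \int[leb]_x (normc (f x))%:E)%E.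
Proof.
move=> mf; have [If|] := ltP (\int[leb]_x (normc (f x))%:E)%E +oo%E; last first.
  by rewrite leye_eq => /eqP ->; rewrite leey.
have {}If : cintegrable f by [].
have [c c1 cI] := normc_rotation (cintegral f).
have Ic := cintegrableZ c If.
have -> : normc (cintegral f) = \int[leb]_x complex.Re (c * f x).
  by rewrite -[LHS]/(complex.Re ((normc (cintegral f))%:C)%C) -cI -cintegralZ.
rewrite /Rintegral fineK; last exact: integrable_fin_num (cintegrable_Re Ic).
apply: le_integral => //.
- exact: cintegrable_Re.
- apply: (integrable_of_normc If); first exact: measurable_normc If.1.
  by move=> x; rewrite ger0_norm ?normc_ge0.
- move=> x _; rewrite lee_fin (le_trans (ler_norm _))//.
  by rewrite (le_trans (normr_Re_le _))// normcM ler_piMl ?normc_ge0.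
Qed.

Lemma eq_cintegral f g : f =1 g -> cintegral f = cintegral g.
Proof. by move=> /funext ->. Qed.

Lemma ae_eq_cintegral f g : cmeasurable f -> cmeasurable g ->
  ae_equal f g -> cintegral f = cintegral g.
Proof.
move=> [mf1 mf2] [mg1 mg2] fg.
by congr (_ +i* _)%C; congr fine; apply: ae_eq_integral => //;
  (try by apply/measurable_EFinP); apply: filterS fg => x -> _.
Qed.

(** Real and imaginary parts are differences of Tonelli integrals of the positive
    and negative parts, which are measurable without any integrability. *)
Lemma cmeasurable_cintegral (K : V * V -> R[i]) : cmeasurable K ->
  cmeasurable (fun x => cintegral (fun y => K (x, y))).
Proof.
have mint (k : V * V -> R) : measurable_fun setT k ->
    measurable_fun setT (fun x => \int[leb]_y k (x, y)).
  move=> mk; have mk' : measurable_fun setT (EFin \o k) by exact/measurable_EFinP.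
  have mp := measurable_fun_fubini_tonelli_F (m2 := leb) _
    (measurable_funepos mk') (fun x => funepos_ge0 _ x).
  have mn := measurable_fun_fubini_tonelli_F (m2 := leb) _
    (measurable_funeneg mk') (fun x => funeneg_ge0 _ x).
  have := measurableT_comp (@fine_measurable R setT measurableT)
    (emeasurable_funB mp mn).
  apply: eq_measurable_fun => x _ /=.
  by rewrite /= /Rintegral [in RHS]integralE; congr (fine (_ - _)%E); apply: eq_integral => y _; rewrite ?funeposE ?funenegE.
move=> [m1 m2]; split.
  exact: (mint (fun z => complex.Re (K z)) m1).
exact: (mint (fun z => complex.Im (K z)) m2).
Qed.

Lemma cFubini (K : V * V -> R[i]) : cmeasurable K ->
  (\int[leb]_x \int[leb]_y (normc (K (x, y)))%:E < +oo)%E ->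
  cintegral (fun x => cintegral (fun y => K (x, y))) =
  cintegral (fun y => cintegral (fun x => K (x, y))).
Proof.
move=> mK IK.
have rFubini (k : V * V -> R) : measurable_fun setT k ->
    (forall z, `|k z| <= normc (K z)) ->
    \int[leb]_x \int[leb]_y k (x, y) = \int[leb]_y \int[leb]_x k (x, y).
  move=> mk kK.
  have mk' : measurable_fun setT (EFin \o k) by exact/measurable_EFinP.
  have Ik : (leb \x leb)%E.-integrable setT (EFin \o k).
    apply/integrable12ltyP => //; apply: le_lt_trans IK.
    apply: ge0_le_integral => //.
    - by move=> x _; apply: integral_ge0.
    - by apply: (measurable_fun_fubini_tonelli_F
        (fun z => `|(EFin \o k) z|)%E) => //; exact: measurableT_comp.
    - apply: (measurable_fun_fubini_tonelli_F
        (fun z => (normc (K z))%:E)) => //.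
        exact: emeasurable_normc.
      by move=> z; rewrite lee_fin normc_ge0.
    - move=> x _; apply: ge0_le_integral => //.
      + by apply: measurableT_comp => //; exact: measurableT_comp.
      + exact: (measurableT_comp (emeasurable_normc mK) (pair1_measurable x)).
      + by move=> y _; rewrite /= lee_fin.
  have fub := Fubini Ik.
  (* An inner real integral is the [fine] of an extended one, and it loses nothing
     only for the almost every x whose section is integrable. *)
  rewrite /Rintegral; transitivity (fine (\int[leb]_x \int[leb]_y (k (x, y))%:E)%E).
    congr fine; apply: ae_eq_integral => //.
    - apply/measurable_EFinP/(measurableT_comp (@fine_measurable R setT measurableT)).
      exact: (measurable_fubini_F Ik).
    - exact: (measurable_fubini_F Ik).
    - apply: filterS (ae_integrable1 Ik) => x Ix _.
      by rewrite fineK//; exact: (integrable_fin_num _ Ix).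
  rewrite fub; congr fine; apply: ae_eq_integral => //.
    - exact: (measurable_fubini_G Ik).
    - apply/measurable_EFinP/(measurableT_comp (@fine_measurable R setT measurableT)).
      exact: (measurable_fubini_G Ik).
    - apply: filterS (ae_integrable2 Ik) => x Ix _.
      by rewrite fineK//; exact: (integrable_fin_num _ Ix).
case: (mK) => m1 m2; apply: complex_eqP => /=.
  by apply: (rFubini (fun z => complex.Re (K z))) => // z; exact: normr_Re_le.
by apply: (rFubini (fun z => complex.Im (K z))) => // z; exact: normr_Im_le.
Qed.

End cintegral_theory.

(** * Invariance of Lebesgue measure *)

Section leb_theory.
Context {R : realType}.
Local Notation V d := 'rV[R]_d.

Lemma ge0_integral_lebS d (g : V d.+1 -> \bar R) : measurable_fun setT g ->
  (forall x, 0 <= g x)%E ->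
  (\int[@leb R d.+1]_x g x =
   \int[@lebesgue_measure R]_s \int[@leb R d]_y g (rV_cons (s, y)))%E.
Proof.
move=> mg g0.
have mc : measurable_fun [set: (measurableTypeR R * V d)%type] (@rV_cons R d).
  exact: measurable_rV_cons.
transitivity (\int[@lebesgue_measure R \x @leb R d]_z (g \o @rV_cons R d) z)%E.
  rewrite -[RHS](@ge0_integral_pushforward _ _ _ _ _ _ mc
    (@lebesgue_measure R \x @leb R d)%E setT)//.
rewrite fubini_tonelli1//; first exact: measurableT_comp.
by move=> z; exact: g0.
Qed.

Lemma ge0_integral_leb0 (g : V 0 -> \bar R) : measurable_fun setT g ->
  (forall x, 0 <= g x)%E -> (\int[@leb R 0]_x g x = g 0%R)%E.
Proof. by move=> mg g0; rewrite /= integral_dirac// diracT mul1e. Qed.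

(** The essential supremum is the value of the norm at exponent oo only on a space
    of positive measure. *)
Lemma leb_setT_gt0 d : (0 < @leb R d setT)%E.
Proof.
elim: d => [|d IH]; first by rewrite /= diracT.
have -> : (@leb R d.+1 setT = \int[@leb R d.+1]_x (cst 1 x))%E.
  by rewrite integral_cst// mul1e.
rewrite ge0_integral_lebS//=.
under eq_integral do rewrite integral_cst// mul1e.
rewrite integral_cst//.
have RT : (@lebesgue_measure R setT = +oo)%E.
  by rewrite -[X in lebesgue_measure X]set_itvNyy lebesgue_measure_itv.
by rewrite [X in (_ * X)%E]RT gt0_muley.
Qed.

Lemma ge0_integral_reflectR (a : R) (g : R -> \bar R) : measurable_fun setT g ->
  (forall x, 0 <= g x)%E ->
  (\int[@lebesgue_measure R]_x g (a - x)%R =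
   \int[@lebesgue_measure R]_x g x)%E.
Proof.
move=> mg g0.
have mr : measurable_fun setT (fun x : measurableTypeR R => a - x : measurableTypeR R).
  exact: measurable_funB.
rewrite -[LHS](@ge0_integral_pushforward _ _ _ _ _ _ mr (@lebesgue_measure R) setT)//.
apply: eq_measure_integral => A mA _.
apply/esym/lebesgue_measure_unique => // _ [[b c]] _ <-.
rewrite -[RHS]/(lebesgue_measure ((fun x => a - x) @^-1` `]b, c])) /=.
rewrite (_ : _ @^-1` _ = `[a - c, a - b[%classic); last first.
  apply/seteqP; split => x /=; rewrite !in_itv/= => /andP[h1 h2].
    by apply/andP; split; lra.
  by apply/andP; split; lra.
rewrite !lebesgue_measure_itv/= !lte_fin -!EFinB.
by rewrite ltrD2l ltrN2; case: ifP => // _; congr (_%:E); ring.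
Qed.

Lemma measurable_rV_sub d d1 (T : measurableType d1) (f g : T -> V d) :
  measurable_fun setT f -> measurable_fun setT g ->
  measurable_fun setT (fun x => f x - g x).
Proof.
move=> mf mg; apply: measurable_fun_coordP => i.
rewrite (_ : _ \o _ = (coord i \o f) \- (coord i \o g)); last first.
  by apply/funext => x; rewrite /coord /= !mxE.
by apply: measurable_funB; apply: measurableT_comp => //; exact: measurable_coord.
Qed.

(** Reflections rather than translations, because x |-> a - x is the map that
    occurs in a convolution and two reflections compose to a translation. The
    measure being an iterated product, a reflection acts on each line separately
    and the induction only has to treat the line. *)
Lemma ge0_integral_reflect d (a : V d) (g : V d -> \bar R) :
  measurable_fun setT g -> (forall x, 0 <= g x)%E ->
  (\int[@leb R d]_x g (a - x)%R = \int[@leb R d]_x g x)%E.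
Proof.
elim: d a g => [|d IH] a g mg g0.
  by apply: eq_integral => x _; congr g; apply/rowP => -[].
have msub : measurable_fun setT (fun x : V d.+1 => g (a - x)).
  by apply: (measurableT_comp mg); apply: measurable_rV_sub.
rewrite (ge0_integral_lebS msub (fun x => g0 (a - x))) (ge0_integral_lebS mg g0).
pose a' : V d := \row_i coord (lift ord0 i) a.
have E s y : a - rV_cons (s, y) = rV_cons (coord ord0 a - s, a' - y).
  apply/rowP => i; case: (unliftP ord0 i) => [j|] ->.
    transitivity (coord (lift ord0 j) (a - rV_cons (s, y))) => //.
    rewrite -[RHS]/(coord _ _) coord_consS [LHS]mxE [X in _ + X]mxE.
    by rewrite -/(coord _ (rV_cons (s, y))) coord_consS /coord !mxE.
  transitivity (coord ord0 (a - rV_cons (s, y))) => //.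
  rewrite -[RHS]/(coord _ _) coord_cons0 [LHS]mxE [X in _ + X]mxE.
  by rewrite -/(coord _ (rV_cons (s, y))) coord_cons0.
have mc s : measurable_fun setT (fun y => g (rV_cons (s, y))).
  apply: (measurableT_comp mg).
  exact: (measurableT_comp (@measurable_rV_cons R d) (pair1_measurable s)).
under eq_integral do under eq_integral do rewrite E.
under eq_integral => s _.
  rewrite (IH a' (fun y => g (rV_cons (coord ord0 a - s, y))))//.
  over.
apply: (ge0_integral_reflectR (coord ord0 a)
  (g := fun s => \int[@leb R d]_y g (rV_cons (s, y)))%E).
  apply: (measurable_fun_fubini_tonelli_F (g \o @rV_cons R d)).
    exact: (measurableT_comp mg (@measurable_rV_cons R d)).
  by move=> z; exact: g0.
by move=> s; exact: integral_ge0.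
Qed.

Lemma ge0_integral_translate d (a : V d) (g : V d -> \bar R) :
  measurable_fun setT g -> (forall x, 0 <= g x)%E ->
  (\int[@leb R d]_x g (x - a)%R = \int[@leb R d]_x g x)%E.
Proof.
move=> mg g0; pose h (y : V d) := g (0 - y).
have mh : measurable_fun setT h.
  by apply: (measurableT_comp mg); apply: measurable_rV_sub.
transitivity (\int[@leb R d]_x h (a - x)%R)%E.
  by apply: eq_integral => x _; rewrite /h sub0r opprB.
rewrite (ge0_integral_reflect a mh); last by move=> x; exact: g0.
exact: (ge0_integral_reflect 0 mg g0).
Qed.

Lemma ge0_integral_prod d (phi : R -> R) : measurable_fun setT phi ->
  (forall s, 0 <= phi s) ->
  (\int[@leb R d]_x (\prod_(i < d) phi (coord i x))%:E =
   (\int[@lebesgue_measure R]_s (phi s)%:E) ^+ d)%E.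
Proof.
move=> mphi phi0.
have mprod n : measurable_fun setT (fun x : V n => (\prod_(i < n) phi (coord i x))%:E).
  apply/measurable_EFinP; elim: (index_enum _) => [|i s IH].
    by under eq_fun do rewrite big_nil; exact: measurable_cst.
  under eq_fun do rewrite big_cons; apply: measurable_funM => //.
  by apply: measurableT_comp => //; exact: measurable_coord.
have p0 n (x : V n) : (0 <= (\prod_(i < n) phi (coord i x))%:E)%E.
  by rewrite lee_fin prodr_ge0.
elim: d => [|d IH].
  by rewrite ge0_integral_leb0// big_ord0 expe0.
rewrite ge0_integral_lebS//.
transitivity (\int[@lebesgue_measure R]_s ((phi s)%:E *
    \int[@leb R d]_y (\prod_(i < d) phi (coord i y))%:E))%E.
  apply: eq_integral => s _.
  rewrite -ge0_integralZl//; [|exact: mprod|by rewrite lee_fin].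
  apply: eq_integral => y _; rewrite big_ord_recl coord_cons0 -EFinM.
  by congr (_ * _)%:E; apply: eq_bigr => i _; rewrite coord_consS.
rewrite ge0_integralZr//; [|exact/measurable_EFinP|by move=> s _; rewrite lee_fin|].
  by rewrite expeS; congr (_ * _)%E; exact: IH.
by apply: integral_ge0 => s _; exact: p0.
Qed.

End leb_theory.

(** * Integrability of powers of the Japanese bracket *)

Section japanese_theory.
Context {R : realType}.
Local Notation V d := 'rV[R]_d.

Lemma is_derive_powR_shift (a c x : R) : 0 < c + x ->
  is_derive x 1 (fun s => (c + s) `^ a) (a * (c + x) `^ (a - 1)).
Proof.
move=> cx0; have dp := is_derive1_powR a cx0.
have ds : is_derive x 1 (fun s => c + s) 1.
  rewrite -[X in is_derive _ _ _ X](add0r 1).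
  exact: (is_deriveD (is_derive_cst c x 1) (is_derive_id x 1)).
by have := is_derive1_comp dp ds; rewrite mulr1.
Qed.

Lemma powR_shift_cvg0 (b : R) : 0 < b ->
  (1 + s) `^ (- b) @[s --> +oo] --> (0 : R).
Proof.
move=> b0; apply/cvgr0Pnorm_lt => e e0.
near=> s.
have s1 : e^-1 `^ b^-1 < 1 + s.
  rewrite -ltrBlDl; near: s; by apply: nbhs_pinfty_gt; rewrite num_real.
have s0 : 0 < 1 + s by apply: le_lt_trans s1; exact: powR_ge0.
rewrite ger0_norm ?powR_ge0// powRN invf_plt ?posrE ?powR_gt0//.
have := @gt0_ltr_powR _ b b0 _ _ _ _ s1; rewrite !nnegrE => /(_ (powR_ge0 _ _) (ltW s0)).
by rewrite -powRrM mulVf ?gt_eqF// powRr1// invr_ge0 ltW.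
Unshelve. all: by end_near. Qed.

Lemma integral_powR_shift_lty (a : R) : 1 < a ->
  (\int[@lebesgue_measure R]_(s in `[0%R, +oo[) ((1 + s) `^ (- a))%:E < +oo)%E.
Proof.
move=> a1; pose F s : R := (1 + s) `^ (1 - a) / (1 - a).
have a10 : 1 - a != 0 by rewrite subr_eq0 lt_eqF.
have dF (s : R) : 0 <= s -> is_derive s 1 F ((1 + s) `^ (- a)).
  move=> s0; have s1 : 0 < 1 + s by rewrite ltr_pwDl.
  have := is_derive_powR_shift (1 - a) s1 => h.
  rewrite /F; apply: is_derive_eq; rewrite !scaler0 add0r /GRing.scale/=.
  by rewrite mulrA mulVf// mul1r; congr (_ `^ _); ring.
rewrite (@ge0_continuous_FTC2y _ _ F 0 0)//.
- by rewrite -EFinB ltry.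
- by move=> x _; exact: powR_ge0.
- apply: continuous_in_subspaceT => x; rewrite inE/= in_itv/= andbT => x0.
  have x1 : 0 < 1 + x by rewrite ltr_pwDl.
  apply: differentiable_continuous; apply/derivable1_diffP.
  by have [] := is_derive_powR_shift (- a) x1.
- rewrite [X in _ --> X](_ : _ = 0 / (1 - a)); last by rewrite mul0r.
  apply: cvgMl; have := @powR_shift_cvg0 (a - 1); rewrite opprB; apply.
  by rewrite subr_gt0.
- by move=> x /ltW /dF[].
- apply: cvg_at_right_filter; apply: differentiable_continuous.
  by apply/derivable1_diffP; case: (dF 0).
- move=> x; rewrite in_itv/= andbT => x0.
  by rewrite derive1E; have [_ ->] := dF _ (ltW x0).
Qed.

(** Comparison with (1 + s)^-a on the half-line, by (1 + s)^2 <= 2 (1 + s^2). *)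
Lemma integral_powR_1Dsqr_lty (a : R) : 1 < a ->
  (\int[@lebesgue_measure R]_s ((1 + s ^+ 2) `^ (- (a / 2)))%:E < +oo)%E.
Proof.
move=> a1; rewrite (@ge0_symfun_integralT _ (fun s => (1 + s ^+ 2) `^ (- (a / 2)))).
- rewrite -set_itvcy lte_mul_pinfty//.
  have mp : measurable_fun (`[0%R, +oo[ : set R) (fun x : R => (2 `^ (a / 2) * (1 + x) `^ (- a))%:E).
    apply/measurable_EFinP/measurable_funM => //.
    apply: (measurableT_comp (measurable_powR _)).
    exact: measurable_funD.
  apply: (@le_lt_trans _ _ (\int[@lebesgue_measure R]_(s in `[0%R, +oo[)
    (2 `^ (a / 2) * (1 + s) `^ (- a))%:E)%E).
    apply: ge0_le_integral => //.
    + by move=> x _; rewrite lee_fin powR_ge0.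
    + apply/measurable_EFinP; apply: (measurableT_comp (measurable_powR _)).
      by apply: measurable_funD => //; exact: measurable_funX.
    + move=> x /=; rewrite in_itv/= andbT => x0; rewrite lee_fin.
      have -> : (1 + x) `^ (- a) = ((1 + x) ^+ 2) `^ (- (a / 2)).
        by rewrite -powR_mulrn ?addr_ge0// -powRrM; congr (_ `^ _); field.
      have p1 : 0 < (1 + x ^+ 2) `^ (a / 2).
        by rewrite powR_gt0// ltr_pwDl// sqr_ge0.
      have p2 : 0 < ((1 + x) ^+ 2) `^ (a / 2).
        by rewrite powR_gt0// exprn_gt0// ltr_pwDl.
      rewrite !powRN ler_pdivlMr// ler_pdivrMl// -powRM//; last first.
        by rewrite addr_ge0 ?sqr_ge0.
      apply: ge0_ler_powR; rewrite ?nnegrE ?sqr_ge0//.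
      + by rewrite divr_ge0// ltW// (lt_trans _ a1).
      + by rewrite mulr_ge0// addr_ge0 ?sqr_ge0.
      + by rewrite -subr_ge0 (_ : _ - _ = (1 - x) ^+ 2) ?sqr_ge0//; ring.
  under eq_integral do rewrite EFinM.
  rewrite ge0_integralZl//.
  + by rewrite lte_mul_pinfty ?lee_fin ?powR_ge0//; exact: integral_powR_shift_lty.
  + apply/measurable_EFinP; apply: (measurableT_comp (measurable_powR _)).
    exact: measurable_funD.
  + by move=> x _; rewrite lee_fin powR_ge0.
- by move=> s; exact: powR_ge0.
- move=> s; apply: differentiable_continuous; apply/derivable1_diffP.
  have s0 : 0 < 1 + s ^+ 2 by rewrite ltr_pwDl// sqr_ge0.
  have ds : is_derive s 1 (fun s => s ^+ 2) (s *+ 2) by apply: is_derive_eq; rewrite /GRing.scale/=; ring.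
  by have [] := @is_derive1_comp _ (fun u => (1 + u) `^ (- (a / 2)))
    (fun s => s ^+ 2) _ _ _ (@is_derive_powR_shift (- (a / 2)) 1 (s ^+ 2) s0) ds.
- by move=> s /=; rewrite sqrrN.
Qed.

Lemma japanese_ge1 d (x : V d) : 1 <= japanese x.
Proof.
rewrite -[leLHS]sqrtr1 ler_wsqrtr// lerDl sumr_ge0// => i _.
exact: sqr_ge0.
Qed.

Lemma japanese_gt0 d (x : V d) : 0 < japanese x.
Proof. exact: lt_le_trans (japanese_ge1 x). Qed.

Lemma measurable_japanese d : measurable_fun setT (@japanese R d).
Proof.
apply: (@measurableT_comp _ _ _ _ _ _ (@Num.sqrt R)).
  exact: (continuous_measurable_fun (@sqrt_continuous R)).
apply: measurable_funD => //.
elim: (index_enum _) => [|i s IH].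
  by under eq_fun do rewrite big_nil; exact: measurable_cst.
under eq_fun do rewrite big_cons; apply: measurable_funD => //.
by apply: measurable_funX; exact: measurable_coord.
Qed.

Lemma measurable_japanese_powR d (t : R) :
  measurable_fun setT (fun x : V d => japanese x `^ t).
Proof.
apply: (measurableT_comp (measurable_powR t)); exact: measurable_japanese.
Qed.

(** Decay of order larger than the dimension is integrable. Since 1 + |x|^2
    dominates every 1 + x_i^2, its d-th power dominates their product, and the
    integral is at most a d-th power of an integral over the line. *)
Lemma integral_japanese_lty d (t : R) : (0 < d)%N -> d%:R < t ->
  (\int[@leb R d]_x (japanese x `^ (- t))%:E < +oo)%E.
Proof.
move=> d0 dt; have dR : 0 < d%:R :> R by rewrite ltr0n.
pose a := t / d%:R; have a1 : 1 < a by rewrite /a ltr_pdivlMr// mul1r.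
pose phi (s : R) := (1 + s ^+ 2) `^ (- (a / 2)).
have mphi : measurable_fun setT phi.
  apply: (measurableT_comp (measurable_powR _)).
  by apply: measurable_funD => //; exact: measurable_funX.
have phi0 s : 0 <= phi s by exact: powR_ge0.
have fin : (\int[@leb R d]_x (\prod_(i < d) phi (coord i x))%:E < +oo)%E.
  rewrite ge0_integral_prod// -[X in (X ^+ _)%E]fineK.
    by rewrite -EFin_expe ltry.
  rewrite ge0_fin_numE; first exact: integral_powR_1Dsqr_lty.
  by apply: integral_ge0 => s _; rewrite lee_fin.
apply: le_lt_trans fin; apply: ge0_le_integral => //.
- by move=> x _; rewrite lee_fin powR_ge0.
- by apply/measurable_EFinP; exact: measurable_japanese_powR.
- apply/measurable_EFinP; elim: (index_enum _) => [|i s IH].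
    by under eq_fun do rewrite big_nil; exact: measurable_cst.
  under eq_fun do rewrite big_cons; apply: measurable_funM => //.
  by apply: measurableT_comp => //; exact: measurable_coord.
- move=> x _; rewrite lee_fin.
  set S := 1 + \sum_(i < d) (x ord0 i) ^+ 2.
  have S0 : 0 <= S by rewrite addr_ge0 ?sumr_ge0// => i _; rewrite sqr_ge0.
  have S1 : 0 < S by rewrite ltr_pwDl// sumr_ge0// => i _; rewrite sqr_ge0.
  have -> : japanese x `^ (- t) = \prod_(i < d) S `^ (- (a / 2)).
    rewrite prodr_const card_ord -powR_mulrn ?powR_ge0// -powRrM.
    rewrite /japanese -/S -powR12_sqrt// -powRrM; congr (_ `^ _).
    by rewrite /a; field; rewrite gt_eqF.
  apply: ler_prod => i _; rewrite powR_ge0/= /phi !powRN.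
  have c0 : 0 < 1 + (coord i x) ^+ 2 by rewrite ltr_pwDl// sqr_ge0.
  rewrite lef_pV2 ?posrE ?powR_gt0//.
  apply: ge0_ler_powR; rewrite ?nnegrE//.
  + by rewrite divr_ge0// ltW// (lt_trans _ a1).
  + exact: ltW.
  + rewrite /S lerD2l (bigD1 i)//= lerDl sumr_ge0// => j _; exact: sqr_ge0.
Qed.

End japanese_theory.

(** * An algebra of explicit smooth functions *)

Section flat_functions.
Context {R : realType}.

(** The derivatives of the classical smooth function e^(-1/t), t > 0, which
    vanishes to infinite order at the origin, are combinations of these. *)
Definition flat (k : nat) (t : R) : R :=
  if 0 < t then t^-1 ^+ k * expR (- t^-1) else 0.

(** A single term of the exponential series of 1/t bounds the negative power. The
    square makes the difference quotient at the origin tend to 0. *)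
Lemma flat_bound k t : `|flat k t| <= k.+2`!%:R * t ^+ 2.
Proof.
rewrite /flat; case: ifPn => [t0|_]; last by rewrite normr0 mulr_ge0// sqr_ge0.
rewrite ger0_norm ?mulr_ge0 ?exprn_ge0 ?invr_ge0 ?expR_ge0//; last exact: ltW.
have it0 : 0 < t^-1 by rewrite invr_gt0.
have : t^-1 ^+ k.+2 / k.+2`!%:R <= expR t^-1.
  by rewrite (le_trans _ (expR_ge1Dxn k.+1 (ltW it0)))// lerDr.
rewrite ler_pdivrMr ?ltr0n ?fact_gt0// => h.
rewrite expRN ler_pdivrMr ?expR_gt0//.
have -> : t^-1 ^+ k = t^-1 ^+ k.+2 * t ^+ 2.
  rewrite -[k.+2]addn2 exprD -mulrA -exprMn mulVf ?gt_eqF// expr1n mulr1//.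
by rewrite [leRHS]mulrAC ler_wpM2r ?sqr_ge0// [leRHS]mulrC.
Qed.

Lemma is_derive_flat (k : nat) (t : R) :
  is_derive t 1 (flat k) (flat k.+2 t - k%:R * flat k.+1 t).
Proof.
have [t0|t0|->] := ltgtP t 0.
- rewrite {2 3}/flat ltNge ltW//= mulr0 subr0.
  apply: (@near_eq_is_derive _ _ _ (cst 0)).
    near=> s; rewrite /flat ltNge ltW//; near: s; exact: lt_nbhsl.
- rewrite {2 3}/flat t0.
  apply: (@near_eq_is_derive _ _ _ (fun s : R => s^-1 ^+ k * expR (- s^-1) : R)).
    by near=> s; rewrite /flat ifT//; near: s; exact: lt_nbhsr.
  have tn0 : t != 0 by rewrite gt_eqF.
  have dV : is_derive t 1 (fun s : R => s^-1) (- t^-1 ^+ 2).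
    have := is_deriveV tn0 (is_derive_id t (1 : R)).
    by rewrite /GRing.scale/= mulr1 exprVn.
  have dE : is_derive t 1 (fun s : R => expR (- s^-1)) (expR (- t^-1) * t^-1 ^+ 2).
    rewrite -[X in _ * X]opprK.
    exact: (is_derive1_comp (is_derive_expR _) (is_deriveN dV)).
  have dX : is_derive t 1 (fun s : R => s^-1 ^+ k) (- (k%:R * t^-1 ^+ k.+1)).
    case: k => [|k].
      rewrite mul0r oppr0 (_ : (fun s => _) = cst 1); first exact: is_derive_cst.
      by apply/funext => s.
    rewrite (_ : (fun s => _) = (fun s : R => s^-1) ^+ k.+1); last first.
      by rewrite exprfctE.
    apply: (is_derive_eq (is_deriveX k.+1 dV)).
    by rewrite /GRing.scale/= !exprS; ring.
  apply: (is_derive_eq (is_deriveM dX dE)).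
  by rewrite /GRing.scale/= !exprS; ring.
- rewrite {2 3}/flat ltxx mulr0 subr0.
  apply/is_derive1_caratheodory; exists (fun z => flat k z / z); split.
  + move=> z; rewrite {2}/flat ltxx !subr0; have [->|z0] := eqVneq z 0.
      by rewrite /flat ltxx mul0r mul0r.
    by rewrite divfK.
  + suff : flat k z / z @[z --> (0 : R)] --> (0 : R).
      by rewrite /prop_for /continuous_at /= invr0 mulr0.
    apply/cvgr0Pnorm_le => e e0.
    have C0 : 0 < k.+2`!%:R :> R by rewrite ltr0n fact_gt0.
    have H : \forall z \near (0 : R), `|z| < e / k.+2`!%:R.
      by apply: pseudometric_normed_Zmodule.nbhs0_lt; rewrite divr_gt0.
    near=> z; have [->|z0] := eqVneq z 0; first by rewrite invr0 mulr0 normr0 ltW.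
    rewrite normrM normfV ler_pdivrMr ?normr_gt0// (le_trans (flat_bound _ _))//.
    rewrite -(real_normK (num_real z)) expr2 mulrA.
    rewrite ler_wpM2r// mulrC -ler_pdivlMr// ltW//.
    near: z; exact: H.
  + by rewrite invr0 mulr0.
Unshelve. all: by end_near. Qed.

Lemma continuous_flat k : continuous (flat k).
Proof.
move=> t; apply: differentiable_continuous; apply/derivable1_diffP.
by have [] := is_derive_flat k t.
Qed.

Lemma flat_ge0 k t : 0 <= flat k t.
Proof.
rewrite /flat; case: ifPn => // t0.
by rewrite mulr_ge0 ?expR_ge0// exprn_ge0// invr_ge0 ltW.
Qed.

Lemma flat0_le1 t : flat 0 t <= 1.
Proof.
rewrite /flat; case: ifPn => // t0.
by rewrite expr0 mul1r expR_le1 oppr_le0 invr_ge0 ltW.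
Qed.

Lemma flat0_cvg (t : R) : 0 < t -> flat 0 (n.+1%:R * t) @[n --> \oo] --> (1 : R).
Proof.
move=> t0; rewrite (_ : (fun n => _) =
    expR \o (fun n => - ((n.+1%:R)^-1 * t^-1))); last first.
  by apply/funext => n; rewrite /= /flat mulr_gt0 ?ltr0n// expr0 mul1r invfM.
have h0 : - ((n.+1%:R)^-1 * t^-1) @[n --> \oo] --> (0 : R).
  rewrite -[X in _ --> X]oppr0; apply: cvgN; rewrite -[X in _ --> X](mul0r t^-1).
  by apply: cvgMl; exact: cvg_harmonic.
rewrite -[X in _ --> X](@expR0 R).
exact: (cvg_comp _ _ h0 (@continuous_expR R 0)).
Qed.

End flat_functions.

Section elementary_functions.
Context {R : realType} {d : nat}.
Local Notation V := 'rV[R]_d.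

(** An algebra of functions that is closed under partial derivatives and that
    contains smooth approximations of the indicators of half-spaces. *)
Inductive elementary : (V -> R) -> Prop :=
| elementary_cst c : elementary (fun _ => c)
| elementary_flat k a b i : elementary (fun x => flat k (a * coord i x + b))
| elementaryD f g : elementary f -> elementary g ->
    elementary (fun x => f x + g x)
| elementaryM f g : elementary f -> elementary g ->
    elementary (fun x => f x * g x).

Lemma is_derive_line (f : V -> R) (x v : V) df :
  is_derive (0 : R) 1 (fun h : R => f (h *: v + x)) df -> is_derive x v f df.
Proof.
move=> [dv ev]; split; first exact/derivable1P.
have E : (fun h : R => h^-1 *: ((f \o shift x) (h *: v) - f x)) =
    (fun h : R => h^-1 *: (((fun h : R => f (h *: v + x)) \o shift 0) (h *: 1) -
      f (0 *: v + x))).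
  by apply/funext => h /=; rewrite addr0 [h *: 1]mulr1 scale0r add0r.
by rewrite -ev /derive E.
Qed.

(** Differentiation of a generator stays in the class since the derivative of
    [flat k] is a combination of [flat k.+1] and [flat k.+2]. By iteration every
    member is smooth. *)
Lemma elementary_is_derive f (j : 'I_d) : elementary f ->
  exists2 g, elementary g & forall x, is_derive x (delta_mx ord0 j) f (g x).
Proof.
elim=> {f} [c|k a b i|f1 f2 _ [g1 e1 d1] _ [g2 e2 d2]|f1 f2 h1 [g1 e1 d1] h2 [g2 e2 d2]].
- by exists (fun _ => 0); [exact: (elementary_cst _)|move=> x; exact: is_derive_cst].
- pose c := a * (i == j)%:R.
  exists (fun x => c * (flat k.+2 (a * coord i x + b) +
                  - k%:R * flat k.+1 (a * coord i x + b))).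
    apply: (@elementaryM (fun _ => c)); first exact: (elementary_cst _).
    apply: elementaryD; first exact: elementary_flat.
    apply: (@elementaryM (fun _ => - k%:R)); first exact: (elementary_cst _).
    exact: elementary_flat.
  move=> x; apply: is_derive_line.
  pose l (h : R) := h * c + (a * coord i x + b).
  rewrite (_ : (fun h : R => _) = flat k \o l); last first.
    by apply/funext => h /=; rewrite /l /coord !mxE /c eqxx/=; congr flat; ring.
  have dl : is_derive (0 : R) 1 l c.
    by apply: is_derive_eq; rewrite /GRing.scale/= !mulr1 !addr0 mulr0 add0r.
  have df := is_derive_flat k (l 0).
  apply: (is_derive_eq (is_derive1_comp df dl)).
  by rewrite /l mul0r add0r; ring.
- by exists (fun x => g1 x + g2 x); [exact: elementaryD|move=> x; exact: is_deriveD].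
- exists (fun x => f1 x * g2 x + f2 x * g1 x); last by move=> x; exact: is_deriveM.
  by apply: elementaryD; exact: elementaryM.
Qed.

Lemma elementary_continuous f : elementary f -> continuous f.
Proof.
elim=> {f} [c|k a b i|f g _ cf _ cg|f g _ cf _ cg] x.
- exact: cst_continuous.
- have cl : continuous (fun x : V => a * coord i x + b).
    move=> y; have ca : (fun=> a) @ nbhs y --> a by exact: cvg_cst.
    have cb : (fun=> b) @ nbhs y --> b by exact: cvg_cst.
    exact: (cvgD (cvgM ca (@coord_continuous R _ _ ord0 i y)) cb).
  exact: (continuous_comp (cl x) (@continuous_flat R k _)).
- exact: cvgD (cf x) (cg x).
- exact: cvgM (cf x) (cg x).
Qed.

Lemma elementary_measurable f : elementary f -> measurable_fun setT f.
Proof.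
elim=> {f} [c|k a b i|f g _ cf _ cg|f g _ cf _ cg].
- exact: measurable_cst.
- apply: (measurableT_comp (continuous_measurable_fun (@continuous_flat R k))).
  apply: measurable_funD => //; apply: measurable_funM => //.
  exact: measurable_coord.
- exact: measurable_funD.
- exact: measurable_funM.
Qed.

Lemma elementary_smooth f : elementary f -> smooth f.
Proof.
move=> ef s; have es : elementary (foldr (@partial R d) f s).
  elim: s => //= j s IH; have [g eg dg] := elementary_is_derive j IH.
  rewrite (_ : partial _ _ = g)//; apply/funext => x.
  by rewrite /partial; have [_ ->] := dg x.
split; first exact: elementary_continuous.
by move=> i x; have [g eg dg] := elementary_is_derive i es; have [] := dg x.
Qed.

Definition vanishes_outside_cube (f : V -> R) : Prop :=
  exists N : R, forall x, f x != 0 -> forall i, `|coord i x| <= N.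

(** Enough test functions for density. Working in a generated class reduces
    smoothness and measurability to its generators. *)
Definition bump (f : V -> R) : Prop := elementary f /\ vanishes_outside_cube f.

Lemma vanishes_outside_cubeD f g : vanishes_outside_cube f ->
  vanishes_outside_cube g -> vanishes_outside_cube (fun x => f x + g x).
Proof.
move=> [N fN] [M gM]; exists (Num.max N M) => x fg i; rewrite le_max.
have [fx|/fN->//] := eqVneq (f x) 0.
by rewrite gM ?orbT//; apply: contraNN fg => /eqP ->; rewrite fx addr0.
Qed.

Lemma vanishes_outside_cubeM f g : vanishes_outside_cube g ->
  vanishes_outside_cube (fun x => f x * g x).
Proof.
by move=> [N gN]; exists N => x; rewrite mulf_eq0 negb_or => /andP[_ /gN].
Qed.

Lemma bump0 : bump (fun _ => 0).
Proof. by split; [exact: (elementary_cst _)|exists 0 => x; rewrite eqxx]. Qed.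

Lemma bumpD f g : bump f -> bump g -> bump (fun x => f x + g x).
Proof.
by move=> [e1 v1] [e2 v2]; split;
  [exact: elementaryD|exact: vanishes_outside_cubeD].
Qed.

Lemma bumpM f g : elementary f -> bump g -> bump (fun x => f x * g x).
Proof.
by move=> e1 [e2 v2]; split; [exact: elementaryM|exact: vanishes_outside_cubeM].
Qed.

Lemma cube_compact (N : R) : compact [set x : V | forall i, `|coord i x| <= N].
Proof.
rewrite (_ : mkset _ = [set v : V | forall i, [set` `[- N, N]] (v ord0 i)]).
  apply: (@rV_compact R d (fun _ => [set` `[- N, N]])) => i.
  exact: segment_compact.
apply/seteqP; split=> x /= h i; have := h i; rewrite in_itv/= ler_norml//.
Qed.

Lemma test_function_bump f g : bump f -> bump g ->
  test_function (fun x => (f x +i* g x)%C).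
Proof.
move=> [ef [N fN]] [eg [M gM]]; split; [exact: elementary_smooth..|].
apply: (subclosed_compact _ (@cube_compact (Num.max N M))).
  exact: closed_closure.
have /closure_id -> : closed [set x : V | forall i, `|coord i x| <= Num.max N M].
  by apply: compact_closed; [exact: norm_hausdorff|exact: cube_compact].
apply: closureS => x /=.
have [fx|/fN h _ i] := eqVneq (f x) 0; last by rewrite le_max h.
have [gx|/gM h _ i] := eqVneq (g x) 0; last by rewrite le_max h orbT.
by rewrite fx gx eqxx.
Qed.

End elementary_functions.

(** * Density of test functions under dominated limits *)

Section dominated_closure.
Context {R : realType} {d : nat}.
Local Notation V := 'rV[R]_d.
Variable dom : set (V -> R).
Hypothesis domD : forall G H, dom G -> dom H -> dom (fun x => G x + H x).
Hypothesis domZ : forall c G, 0 <= c -> dom G -> dom (fun x => c * G x).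
Hypothesis dom_bump : forall f, bump f -> dom (fun x => `|f x|).

(** Limits with a common majorant in [dom] take the place of norm limits, which
    for essentially bounded functions would not leave the uniform closure of the
    bumps. *)
Inductive closure_bump : (V -> R) -> Prop :=
| closure_bump_base f : bump f -> closure_bump f
| closure_bump_lim u f G : (forall n, closure_bump (u n)) -> dom G ->
    (forall n x, `|u n x| <= G x) ->
    (forall x, u n x @[n --> \oo] --> f x) -> closure_bump f.

Lemma closure_bump_measurable f : closure_bump f -> measurable_fun setT f.
Proof.
elim=> {f} [f [ef _]|u f G _ mu _ _ uf]; first exact: elementary_measurable.
by apply: (measurable_fun_cvg mu) => x _; exact: uf.
Qed.

Lemma normr_cvg_le (u : R^nat) (l G : R) : (forall n, `|u n| <= G) ->
  u @ \oo --> l -> `|l| <= G.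
Proof.
move=> uG ul; apply: (cvgr_to_le (cvg_norm ul)).
exact: nearW.
Qed.

Lemma dist_cvg0 (u : R^nat) (l : R) : u @ \oo --> l ->
  `|u n - l| @[n --> \oo] --> (0 : R).
Proof.
move=> ul; rewrite -(@normr0 R R); apply: cvg_norm.
by rewrite -(subrr l); apply: cvgB => //; exact: cvg_cst.
Qed.

Lemma closure_bump_dom f : closure_bump f ->
  exists2 G, dom G & forall x, `|f x| <= G x.
Proof.
elim=> {f} [f bf|u f G _ _ dG uG uf].
  by exists (fun x => `|f x|) => //; exact: dom_bump.
by exists G => // x; apply: normr_cvg_le (uf x) => n.
Qed.

Lemma closure_bumpD f g : closure_bump f -> closure_bump g ->
  closure_bump (fun x => f x + g x).
Proof.
move=> cf; elim: cf g => {f} [f bf|u f G _ IH dG uG uf] g cg.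
  elim: cg => {g} [g bg|u g G cu IH dG uG ug].
    by apply: closure_bump_base; exact: bumpD.
  apply: (@closure_bump_lim (fun n x => f x + u n x) _ (fun x => `|f x| + G x)) => //.
  - by apply: domD => //; exact: dom_bump.
  - by move=> n x; apply: le_trans (ler_normD _ _) _; rewrite lerD2l.
  - by move=> x; apply: cvgD; [exact: cvg_cst|exact: ug].
have [H dH gH] := closure_bump_dom cg.
apply: (@closure_bump_lim (fun n x => u n x + g x) _ (fun x => G x + H x)).
- by move=> n; exact: IH.
- exact: domD.
- by move=> n x; apply: le_trans (ler_normD _ _) _; exact: lerD.
- by move=> x; apply: cvgD; [exact: uf|exact: cvg_cst].
Qed.

Lemma closure_bumpM (e f : V -> R) (M : R) : 0 <= M -> elementary e ->
  (forall x, `|e x| <= M) -> closure_bump f -> closure_bump (fun x => e x * f x).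
Proof.
move=> M0 ee eM; elim=> {f} [f bf|u f G _ IH dG uG uf].
  by apply: closure_bump_base; exact: bumpM.
apply: (@closure_bump_lim (fun n x => e x * u n x) _ (fun x => M * G x)) => //.
- exact: domZ.
- by move=> n x; rewrite normrM ler_pM.
- by move=> x; apply: cvgMr; exact: uf.
Qed.

Lemma closure_bumpZ c f : closure_bump f -> closure_bump (fun x => c * f x).
Proof.
apply: (@closure_bumpM (fun _ => c) f `|c|) => //; exact: (elementary_cst _).
Qed.

Lemma closure_bump_eq f g : f =1 g -> closure_bump f -> closure_bump g.
Proof. by move=> /funext ->. Qed.

Lemma closure_bump0 : closure_bump (fun _ => 0).
Proof. by apply: closure_bump_base; exact: bump0. Qed.

(** Sets by whose indicator the class may be multiplied. They form a
    sigma-algebra, which will turn out to contain every measurable set. *)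
Definition multiplier (A : set V) : Prop :=
  forall f, closure_bump f -> closure_bump (fun x => \1_A x * f x).

Lemma multiplierC A : multiplier A -> multiplier (~` A).
Proof.
move=> mA f cf.
apply: (@closure_bump_eq (fun x => f x + (-1) * (\1_A x * f x))).
  by move=> x; rewrite !indicE in_setC; case: (x \in A) => /=; ring.
by apply: closure_bumpD => //; apply: closure_bumpZ; exact: mA.
Qed.

Lemma multiplierU A B : multiplier A -> multiplier B -> multiplier (A `|` B).
Proof.
move=> mA mB; rewrite -(setCK (A `|` B)) setCU; apply: multiplierC => f cf.
apply: (@closure_bump_eq (fun x => \1_(~` A) x * (\1_(~` B) x * f x))).
  by move=> x; rewrite indicI mulrA.
by apply: multiplierC => //; exact: multiplierC.
Qed.

Lemma multiplier0 : multiplier set0.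
Proof.
move=> f cf; apply: closure_bump_eq closure_bump0 => x.
by rewrite indic0 mul0r.
Qed.

Lemma multiplier_bigcup (A : (set V)^nat) : (forall n, multiplier (A n)) ->
  multiplier (\bigcup_n A n).
Proof.
move=> mA f cf; have [G dG fG] := closure_bump_dom cf.
have mU n : multiplier (\big[setU/set0]_(i < n) A i).
  elim/big_ind : _ => //; [exact: multiplier0|exact: multiplierU].
apply: (@closure_bump_lim (fun n x => \1_(\big[setU/set0]_(i < n) A i) x * f x) _ G) => //.
- by move=> n; exact: mU.
- move=> n x; rewrite indicE normrM (le_trans _ (fG x))// ler_piMl//.
  by case: (x \in _); rewrite ?normr1 ?normr0.
- move=> x; apply: cvgMl.
  have [[k _ Akx]|nAx] := pselect ((\bigcup_n A n) x).
    rewrite [X in _ --> X](_ : _ = 1); last by rewrite indicE mem_set//; exists k.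
    apply: cvg_near_cst; exists k.+1 => // n /= kn.
    by rewrite indicE mem_set// -bigcup_mkord; exists k.
  rewrite [X in _ --> X](_ : _ = 0); last by rewrite indicE memNset.
  apply: cvg_near_cst; apply: nearW => n.
  rewrite indicE memNset//; apply: contra_not nAx.
  by rewrite -bigcup_mkord => -[k _ Akx]; exists k.
Qed.

(** The functions flat 0 (n (x_i - a)) are elementary and tend to the indicator of
    the half-space. *)
Lemma multiplier_halfspace i a : multiplier [set x | a < coord i x].
Proof.
move=> f cf; have [G dG fG] := closure_bump_dom cf.
apply: (@closure_bump_lim (fun n x =>
  flat 0 (n.+1%:R * coord i x + - (n.+1%:R * a)) * f x) _ G) => //.
- move=> n; apply: (@closure_bumpM _ _ 1) => //; first exact: elementary_flat.
  by move=> x; rewrite ger0_norm ?flat_ge0// flat0_le1.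
- move=> n x; rewrite normrM (le_trans _ (fG x))// ler_piMl//.
  by rewrite ger0_norm ?flat_ge0// flat0_le1.
- move=> x; apply: cvgMl.
  under eq_fun do rewrite -mulrBr.
  rewrite indicE; have [ax|xa] := ltP a (coord i x).
    by rewrite mem_set//; apply: flat0_cvg; rewrite subr_gt0.
  rewrite memNset /=; last by apply/negP; rewrite -leNgt.
  apply: cvg_near_cst; apply: nearW => n; rewrite /flat ifF//.
  by apply/negbTE; rewrite -leNgt pmulr_rle0 ?ltr0n// subr_le0.
Qed.

Lemma measurable_multiplier (A : set V) : measurable A -> multiplier A.
Proof.
have sigV : sigma_algebra setT multiplier.
  split; first exact: multiplier0.
  - by move=> B mB; rewrite setTD; exact: multiplierC.
  - exact: multiplier_bigcup.
have coordm i (B : set R) : measurable B -> multiplier (coord i @^-1` B).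
  move=> mB; pose S := [set B : set R | multiplier (coord i @^-1` B)].
  have sigS : sigma_algebra setT S.
    split; rewrite /S /=; first by rewrite preimage_set0; exact: multiplier0.
    - by move=> C mC; rewrite setTD preimage_setC; exact: multiplierC.
    - by move=> C mC; rewrite preimage_bigcup; exact: multiplier_bigcup.
  have : (@RGenOInfty.G R).-sigma.-measurable B by rewrite -RGenOInfty.measurableE.
  apply: (@smallest_sub _ _ (@RGenOInfty.G R) S sigS) => C /= [a ->]; rewrite /S/=.
  rewrite (_ : _ @^-1` _ = [set x | a < coord i x]); first exact: multiplier_halfspace.
  by apply/seteqP; split => x /=; rewrite in_itv/= andbT.
apply: (@smallest_sub _ _ (\big[setU/set0]_(i < d)
  preimage_set_system setT (@coord R d i) measurable) multiplier sigV) => B.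
elim/big_ind : _ => [//|S1 S2 h1 h2 [/h1|/h2]//|i _ [C mC <-]].
by rewrite setTI; exact: coordm.
Qed.

(** Truncations to growing cubes: they tend to 1 at every point and multiply a
    dominated function without increasing its majorant. *)
Definition cutoff (n : nat) (x : V) : R :=
  \prod_(i < d) (flat 0 (1 * coord i x + n%:R) * flat 0 ((-1) * coord i x + n%:R)).

Lemma cutoff_ge0 n x : 0 <= cutoff n x.
Proof. by apply: prodr_ge0 => i _; rewrite mulr_ge0 ?flat_ge0. Qed.

Lemma cutoff_le1 n x : cutoff n x <= 1.
Proof.
rewrite /cutoff; apply: prodr_ile1 => i _.
by rewrite mulr_ge0 ?flat_ge0//= mulr_ile1 ?flat_ge0 ?flat0_le1.
Qed.

Lemma elementary_prod (s : seq 'I_d) (e : 'I_d -> V -> R) :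
  (forall i, elementary (e i)) -> elementary (fun x => \prod_(i <- s) e i x).
Proof.
move=> ee; elim: s => [|i s IH].
  by under eq_fun do rewrite big_nil; exact: elementary_cst.
by under eq_fun do rewrite big_cons; exact: elementaryM.
Qed.

Lemma bump_cutoff n : bump (cutoff n).
Proof.
split.
  apply: (@elementary_prod (index_enum 'I_d)) => i.
  by apply: elementaryM; exact: elementary_flat.
exists n%:R => x /prodf_neq0 h i; have := h i isT.
rewrite mulf_eq0 negb_or /flat => /andP[].
case: ifPn => [h1 _|]; last by rewrite eqxx.
case: ifPn => [h2 _|]; last by rewrite eqxx.
by rewrite ler_norml; apply/andP; split; lra.
Qed.

Lemma cutoff_cvg x : cutoff n x @[n --> \oo] --> (1 : R).
Proof.
have flat_cvg (a : R) : flat 0 (a + n%:R) @[n --> \oo] --> (1 : R).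
  pose u n := (a + n%:R)^-1.
  have u0 : u @ \oo --> (0 : R).
    apply/cvgr0Pnorm_lt => e e0.
    near=> n.
    have h : e^-1 < a + n%:R.
      rewrite -ltrBlDl; near: n; exact: nbhs_infty_gtr.
    have h0 : 0 < a + n%:R by rewrite (lt_trans _ h)// invr_gt0.
    by rewrite /u gtr0_norm ?invr_gt0// invf_plt ?posrE.
  have h : expR (- u n) @[n --> \oo] --> (1 : R).
    rewrite -[X in _ --> X](@expR0 R) -[X in expR X]oppr0.
    apply: (cvg_comp _ _ (cvgN u0) (@continuous_expR R (- 0))).
  apply: cvg_trans h; apply: near_eq_cvg; near=> n.
  rewrite /flat ifT ?expr0 ?mul1r//.
  rewrite -ltrBlDl; near: n; exact: nbhs_infty_gtr.
pose F n i : R := flat 0 (1 * coord i x + n%:R) * flat 0 ((-1) * coord i x + n%:R).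
have F1 i : F n i @[n --> \oo] --> (1 : R).
  by rewrite -[X in _ --> X]mulr1; apply: cvgM; exact: flat_cvg.
suff H (s : seq 'I_d) : \prod_(i <- s) F n i @[n --> \oo] --> (1 : R) by exact: H.
elim: s => [|i s IH].
  rewrite (_ : (fun n => _) = cst 1); first exact: cvg_cst.
  by apply/funext => n; rewrite big_nil.
rewrite (_ : (fun n => _) = (fun n => F n i * \prod_(j <- s) F n j)); last first.
  by apply/funext => n; rewrite big_cons.
by rewrite -[X in _ --> X]mulr1; exact: cvgM (F1 i) IH.
Unshelve. all: by end_near. Qed.

Lemma closure_bump_sum (I : Type) (s : seq I) (f : I -> V -> R) :
  (forall i, closure_bump (f i)) -> closure_bump (fun x => \sum_(i <- s) f i x).
Proof.
move=> cf; elim: s => [|i s IH].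
  by under eq_fun do rewrite big_nil; exact: closure_bump0.
by under eq_fun do rewrite big_cons; exact: closure_bumpD.
Qed.

Import HBNNSimple.

Lemma closure_bump_sfun (s : {nnsfun V >-> R}) n :
  closure_bump (fun x => s x * cutoff n x).
Proof.
rewrite (_ : (fun x => _) = (fun x : V => \sum_(y <- finmap.enum_fset (fset_set (range s)))
    y * (\1_(s @^-1` [set y]) x * cutoff n x))); last first.
  apply/funext => x; rewrite [in LHS]fimfunE fsbig_finite//= mulr_suml.
  by apply: eq_bigr => y _; rewrite mulrA.
apply: closure_bump_sum => y; apply: closure_bumpZ.
apply: measurable_multiplier => //.
by apply: closure_bump_base; exact: bump_cutoff.
Qed.

(** Truncated simple functions approximate f from below, so f's own majorant
    serves for the whole sequence. *)
Lemma closure_bump_ge0 (f : V -> R) G : measurable_fun setT f ->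
  (forall x, 0 <= f x) -> dom G -> (forall x, f x <= G x) -> closure_bump f.
Proof.
move=> mf f0 dG fG.
have mf' : measurable_fun setT (EFin \o f) by exact/measurable_EFinP.
pose s := nnsfun_approx measurableT mf'.
have scvg x : s n x @[n --> \oo] --> f x.
  have := @cvg_nnsfun_approx _ _ _ setT measurableT _ mf'
    (fun x _ => ltac:(rewrite lee_fin; exact: f0)) x I.
  by move=> /fine_cvgP[_]/=.
have sf n x : s n x <= f x.
  have h : nondecreasing_seq (fun n => s n x).
    by move=> a b ab; exact/lefP/nd_nnsfun_approx.
  rewrite -(cvg_lim _ (scvg x))//; apply: nondecreasing_cvgn_le => //.
  by apply/cvg_ex; exists (f x).
apply: (@closure_bump_lim (fun n x => s n x * cutoff n x) _ G) => //.
- by move=> n; exact: closure_bump_sfun.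
- move=> n x; rewrite ger0_norm ?mulr_ge0 ?cutoff_ge0//.
  by rewrite (le_trans _ (fG x))// (le_trans _ (sf n x))// ler_piMr ?cutoff_le1.
- by move=> x; rewrite -[X in _ --> X]mulr1; apply: cvgM => //; exact: cutoff_cvg.
Qed.

Lemma closure_bump_full (f : V -> R) G : measurable_fun setT f ->
  dom G -> (forall x, `|f x| <= G x) -> closure_bump f.
Proof.
move=> mf dG fG.
apply: (@closure_bump_eq (fun x => f^\+ x + (-1) * f^\- x)).
  by move=> x; rewrite mulN1r -[RHS](congr1 (@^~ x) (funrposBneg f)).
apply: closure_bumpD.
  apply: (@closure_bump_ge0 _ G) => //; first exact: measurable_funrpos.
  by move=> x; rewrite (le_trans _ (fG x))// /funrpos ge_max ler_norm normr_ge0.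
apply: closure_bumpZ; apply: (@closure_bump_ge0 _ G) => //; first exact: measurable_funrneg.
by move=> x; rewrite (le_trans _ (fG x))// /funrneg ge_max -normrN ler_norm normr_ge0.
Qed.

(** Density of the test functions in a form that is uniform in the exponent: all
    functions with a majorant in [dom] arise from bumps by iterated dominated
    limits, so that a property need only be known for bumps and be carried
    through such limits. *)
Theorem dominated_density (P : (V -> R[i]) -> Prop) :
  (forall f g, bump f -> bump g -> P (fun x => (f x +i* g x)%C)) ->
  (forall (u : nat -> V -> R[i]) f G, (forall n, cmeasurable (u n)) ->
     cmeasurable f -> (forall n, P (u n)) ->
     dom G -> (forall n x, normc (u n x) <= G x) ->
     (forall x, normc (u n x - f x) @[n --> \oo] --> 0) -> P f) ->
  forall f G, cmeasurable f -> dom G -> (forall x, normc (f x) <= G x) -> P f.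
Proof.
move=> Pbump Plim f G [mRe mIm] dG fG.
have cRe : closure_bump (fun x => complex.Re (f x)).
  by apply: (closure_bump_full mRe dG) => x; rewrite (le_trans (normr_Re_le _)).
have cIm : closure_bump (fun x => complex.Im (f x)).
  by apply: (closure_bump_full mIm dG) => x; rewrite (le_trans (normr_Im_le _)).
suff H : forall u v, closure_bump u -> closure_bump v ->
    P (fun x => (u x +i* v x)%C).
  by have := H _ _ cRe cIm; congr P; apply/funext => x; case: (f x).
move=> {f G mRe mIm dG fG cRe cIm} u v cu cv.
elim: cu => {u} [u bu|u f G cu IH dG uG uf].
  elim: cv => {v} [v bv|v f G cv IH dG vG vf]; first exact: Pbump.
  have mu : measurable_fun setT u by apply: elementary_measurable; case: bu.
  have cf : closure_bump f by exact: closure_bump_lim cv dG vG vf.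
  apply: (Plim (fun n x => (u x +i* v n x)%C) _ (fun x => `|u x| + G x)) => //.
  - by move=> n; split => //=; exact: closure_bump_measurable.
  - by split => //=; exact: closure_bump_measurable.
  - by apply: domD => //; exact: dom_bump.
  - by move=> n x; rewrite (le_trans (normc_le _))//= lerD2l.
  - move=> x; rewrite (_ : (fun n => _) = (fun n => `|v n x - f x|)); last first.
      by apply/funext => n; rewrite /= subrr expr0n/= add0r sqrtr_sqr.
    exact: dist_cvg0.
have [H dH vH] := closure_bump_dom cv.
have mv := closure_bump_measurable cv.
have cf : closure_bump f by exact: closure_bump_lim cu dG uG uf.
apply: (Plim (fun n x => (u n x +i* v x)%C) _ (fun x => G x + H x)) => //.
- by move=> n; split => //=; exact: closure_bump_measurable.
- by split => //=; exact: closure_bump_measurable.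
- exact: domD.
- by move=> n x; rewrite (le_trans (normc_le _))//= lerD.
- move=> x; rewrite (_ : (fun n => _) = (fun n => `|u n x - f x|)); last first.
    by apply/funext => n; rewrite /= subrr expr0n/= addr0 sqrtr_sqr.
  exact: dist_cvg0.
Qed.

End dominated_closure.

(** * Weighted Lebesgue norms and majorants *)

Section Lnorm_theory.
Context {R : realType} {d : nat}.
Local Notation V := 'rV[R]_d.
Local Notation leb := (@leb R d).

Lemma le_Lnorm (q : \bar R) (f g : V -> \bar R) : (0 < q)%E ->
  measurable_fun setT f -> measurable_fun setT g ->
  {ae leb, forall x, (`|f x| <= `|g x|)%E} ->
  (Lnorm leb q f <= Lnorm leb q g)%E.
Proof.
case: q => [p| |//] p0 mf mg fg.
- rewrite unlock; have {}p0 : 0 < p by rewrite -lte_fin.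
  have mp (h : V -> \bar R) : measurable_fun setT h ->
      measurable_fun setT (fun x => (`|h x| `^ p)%E).
    move=> mh; apply: (@measurableT_comp _ _ _ _ _ _ (fun x => x `^ p)%E) => //=.
      exact: (measurableT_comp (measurable_poweR _)).
    exact: measurableT_comp.
  apply: gt0_ler_poweR.
  + by rewrite invr_ge0 ltW.
  + by rewrite in_itv/= leey andbT; apply: integral_ge0 => x _; exact: poweR_ge0.
  + by rewrite in_itv/= leey andbT; apply: integral_ge0 => x _; exact: poweR_ge0.
  + apply: ae_ge0_le_integral => //.
    * by move=> x _; exact: poweR_ge0.
    * exact: mp.
    * by move=> x _; exact: poweR_ge0.
    * exact: mp.
    * apply: filterS fg => x h _; apply: gt0_ler_poweR => //; first exact: ltW.
      - by rewrite in_itv/= leey andbT.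
      - by rewrite in_itv/= leey andbT.
by rewrite unlock; case: ifPn => // _; exact: le_ess_sup.
Qed.

Lemma LnormD (q : \bar R) (u v : V -> R) : (1 <= q)%E ->
  measurable_fun setT u -> measurable_fun setT v ->
  (Lnorm leb q (fun x => (u x + v x)%:E) <=
   Lnorm leb q (EFin \o u) + Lnorm leb q (EFin \o v))%E.
Proof.
case: q => [p| |//] q1 mu mv.
  by apply: minkowski_EFin => //; rewrite -lee_fin.
rewrite unlock; case: ifPn => [_|_]; last by rewrite adde0.
by apply: (ess_sup_absD leb (EFin \o u) (EFin \o v)).
Qed.

Lemma ae_le_Lnormy (f : V -> \bar R) :
  {ae leb, forall x, (`|f x| <= Lnorm leb +oo f)%E}.
Proof. by rewrite unlock leb_setT_gt0; exact: ess_sup_ge. Qed.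

Lemma Lnormy_le (f : V -> \bar R) (M : \bar R) :
  {ae leb, forall x, (`|f x| <= M)%E} -> (Lnorm leb +oo f <= M)%E.
Proof. by rewrite unlock leb_setT_gt0 => h; exact/ess_supP. Qed.

Lemma LnormEp (p : R) (u : V -> R) : 0 < p -> (forall x, 0 <= u x) ->
  (Lnorm leb p%:E (EFin \o u) `^ p = \int[leb]_x (u x `^ p)%:E)%E.
Proof.
move=> p0 u0; rewrite (poweR_Lnorm _ _ (lt0r_neq0 p0)).
apply: eq_integral => x _ /=.
by rewrite ger0_norm.
Qed.

Lemma lt_LnormP (p : R) (u : V -> R) (e : R) : 0 < p -> 0 < e ->
  (forall x, 0 <= u x) -> (\int[leb]_x (u x `^ p)%:E < (e `^ p)%:E)%E ->
  (Lnorm leb p%:E (EFin \o u) < e%:E)%E.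
Proof.
move=> p0 e0 u0 h; rewrite ltNge; apply/negP => eN.
move: h; rewrite -LnormEp// -poweR_EFin ltNge => /negP; apply.
apply: gt0_ler_poweR => //; first exact: ltW.
  by rewrite in_itv/= leey andbT lee_fin ltW.
by rewrite in_itv/= leey andbT Lnorm_ge0.
Qed.

Lemma le_LnormP (p : R) (f : V -> \bar R) (M : \bar R) : 0 < p -> (0 <= M)%E ->
  (\int[leb]_x (`|f x| `^ p) <= M `^ p)%E -> (Lnorm leb p%:E f <= M)%E.
Proof.
move=> p0 M0 h; rewrite unlock -[leRHS]poweRe1// -(mulfV (lt0r_neq0 p0)) poweRrM.
apply: gt0_ler_poweR => //; first by rewrite invr_ge0 ltW.
  by rewrite in_itv/= leey andbT; apply: integral_ge0 => x _; exact: poweR_ge0.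
by rewrite in_itv/= leey andbT poweR_ge0.
Qed.

Lemma normLqrE q r (g : V -> R[i]) :
  normLqr q r g = Lnorm leb q (EFin \o (fun x => normc (g x) * japanese x `^ r)).
Proof.
by apply: eq_Lnorm => x /=; rewrite normcM normc_real ger0_norm ?powR_ge0.
Qed.

Lemma normLqr0 q : normLqr q 0 = normLq q :> ((V -> R[i]) -> \bar R).
Proof.
apply/funext => g; rewrite normLqrE; apply: eq_Lnorm => x /=.
by rewrite powRr0 mulr1.
Qed.

Lemma Lqr0 q : Lqr q 0 = Lq q :> ((V -> R[i]) -> Prop).
Proof. by apply/funext => g; rewrite /Lqr normLqr0. Qed.

Lemma weighted_ge0 r (g : V -> R[i]) x : 0 <= normc (g x) * japanese x `^ r.
Proof. by rewrite mulr_ge0 ?normc_ge0 ?powR_ge0. Qed.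

Lemma measurable_weighted r (u : V -> R) : measurable_fun setT u ->
  measurable_fun setT (fun x => u x * japanese x `^ r).
Proof.
by move=> mu; apply: measurable_funM => //; exact: measurable_japanese_powR.
Qed.

Lemma normLqrD q r (f g : V -> R[i]) : (1 <= q)%E ->
  cmeasurable f -> cmeasurable g ->
  (normLqr q r (fun x => f x + g x)%R <= normLqr q r f + normLqr q r g)%E.
Proof.
move=> q1 mf mg; rewrite !normLqrE.
have mwf := measurable_weighted r (measurable_normc mf).
have mwg := measurable_weighted r (measurable_normc mg).
apply: le_trans (LnormD q1 mwf mwg).
apply: le_Lnorm; first exact: lt_le_trans q1.
- apply/measurable_EFinP; apply: measurable_weighted; apply: measurable_normc.
  exact: cmeasurableD.
- by apply/measurable_EFinP; exact: measurable_funD.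
- apply: aeW => x /=; rewrite lee_fin !ger0_norm ?addr_ge0 ?mulr_ge0 ?normc_ge0 ?powR_ge0//.
  by rewrite -mulrDl ler_wpM2r ?powR_ge0// normcD_le.
Qed.

Lemma normLqr_norm_eq q r (f g : V -> R[i]) :
  (forall x, normc (f x) = normc (g x)) -> normLqr q r f = normLqr q r g.
Proof. by move=> fg; rewrite !normLqrE; apply: eq_Lnorm => x /=; rewrite fg. Qed.

Lemma normLqr_sub0 q r (f : V -> R[i]) : (0 < q)%E ->
  normLqr q r (fun x => f x - f x) = 0%E.
Proof.
move=> q0; rewrite normLqrE -(@Lnorm0 _ _ _ leb q ltac:(by rewrite gt_eqF)).
by apply: eq_Lnorm => x /=; rewrite subrr normc0 mul0r.
Qed.

Lemma LqrB q r (f g : V -> R[i]) : (1 <= q)%E -> Lqr q r f -> Lqr q r g ->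
  Lqr q r (fun x => f x - g x).
Proof.
move=> q1 [mf nf] [mg ng]; split; first exact: cmeasurableB.
apply: (le_lt_trans (normLqrD r q1 mf (cmeasurableN mg))).
rewrite (@normLqr_norm_eq _ _ (fun x => - g x) g) ?lte_add_pinfty// => x.
exact: normc_opp.
Qed.

Lemma normLq_eq0_ae q (f g : V -> R[i]) : (0 < q)%E ->
  cmeasurable f -> cmeasurable g ->
  normLq q (fun x => f x - g x) = 0%E -> ae_equal f g.
Proof.
move=> q0 mf mg /Lnorm_eq0_eq0 h.
have := h (emeasurable_normc (cmeasurableB mf mg)) q0.
apply: filterS => x /(_ I) /= [] /eqP.
by rewrite normc_eq0 subr_eq0 => /eqP.
Qed.

Lemma normLq_ae_eq q (f g : V -> R[i]) : (0 < q)%E ->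
  cmeasurable f -> cmeasurable g -> ae_equal f g -> normLq q f = normLq q g.
Proof.
move=> q0 mf mg fg; apply/eqP; rewrite eq_le; apply/andP; split;
  apply: le_Lnorm; rewrite //; try exact: emeasurable_normc;
  by apply: filterS fg => x ->.
Qed.

End Lnorm_theory.

Section weighted_majorants.
Context {R : realType} {d : nat}.
Local Notation V := 'rV[R]_d.
Local Notation leb := (@leb R d).

Definition majorant (q : \bar R) (r : R) : set (V -> R) := [set G : V -> R |
  measurable_fun setT G /\
  (Lnorm leb q (EFin \o (fun x => (G x * japanese x `^ r)%R)) < +oo)%E].

Lemma majorant_normc q r (f : V -> R[i]) : Lqr q r f ->
  majorant q r (fun x => normc (f x)).
Proof.
by move=> [mf]; rewrite normLqrE => nf; split => //; exact: measurable_normc.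
Qed.

Lemma majorant_le q r (G H : V -> R) : (0 < q)%E -> majorant q r H ->
  measurable_fun setT G -> (forall x, `|G x| <= `|H x|) -> majorant q r G.
Proof.
move=> q0 [mH nH] mG GH; split => //; apply: le_lt_trans nH.
apply: le_Lnorm => //; try by apply/measurable_EFinP; exact: measurable_weighted.
apply: aeW => x /=; rewrite lee_fin !normrM ler_wpM2r//.
Qed.

Lemma Lqr_majorant q r (f : V -> R[i]) (G : V -> R) : (0 < q)%E -> cmeasurable f ->
  majorant q r G -> (forall x, normc (f x) <= G x) -> Lqr q r f.
Proof.
move=> q0 mf mG fG; split => //; rewrite normLqrE.
have [] // := @majorant_le q r (fun x => normc (f x)) G q0 mG.
  exact: measurable_normc.
by move=> x; rewrite ger0_norm ?normc_ge0// (le_trans (fG x))// ler_norm.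
Qed.

Lemma majorantD q r (G H : V -> R) : (1 <= q)%E -> majorant q r G -> majorant q r H ->
  majorant q r (fun x => G x + H x).
Proof.
move=> q1 [mG nG] [mH nH]; split; first exact: measurable_funD.
apply: (@le_lt_trans _ _ (Lnorm leb q (EFin \o (fun x => (G x * japanese x `^ r)%R)) +
  Lnorm leb q (EFin \o (fun x => (H x * japanese x `^ r)%R)))%E).
  apply: le_trans (LnormD q1 (measurable_weighted r mG) (measurable_weighted r mH)).
  rewrite le_eqVlt; apply/orP; left; apply/eqP; apply: eq_Lnorm => x /=.
  by rewrite mulrDl.
exact: lte_add_pinfty.
Qed.

(** Scaling follows from addition, since c is at most an integer. *)
Lemma majorantZ q r (c : R) (G : V -> R) : (1 <= q)%E -> 0 <= c -> majorant q r G ->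
  majorant q r (fun x => c * G x).
Proof.
move=> q1 c0 mG; have q0 : (0 < q)%E by exact: lt_le_trans q1.
have mn n : majorant q r (fun x => n.+1%:R * G x).
  elim: n => [|n IH]; first by under eq_fun do rewrite mul1r.
  under eq_fun do rewrite -[n.+2]addn1 natrD mulrDl mul1r.
  exact: majorantD.
apply: (majorant_le q0 (mn (Num.truncn c))).
  by apply: measurable_funM => //; case: mG.
move=> x; rewrite !normrM ler_wpM2r// !ger0_norm//.
by rewrite ltW// truncnS_gt.
Qed.

Lemma flat_le_fact k (t : R) : flat k t <= k`!%:R.
Proof.
rewrite /flat; case: ifPn => // t0.
have it0 : 0 < t^-1 by rewrite invr_gt0.
rewrite expRN ler_pdivrMr ?expR_gt0//; case: k => [|k].
  by rewrite expr0 fact0 mul1r -expR0 ler_expR ltW.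
rewrite -ler_pdivrMl ?ltr0n ?fact_gt0// mulrC.
by rewrite (le_trans _ (expR_ge1Dxn k (ltW it0)))// lerDr.
Qed.

Lemma elementary_bounded (f : V -> R) : elementary f ->
  exists2 M, 0 <= M & forall x, `|f x| <= M.
Proof.
elim=> {f} [c|k a b i|f g _ [M M0 fM] _ [N N0 gN]|f g _ [M M0 fM] _ [N N0 gN]].
- by exists `|c|.
- exists k`!%:R => // x; rewrite ger0_norm ?flat_ge0//; exact: flat_le_fact.
- exists (M + N); first exact: addr_ge0.
  by move=> x; apply: le_trans (ler_normD _ _) _; exact: lerD.
- exists (M * N); first exact: mulr_ge0.
  by move=> x; rewrite normrM; exact: ler_pM.
Qed.

(** A bump is bounded and lives on a cube, on which every power of the weight is
    bounded as well. *)
Lemma bump_rapid_decay (f : V -> R) (a : R) : bump f ->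
  exists2 K, 0 <= K & forall x, `|f x| * japanese x `^ a <= K.
Proof.
move=> [ef [N fN]]; have [M M0 fM] := elementary_bounded ef.
pose J := Num.sqrt (1 + \sum_(i < d) N ^+ 2).
have J1 : 1 <= J.
  by rewrite -[leLHS]sqrtr1 ler_wsqrtr// lerDl sumr_ge0// => i _; exact: sqr_ge0.
exists (M * J `^ `|a|); first by rewrite mulr_ge0 ?powR_ge0.
move=> x; have [->|fx] := eqVneq (f x) 0.
  by rewrite normr0 mul0r mulr_ge0 ?powR_ge0.
apply: ler_pM; rewrite ?powR_ge0//.
apply: (@le_trans _ _ (japanese x `^ `|a|)).
  by apply: ler_powR; [exact: japanese_ge1|exact: ler_norm].
apply: ge0_ler_powR; rewrite ?nnegrE//.
- exact: ltW (japanese_gt0 _).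
- exact: le_trans J1.
- apply: ler_wsqrtr; rewrite lerD2l; apply: ler_sum => i _.
  have := fN x fx i; rewrite -/(coord i x) => h.
  have N0 : 0 <= N by exact: le_trans h.
  by rewrite -[leLHS]real_normK ?num_real// lerXn2r ?nnegrE.
Qed.

Lemma majorant_bump q r (f : V -> R) : (0 < d)%N -> (1 <= q)%E -> bump f ->
  majorant q r (fun x => `|f x|).
Proof.
move=> d0; case: q => [p| |//] q1 bf; have mf := elementary_measurable bf.1.
- split; first exact: measurableT_comp.
  have p1 : 1 <= p by rewrite -lee_fin.
  have p0 : 0 < p by exact: lt_le_trans p1.
  rewrite unlock; apply: poweR_lty.
  rewrite (eq_integral (fun x => ((`|f x| * japanese x `^ r) `^ p)%:E)); last first.
    by move=> x _ /=; rewrite ger0_norm ?mulr_ge0 ?powR_ge0.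
  have [K K0 fK] := bump_rapid_decay (r + d.+1%:R) bf.
  apply: (@le_lt_trans _ _ (\int[leb]_x ((K `^ p)%:E * (japanese x `^ (- d.+1%:R))%:E))%E).
    apply: ge0_le_integral => //.
    + by move=> x _; rewrite lee_fin powR_ge0.
    + apply/measurable_EFinP; apply: (measurableT_comp (measurable_powR _)).
      by apply: measurable_weighted; exact: measurableT_comp.
    + apply/measurable_EFinP; apply: measurable_funM => //.
      exact: measurable_japanese_powR.
    + move=> x _ /=; rewrite lee_fin.
      have j0 := japanese_gt0 x.
      apply: (@le_trans _ _ ((K * japanese x `^ (- d.+1%:R)) `^ p)).
        apply: ge0_ler_powR; rewrite ?nnegrE ?mulr_ge0 ?powR_ge0//; first exact: ltW.
        rewrite [in leRHS]powRN ler_pdivlMr ?powR_gt0// -mulrA -powRD//.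
        by apply/implyP => _; rewrite gt_eqF.
      rewrite powRM ?powR_ge0// ler_wpM2l ?powR_ge0// -powRrM.
      apply: ler_powR; first exact: japanese_ge1.
      by rewrite mulNr lerN2 ler_peMr.
  rewrite ge0_integralZl//.
  + rewrite lte_mul_pinfty ?lee_fin ?powR_ge0//.
    by apply: integral_japanese_lty => //; rewrite ltr_nat.
  + by apply/measurable_EFinP; exact: measurable_japanese_powR.
  + by move=> x _; rewrite lee_fin powR_ge0.
  + by rewrite lee_fin powR_ge0.
- split; first exact: measurableT_comp.
  have [K K0 fK] := bump_rapid_decay r bf.
  apply: (@le_lt_trans _ _ K%:E); last exact: ltry.
  apply: Lnormy_le; apply: aeW => x /=.
  by rewrite lee_fin ger0_norm ?mulr_ge0 ?powR_ge0.
Qed.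

End weighted_majorants.

(** * Convergence of dominated sequences *)

Section dominated_limits.
Context {R : realType} {d : nat}.
Local Notation V := 'rV[R]_d.
Local Notation leb := (@leb R d).

Lemma ecvg0_lt (v : (\bar R)^nat) (c : R) : v @ \oo --> 0%E -> 0 < c ->
  \forall n \near \oo, (v n < c%:E)%E.
Proof.
move=> /fine_cvgP[vfin /cvgr0_norm_lt vc] c0; have {}vc := vc _ c0.
near=> n.
have vn : v n \is a fin_num by near: n.
rewrite -(fineK vn) lte_fin (le_lt_trans (ler_norm _))//.
by near: n.
Unshelve. all: by end_near. Qed.

Lemma powR_seq_cvg0 (v : R^nat) (p : R) : 0 < p -> (forall n, 0 <= v n) ->
  v @ \oo --> (0 : R) -> v n `^ p @[n --> \oo] --> (0 : R).
Proof.
move=> p0 v0 /cvgr0_norm_lt vc; apply/cvgr0Pnorm_lt => e e0.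
have e1 : 0 < e `^ p^-1 by rewrite powR_gt0.
have {}vc := vc _ e1; near=> n.
have h : `|v n| < e `^ p^-1 by near: n.
rewrite ger0_norm ?powR_ge0//; rewrite ger0_norm// in h.
have := @gt0_ltr_powR _ p p0 _ _ _ _ h.
rewrite -powRrM mulVf ?gt_eqF// powRr1 ?ltW//; apply; rewrite nnegrE//.
exact: powR_ge0.
Unshelve. all: by end_near. Qed.

Section limits.
Variables (u : (V -> R[i])^nat) (f : V -> R[i]) (G : V -> R).
Hypothesis mu : forall n, cmeasurable (u n).
Hypothesis mf : cmeasurable f.
Hypothesis uG : forall n x, normc (u n x) <= G x.
Hypothesis uf : forall x, normc (u n x - f x) @[n --> \oo] --> (0 : R).

Lemma dominated_limit_le x : normc (f x) <= G x.
Proof.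
rewrite -subr_le0; apply: (cvgr_to_ge (uf x)); apply: nearW => n.
rewrite lerBlDr normcB (le_trans _ (lerD (lexx _) (uG n x)))//.
by rewrite (le_trans _ (normcD_le _ _))// subrK.
Qed.

Lemma dominated_diff_le n x : normc (u n x - f x) <= 2 * G x.
Proof.
rewrite (le_trans (normcD_le _ _))// normc_opp mulr2n mulrDl mul1r.
by rewrite lerD// dominated_limit_le.
Qed.

Lemma dominated_normLqr_cvg p r (e : R) : 1 <= p -> majorant p%:E r G ->
  0 < e -> \forall n \near \oo,
  (normLqr p%:E r (fun x => u n x - f x)%R < e%:E)%E.
Proof.
move=> p1 [mG nG] e0; have p0 : 0 < p by exact: lt_le_trans p1.
have G0 x : 0 <= G x by exact: le_trans (normc_ge0 _) (uG 0 x).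
pose w n x := normc (u n x - f x) * japanese x `^ r.
pose H x := 2 `^ p * (G x * japanese x `^ r) `^ p.
have mw n : measurable_fun setT (fun x => (w n x `^ p)%:E).
  apply/measurable_EFinP; apply: (measurableT_comp (measurable_powR _)).
  by apply: measurable_weighted; apply: measurable_normc; exact: cmeasurableB.
have mH : measurable_fun setT (fun x => ((G x * japanese x `^ r) `^ p)%:E).
  apply/measurable_EFinP; apply: (measurableT_comp (measurable_powR _)).
  exact: measurable_weighted.
have iH : leb.-integrable setT (EFin \o H).
  rewrite (_ : _ \o _ = (fun x => (2 `^ p)%:E * ((G x * japanese x `^ r) `^ p)%:E)%E)//.
  apply: integrableZl => //; apply/integrableP; split=> //.
  rewrite (eq_integral (fun x => ((G x * japanese x `^ r) `^ p)%:E)); last first.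
    by move=> x _; rewrite gee0_abs// lee_fin powR_ge0.
  rewrite -(@LnormEp _ _ _ (fun x => G x * japanese x `^ r))//.
    exact: poweR_lty.
  by move=> x; rewrite mulr_ge0 ?powR_ge0.
have wcvg x : w n x `^ p @[n --> \oo] --> (0 : R).
  apply: powR_seq_cvg0 => //; first by move=> n; rewrite mulr_ge0 ?normc_ge0 ?powR_ge0.
  by rewrite -(mul0r (japanese x `^ r)); apply: cvgMl; exact: uf.
have wH n x : w n x `^ p <= H x.
  rewrite /H -powRM ?mulr_ge0 ?powR_ge0//.
  apply: ge0_ler_powR; rewrite ?nnegrE ?mulr_ge0 ?normc_ge0 ?powR_ge0//.
    exact: ltW.
  by rewrite mulrA ler_wpM2r ?powR_ge0// dominated_diff_le.
have c1 : {ae leb, forall x, setT x -> (w n x `^ p)%:E @[n --> \oo] --> 0%E}.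
  by apply: aeW => x _; apply: cvg_EFin; [exact: nearW|exact: wcvg].
have c2 : {ae leb, forall x n, setT x -> (`|(w n x `^ p)%:E| <= (EFin \o H) x)%E}.
  by apply: aeW => x n _; rewrite /= lee_fin ger0_norm ?powR_ge0.
have [_ _] := dominated_convergence measurableT mw (measurable_cst 0%E) c1 iH c2.
rewrite integral0 => /ecvg0_lt/(_ (powR_gt0 p e0)); apply: filterS => n h.
rewrite normLqrE; apply: lt_LnormP => // x.
by rewrite mulr_ge0 ?normc_ge0 ?powR_ge0.
Qed.

(** For h in the predual, the product of the majorant with |h| is integrable, so
    dominated convergence applies to the pairing with h. *)
Lemma dominated_weakstar_cvg r : majorant +oo r G -> weakstar_cvg r u f.
Proof.
move=> [mG nG] h [mh nh]; rewrite normLqrE Lnorm1 in nh.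
have G0 x : 0 <= G x by exact: le_trans (normc_ge0 _) (uG 0 x).
pose M := fine (Lnorm leb +oo (EFin \o (fun x => G x * japanese x `^ r)))%R.
have aeM : {ae leb, forall x, G x * japanese x `^ r <= M}.
  have := ae_le_Lnormy (EFin \o (fun x => G x * japanese x `^ r)).
  apply: filterS => x /=; rewrite ger0_norm ?mulr_ge0 ?powR_ge0// -lee_fin /M fineK//.
  by rewrite ge0_fin_numE// Lnorm_ge0.
have M0 : 0 <= M by rewrite fine_ge0// Lnorm_ge0.
pose v x := normc (h x) * japanese x `^ (- r).
have mv : measurable_fun setT v.
  by apply: measurable_weighted; exact: measurable_normc.
have v0 x : 0 <= v x by rewrite mulr_ge0 ?normc_ge0 ?powR_ge0.
have aeGh : {ae leb, forall x, G x * normc (h x) <= M * v x}.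
  apply: filterS aeM => x xM; rewrite /v powRN.
  rewrite (_ : M * _ = (M / japanese x `^ r) * normc (h x)); last by ring.
  by rewrite ler_wpM2r ?normc_ge0// ler_pdivlMr ?powR_gt0 ?japanese_gt0.
have iv : leb.-integrable setT (EFin \o (fun x => 2 * M * v x)).
  rewrite (_ : _ \o _ = (fun x => (2 * M)%:E * (v x)%:E)%E)//.
  apply: integrableZl => //; apply/integrableP; split.
    exact/measurable_EFinP.
  exact: nh.
have ci g : cmeasurable g -> (forall x, normc (g x) <= G x) ->
    cintegrable (fun x => g x * h x).
  move=> mg gG; split; first exact: cmeasurableM.
  apply: (@le_lt_trans _ _ (\int[leb]_x `|(EFin \o (fun x => (2 * M * v x)%R)) x|)%E).
    apply: ae_ge0_le_integral => //.
    - by move=> x _; rewrite lee_fin normc_ge0.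
    - by apply: emeasurable_normc; exact: cmeasurableM.
    - apply: measurableT_comp => //; exact: measurable_int iv.
    - apply: filterS aeGh => x hx _.
      suff gh : normc (g x * h x) <= 2 * M * v x.
        by apply: (le_trans _ (lee_abs _)); rewrite lee_fin.
      rewrite normcM; apply: le_trans (ler_wpM2r (normc_ge0 _) (gG x)) _; apply: le_trans hx _.
      by have := mulr_ge0 M0 (v0 x); lra.
  by case/integrableP : iv.
have cf := ci f mf dominated_limit_le.
have cu n := ci (u n) (mu n) (uG n).
pose k n x := (u n x - f x) * h x.
have mk n : cmeasurable (k n) by apply: cmeasurableM => //; exact: cmeasurableB.
have kcvg x : normc (k n x) @[n --> \oo] --> (0 : R).
  under eq_fun do rewrite /k normcM.
  by rewrite -(mul0r (normc (h x))); apply: cvgMl; exact: uf.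
have c1 : {ae leb, forall x, setT x -> (normc (k n x))%:E @[n --> \oo] --> 0%E}.
  by apply: aeW => x _; apply: cvg_EFin; [exact: nearW|exact: kcvg].
have c2 : {ae leb, forall x n, setT x ->
    (`|(normc (k n x))%:E| <= (EFin \o (fun x => (2 * M * v x)%R)) x)%E}.
  apply: filterS aeGh => x hx n _; rewrite gee0_abs; last by rewrite lee_fin normc_ge0.
  rewrite lee_fin normcM; apply: le_trans (ler_wpM2r (normc_ge0 _) (dominated_diff_le n x)) _.
  by rewrite -!mulrA ler_wpM2l.
have [_ _] := dominated_convergence measurableT (fun n => emeasurable_normc (mk n))
  (measurable_cst 0%E) c1 iv c2.
rewrite integral0 => cvg0.
apply/cvgr0Pnorm_lt => e e0; have := ecvg0_lt cvg0 e0; apply: filterS => n h_n.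
rewrite -lte_fin; apply: le_lt_trans h_n; rewrite ger0_norm ?normc_ge0// -cintegralB//.
apply: le_trans (normc_cintegral_le (mk n)); rewrite le_eqVlt; apply/orP; left.
by apply/eqP; congr (normc _)%:E; apply: eq_cintegral => x; rewrite /k mulrBl.
Qed.

End limits.

End dominated_limits.

(** * The dominating integral *)

Section bilinear_kernel.
Context {R : realType} {d : nat}.
Local Notation V := 'rV[R]_d.
Local Notation leb := (@leb R d).
Implicit Types (F : V * V -> R[i]) (f g h : V -> R[i]).

Definition absTF F f g (xi : V) : \bar R :=
  (\int[leb]_eta (normc (F (xi, eta)) * normc (f eta) * normc (g (xi - eta)%R))%:E)%E.

Definition integrand F f g (z : V * V) : R[i] := F z * f z.2 * g (z.1 - z.2).

Lemma absTFE F f g xi :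
  absTF F f g xi = (\int[leb]_eta (normc (integrand F f g (xi, eta)))%:E)%E.
Proof. by apply: eq_integral => eta _; rewrite /integrand !normcM. Qed.

Lemma cmeasurable_snd f : cmeasurable f -> cmeasurable (fun z : V * V => f z.2).
Proof. by move=> mf; apply: (cmeasurable_comp mf); exact: measurable_snd. Qed.

Lemma cmeasurable_fst f : cmeasurable f -> cmeasurable (fun z : V * V => f z.1).
Proof. by move=> mf; apply: (cmeasurable_comp mf); exact: measurable_fst. Qed.

Lemma cmeasurable_diff f : cmeasurable f ->
  cmeasurable (fun z : V * V => f (z.1 - z.2)).
Proof.
move=> mf; apply: (cmeasurable_comp mf).
by apply: measurable_rV_sub; [exact: measurable_fst|exact: measurable_snd].
Qed.

Lemma cmeasurable_pair1 (K : V * V -> R[i]) x : cmeasurable K ->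
  cmeasurable (fun y => K (x, y)).
Proof. by move=> mK; apply: (cmeasurable_comp mK); exact: pair1_measurable. Qed.

Lemma cmeasurable_pair2 (K : V * V -> R[i]) y : cmeasurable K ->
  cmeasurable (fun x => K (x, y)).
Proof. by move=> mK; apply: (cmeasurable_comp mK); exact: pair2_measurable. Qed.

Lemma cmeasurable_integrand F f g : cmeasurable F -> cmeasurable f ->
  cmeasurable g -> cmeasurable (integrand F f g).
Proof.
move=> mF mf mg; apply: cmeasurableM; last exact: cmeasurable_diff.
by apply: cmeasurableM => //; exact: cmeasurable_snd.
Qed.

Lemma measurable_absTF F f g : cmeasurable F -> cmeasurable f ->
  cmeasurable g -> measurable_fun setT (absTF F f g).
Proof.
move=> mF mf mg; rewrite (_ : absTF F f g = fun x =>
    (\int[leb]_y (normc (integrand F f g (x, y)))%:E)%E); last first.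
  by apply/funext => x; exact: absTFE.
apply: (measurable_fun_fubini_tonelli_F (fun z => (normc (integrand F f g z))%:E)).
  by apply: emeasurable_normc; exact: cmeasurable_integrand.
by move=> z; rewrite lee_fin normc_ge0.
Qed.

Lemma absTF_ge0 F f g xi : (0 <= absTF F f g xi)%E.
Proof.
by apply: integral_ge0 => x _; rewrite lee_fin !mulr_ge0// normc_ge0.
Qed.

Lemma cmeasurable_TF F f g : cmeasurable F -> cmeasurable f ->
  cmeasurable g -> cmeasurable (TF F f g).
Proof.
by move=> mF mf mg; exact: (cmeasurable_cintegral (cmeasurable_integrand mF mf mg)).
Qed.

Lemma TF_le_absTF F f g xi : cmeasurable F -> cmeasurable f ->
  cmeasurable g -> ((normc (TF F f g xi))%:E <= absTF F f g xi)%E.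
Proof.
move=> mF mf mg; rewrite absTFE.
apply: (@normc_cintegral_le _ _ (fun eta => integrand F f g (xi, eta))).
by apply: cmeasurable_pair1; exact: cmeasurable_integrand.
Qed.

Lemma Lnorm_lty_ae (q : \bar R) (u : V -> \bar R) : (0 < q)%E ->
  measurable_fun setT u -> (Lnorm leb q u < +oo)%E ->
  {ae leb, forall x, (`|u x| < +oo)%E}.
Proof.
case: q => [p| |//] p0 mu.
- have {}p0 : 0 < p by rewrite -lte_fin.
  move=> nu; have : (\int[leb]_x (`|u x| `^ p) < +oo)%E.
    by rewrite -poweR_Lnorm ?gt_eqF//; exact: poweR_lty.
  move=> iu; have mp : measurable_fun setT (fun x => (`|u x| `^ p)%E).
    apply: (@measurableT_comp _ _ _ _ _ _ (fun x => x `^ p)%E) => //=.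
      exact: (measurableT_comp (measurable_poweR _)).
    exact: measurableT_comp.
  have Iu : leb.-integrable setT (fun x => (`|u x| `^ p)%E).
    apply/integrableP; split => //.
    by under eq_integral do rewrite gee0_abs ?poweR_ge0//.
  have := integrable_ae measurableT Iu; apply: filterS => x /(_ I).
  rewrite ltey fin_numE => /andP[_]; apply: contraNN => /eqP ->.
  by rewrite poweRyr// gt_eqF.
- move=> nu; have := ae_le_Lnormy u; apply: filterS => x.
  by move=> /le_lt_trans; exact.
Qed.

(** The substitution eta -> xi - eta exchanges the two factors. It transports
    every statement about the first variable to the second. *)
Definition flip F (z : V * V) : R[i] := F (z.1, z.1 - z.2).

Lemma cmeasurable_flip F : cmeasurable F -> cmeasurable (flip F).
Proof.
move=> mF; apply: (cmeasurable_comp mF); apply/measurable_fun_pairP; split.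
  exact: measurable_fst.
by apply: measurable_rV_sub; [exact: measurable_fst|exact: measurable_snd].
Qed.

Lemma integral_reflect (a : V) (u : V -> \bar R) : measurable_fun setT u ->
  (\int[leb]_x u (a - x)%R = \int[leb]_x u x)%E.
Proof.
move=> mu; rewrite integralE [RHS]integralE; congr (_ - _)%E.
- rewrite -(@ge0_integral_reflect _ _ a (funepos u)) //.
    by apply: eq_integral => x _; rewrite !funeposE.
  exact: measurable_funepos.
- rewrite -(@ge0_integral_reflect _ _ a (funeneg u)) //.
    by apply: eq_integral => x _; rewrite !funenegE.
  exact: measurable_funeneg.
Qed.

Lemma cintegral_reflect (a : V) (f : V -> R[i]) : cmeasurable f ->
  cintegral (fun x => f (a - x)) = cintegral f.
Proof.
move=> [m1 m2]; congr (_ +i* _)%C; congr fine.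
  by apply: (integral_reflect a (u := fun x => (complex.Re (f x))%:E)); exact/measurable_EFinP.
by apply: (integral_reflect a (u := fun x => (complex.Im (f x))%:E)); exact/measurable_EFinP.
Qed.

Lemma integrand_flip F f g xi eta :
  integrand (flip F) g f (xi, xi - eta) = integrand F f g (xi, eta).
Proof. by rewrite /integrand /flip /= subKr mulrAC. Qed.

Lemma TF_flip F f g : cmeasurable F -> cmeasurable f -> cmeasurable g ->
  TF (flip F) g f = TF F f g.
Proof.
move=> mF mf mg; apply/funext => xi.
rewrite /TF -[LHS](@cintegral_reflect xi (fun y => integrand (flip F) g f (xi, y))).
  by apply: eq_cintegral => eta; rewrite integrand_flip.
by apply: cmeasurable_pair1; apply: cmeasurable_integrand => //; exact: cmeasurable_flip.
Qed.

Lemma absTF_flip F f g : cmeasurable F -> cmeasurable f -> cmeasurable g ->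
  absTF (flip F) g f = absTF F f g.
Proof.
move=> mF mf mg; apply/funext => xi; rewrite !absTFE.
rewrite -[LHS](@integral_reflect xi (fun y => (normc (integrand (flip F) g f (xi, y)))%:E)).
  by apply: eq_integral => eta _; rewrite integrand_flip.
apply: emeasurable_normc; apply: cmeasurable_pair1.
by apply: cmeasurable_integrand => //; exact: cmeasurable_flip.
Qed.

(** Boundedness of the dominating operator between weighted spaces; all the
    analysis of the extension depends on F only through this property. *)
Definition bounded_kernel (q : \bar R) (r1 r2 : R) (K : R) F : Prop :=
  [/\ cmeasurable F, 0 <= K & forall f g, Lqr q r1 f -> Lqr q r2 g ->
    (Lnorm leb q (absTF F f g) <= K%:E * normLqr q r1 f * normLqr q r2 g)%E].

Lemma bounded_kernel_flip q r1 r2 K F :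
  bounded_kernel q r1 r2 K F -> bounded_kernel q r2 r1 K (flip F).
Proof.
move=> [mF K0 HF]; split => //; first exact: cmeasurable_flip.
move=> f g Lf Lg; rewrite absTF_flip//; [|exact: (proj1 Lg)|exact: (proj1 Lf)].
by rewrite -muleA [X in (_ * X)%E]muleC muleA; exact: HF.
Qed.

End bilinear_kernel.

(** * Continuity of the operator *)

Section extension.
Context {R : realType} {d : nat}.
Local Notation V := 'rV[R]_d.
Local Notation leb := (@leb R d).
Implicit Types (F : V * V -> R[i]) (f g h : V -> R[i]).

Section bounded.
Variables (q : \bar R) (r1 r2 K : R) (F : V * V -> R[i]).
Hypothesis q1 : (1 <= q)%E.
Hypothesis HF : bounded_kernel q r1 r2 K F.

Let q0 : (0 < q)%E. Proof. exact: lt_le_trans q1. Qed.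
Let mF : cmeasurable F. Proof. by case: HF. Qed.
Let K0 : 0 <= K. Proof. by case: HF. Qed.

Lemma Lnorm_absTF_lty f g : Lqr q r1 f -> Lqr q r2 g ->
  (Lnorm leb q (absTF F f g) < +oo)%E.
Proof.
move=> Lf Lg; case: HF => _ _ /(_ _ _ Lf Lg) /le_lt_trans; apply.
rewrite lte_mul_pinfty ?mule_ge0 ?lee_fin ?Lnorm_ge0//; last by case: Lg.
rewrite ge0_fin_numE ?mule_ge0 ?lee_fin ?Lnorm_ge0//.
by rewrite lte_mul_pinfty ?lee_fin//; case: Lf.
Qed.

Lemma cintegrable_integrand f g : Lqr q r1 f -> Lqr q r2 g ->
  {ae leb, forall xi, cintegrable (fun eta => integrand F f g (xi, eta))}.
Proof.
move=> Lf Lg; have [mf _] := Lf; have [mg _] := Lg.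
have := Lnorm_lty_ae q0 (measurable_absTF mF mf mg) (Lnorm_absTF_lty Lf Lg).
apply: filterS => xi; rewrite gee0_abs ?absTF_ge0// absTFE => h; split => //.
by apply: cmeasurable_pair1; exact: cmeasurable_integrand.
Qed.

Lemma normLq_TF_le f g : Lqr q r1 f -> Lqr q r2 g ->
  (normLq q (TF F f g) <= K%:E * normLqr q r1 f * normLqr q r2 g)%E.
Proof.
move=> Lf Lg; have [mf _] := Lf; have [mg _] := Lg.
case: HF => _ _ /(_ _ _ Lf Lg); apply: le_trans; apply: le_Lnorm => //.
- by apply: emeasurable_normc; exact: cmeasurable_TF.
- exact: measurable_absTF.
- apply: aeW => xi; rewrite gee0_abs ?lee_fin ?normc_ge0// gee0_abs ?absTF_ge0//.
  exact: TF_le_absTF.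
Qed.

Lemma Lq_TF f g : Lqr q r1 f -> Lqr q r2 g -> Lq q (TF F f g).
Proof.
move=> Lf Lg; have [mf _] := Lf; have [mg _] := Lg.
split; first exact: cmeasurable_TF.
apply: le_lt_trans (Lnorm_absTF_lty Lf Lg); apply: le_Lnorm => //.
- by apply: emeasurable_normc; exact: cmeasurable_TF.
- exact: measurable_absTF.
- apply: aeW => xi; rewrite gee0_abs ?lee_fin ?normc_ge0// gee0_abs ?absTF_ge0//.
  exact: TF_le_absTF.
Qed.

(** Bilinearity holds only at the points xi where the integrals involved
    converge absolutely, hence almost everywhere. *)
Lemma TF_diff f g f' g' : Lqr q r1 f -> Lqr q r2 g -> Lqr q r1 f' ->
  Lqr q r2 g' ->
  ae_equal (fun x => TF F f' g' x - TF F f g x)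
    (fun x => TF F (fun y => f' y - f y) g' x + TF F f (fun y => g' y - g y) x).
Proof.
move=> Lf Lg Lf' Lg'.
apply: filterS3 (cintegrable_integrand Lf Lg) (cintegrable_integrand Lf' Lg')
  (cintegrable_integrand Lf Lg') => x I1 I2 I3.
have -> : TF F (fun y => f' y - f y) g' x = TF F f' g' x - TF F f g' x.
  rewrite /TF -cintegralB//; apply: eq_cintegral => y.
  by rewrite mulrBr mulrBl.
have -> : TF F f (fun y => g' y - g y) x = TF F f g' x - TF F f g x.
  rewrite /TF -cintegralB//; apply: eq_cintegral => y.
  by rewrite mulrBr.
by rewrite addrA subrK.
Qed.

Lemma TF_norm_continuous f g : Lqr q r1 f -> Lqr q r2 g -> forall e : R, 0 < e ->
  exists2 delta : R, 0 < delta &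
    forall f' g', Lqr q r1 f' -> Lqr q r2 g' ->
      (normLqr q r1 (fun x => f' x - f x)%R < delta%:E)%E ->
      (normLqr q r2 (fun x => g' x - g x)%R < delta%:E)%E ->
      (normLq q (fun x => TF F f' g' x - TF F f g x)%R < e%:E)%E.
Proof.
move=> Lf Lg e e0.
have fin r h : Lqr q r h -> exists2 a : R, 0 <= a & normLqr q r h = a%:E.
  move=> [_ nh]; exists (fine (normLqr q r h)); first by rewrite fine_ge0// Lnorm_ge0.
  by rewrite fineK// ge0_fin_numE// Lnorm_ge0.
have [a a0 Ea] := fin _ _ Lf; have [b b0 Eb] := fin _ _ Lg.
pose M := K * (a + b + 1) + 1.
have M0 : 0 < M by rewrite ltr_wpDl// mulr_ge0// !addr_ge0.
pose delta := Num.min 1 (e / M).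
have dl1 : delta <= 1 by rewrite ge_min lexx.
have dle : delta <= e / M by rewrite ge_min lexx orbT.
have d0 : 0 < delta by rewrite lt_min ltr01 divr_gt0.
exists delta => // f' g' Lf' Lg' ff gg.
have [mf _] := Lf; have [mg _] := Lg; have [mf' _] := Lf'; have [mg' _] := Lg'.
have Lff := LqrB q1 Lf' Lf; have Lgg := LqrB q1 Lg' Lg.
have m1 : cmeasurable (TF F (fun y => f' y - f y) g') by apply: cmeasurable_TF => //; exact: cmeasurableB.
have m2 : cmeasurable (TF F f (fun y => g' y - g y)) by apply: cmeasurable_TF => //; exact: cmeasurableB.
rewrite (normLq_ae_eq q0 _ _ (TF_diff Lf Lg Lf' Lg')); last 2 first.
- by apply: cmeasurableB; exact: cmeasurable_TF.
- exact: cmeasurableD.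
rewrite -normLqr0; apply: le_lt_trans (normLqrD 0 q1 m1 m2) _; rewrite normLqr0.
apply: le_lt_trans (leeD (normLq_TF_le Lff Lg') (normLq_TF_le Lf Lgg)) _.
have [s s0 Es] := fin _ _ Lff; have [t t0 Et] := fin _ _ Lgg.
have [c c0 Ec] := fin _ _ Lg'.
have ng' : c <= t + b.
  rewrite -lee_fin EFinD -Ec -Et -Eb.
  rewrite [leLHS](_ : _ = normLqr q r2 (fun x => (g' x - g x) + g x)).
    by apply: normLqrD => //; exact: cmeasurableB.
  by congr normLqr; apply/funext => x; rewrite subrK.
rewrite Es lte_fin in ff; rewrite Et lte_fin in gg.
rewrite Es Et Ec Ea -!EFinM -EFinD lte_fin.
have h1 : K * s * c <= K * delta * (1 + b).
  apply: ler_pM; rewrite ?mulr_ge0//; first by rewrite ler_wpM2l// ltW.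
  by rewrite (le_trans ng')// lerD2r (le_trans (ltW gg)).
have h2 : K * a * t <= K * a * delta by rewrite ler_wpM2l ?mulr_ge0// ltW.
apply: (@lt_le_trans _ _ (delta * M)); last by rewrite -ler_pdivlMr.
have : delta * M = K * delta * (1 + b) + K * a * delta + delta by rewrite /M; ring.
lra.
Qed.

End bounded.

Section weakstar.
Variables (r1 r2 K : R) (F : V * V -> R[i]) (g h : V -> R[i]).
Hypothesis HF : bounded_kernel +oo r1 r2 K F.
Hypothesis Lg : Lqr +oo r2 g.
Hypothesis Lh : Lqr 1 (- 0) h.

Let mF : cmeasurable F. Proof. by case: HF. Qed.
Let mg : cmeasurable g. Proof. by case: Lg. Qed.
Let mh : cmeasurable h. Proof. by case: Lh. Qed.

(** With g and h fixed, f |-> int (TF F f g) h is integration against [adjoint]. *)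
Definition dual_kernel (z : V * V) : R[i] := F z * g (z.1 - z.2) * h z.1.

Definition adjoint (eta : V) : R[i] := cintegral (fun xi => dual_kernel (xi, eta)).

Lemma cmeasurable_dual_kernel : cmeasurable dual_kernel.
Proof.
apply: cmeasurableM; last exact: cmeasurable_fst.
by apply: cmeasurableM => //; exact: cmeasurable_diff.
Qed.

Lemma dual_integral_lty f : Lqr +oo r1 f ->
  (\int[leb]_xi \int[leb]_eta (normc (f eta * dual_kernel (xi, eta)))%:E < +oo)%E.
Proof.
move=> Lf; have [mf _] := Lf.
have [_ nh] := Lh; rewrite normLqrE Lnorm1 in nh.
pose M := Lnorm leb +oo (absTF F f g).
have Moo : (M < +oo)%E := Lnorm_absTF_lty HF Lf Lg.
have M0 : (0 <= M)%E by exact: Lnorm_ge0.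
have mk := cmeasurableM (cmeasurable_snd mf) cmeasurable_dual_kernel.
apply: (@le_lt_trans _ _ (\int[leb]_xi (M * (normc (h xi))%:E))%E).
  apply: ae_ge0_le_integral => //.
  - by move=> x _; apply: integral_ge0 => y _; rewrite lee_fin normc_ge0.
  - apply: (measurable_fun_fubini_tonelli_F (fun z => (normc (f z.2 * dual_kernel z))%:E)).
      exact: emeasurable_normc mk.
    by move=> z; rewrite lee_fin normc_ge0.
  - by move=> x _; rewrite mule_ge0// lee_fin normc_ge0.
  - by apply: emeasurable_funM => //; exact: emeasurable_normc.
  - have := ae_le_Lnormy (absTF F f g); apply: filterS => xi hxi _.
    rewrite (eq_integral (fun eta => (normc (integrand F f g (xi, eta)))%:E * (normc (h xi))%:E)%E); last first.
      move=> eta _; rewrite -EFinM -normcM; congr (normc _)%:E.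
      by rewrite /integrand /dual_kernel/=; ring.
    rewrite ge0_integralZr//; last 3 first.
    + by apply: emeasurable_normc; apply: cmeasurable_pair1; exact: cmeasurable_integrand.
    + by move=> eta _; rewrite lee_fin normc_ge0.
    + by rewrite lee_fin normc_ge0.
    rewrite -absTFE lee_wpmul2r ?lee_fin ?normc_ge0//.
    by move: hxi; rewrite gee0_abs ?absTF_ge0.
rewrite ge0_integralZl//; last 2 first.
- exact: emeasurable_normc.
- by move=> x _; rewrite lee_fin normc_ge0.
rewrite lte_mul_pinfty// ?ge0_fin_numE//.
move: nh; congr (_ < _)%E; apply: eq_integral => x _ /=.
by rewrite oppr0 powRr0 mulr1 ger0_norm ?normc_ge0.
Qed.

(** The element of the weighted L^oo space on which the dual kernel is tested: it
    has norm one and vanishes nowhere, so bounds for f = weight are bounds for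
    the kernel. *)
Definition weight (x : V) : R[i] := ((japanese x `^ (- r1))%:C)%C.

Lemma Lqr_weight : Lqr +oo r1 weight.
Proof.
have mw : cmeasurable weight by apply: cmeasurable_real; exact: measurable_japanese_powR.
split => //; rewrite normLqrE; apply: (@le_lt_trans _ _ 1%E); last exact: ltry.
apply: Lnormy_le; apply: aeW => x.
have E : normc (weight x) * japanese x `^ r1 = 1.
  rewrite /weight normc_real ger0_norm ?powR_ge0// powRN mulVf//.
  by rewrite gt_eqF// powR_gt0// japanese_gt0.
by rewrite -[X in (`|X| <= _)%E]/((normc (weight x) * japanese x `^ r1)%:E) E abse_EFin normr1.
Qed.

Lemma dual_integral_swap f : Lqr +oo r1 f ->
  (\int[leb]_eta \int[leb]_xi (normc (f eta * dual_kernel (xi, eta)))%:E < +oo)%E.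
Proof.
move=> Lf; have := dual_integral_lty Lf.
have [mf _] := Lf; have mk := cmeasurableM (cmeasurable_snd mf) cmeasurable_dual_kernel.
rewrite (fubini_tonelli (fun z => (normc (f z.2 * dual_kernel z))%:E))//.
  exact: emeasurable_normc mk.
by move=> z; rewrite lee_fin normc_ge0.
Qed.

(** Integrability of the kernel times the weight, divided by the nonzero weight. *)
Lemma cintegrable_dual_kernel :
  {ae leb, forall eta, cintegrable (fun xi => dual_kernel (xi, eta))}.
Proof.
have mw := proj1 Lqr_weight.
have mk := cmeasurableM (cmeasurable_snd mw) cmeasurable_dual_kernel.
have Iw : leb.-integrable setT
    (fun eta => \int[leb]_xi (normc (weight eta * dual_kernel (xi, eta)))%:E)%E.
  apply/integrableP; split.
    apply: (measurable_fun_fubini_tonelli_G (fun z => (normc (weight z.2 * dual_kernel z))%:E)).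
      exact: emeasurable_normc mk.
    by move=> z; rewrite lee_fin normc_ge0.
  apply: le_lt_trans (dual_integral_swap Lqr_weight); rewrite le_eqVlt.
  apply/orP; left; apply/eqP; apply: eq_integral => eta _; rewrite gee0_abs//.
  by apply: integral_ge0 => x _; rewrite lee_fin normc_ge0.
have := integrable_ae measurableT Iw; apply: filterS => eta /(_ I) fineta.
have w0 : weight eta != 0.
  by rewrite -normc_eq0 normc_real normr_eq0 gt_eqF// powR_gt0// japanese_gt0.
have cw : cintegrable (fun xi => weight eta * dual_kernel (xi, eta)).
  split; first exact: (cmeasurable_pair2 (K := fun z => weight z.2 * dual_kernel z)).
  rewrite -ge0_fin_numE//.
  by apply: integral_ge0 => x _; rewrite lee_fin normc_ge0.
have := cintegrableZ (weight eta)^-1 cw; congr cintegrable.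
by apply/funext => xi; rewrite mulKf.
Qed.

Lemma cmeasurable_adjoint : cmeasurable adjoint.
Proof.
apply: (cmeasurable_cintegral (K := fun z => dual_kernel (z.2, z.1))).
apply: (cmeasurable_comp cmeasurable_dual_kernel).
by apply/measurable_fun_pairP; split; [exact: measurable_snd|exact: measurable_fst].
Qed.

Lemma Lqr_adjoint : Lqr 1 (- r1) adjoint.
Proof.
have ma := cmeasurable_adjoint; split => //.
rewrite normLqrE Lnorm1; apply: le_lt_trans (dual_integral_swap Lqr_weight).
have mw := proj1 Lqr_weight.
have mk := cmeasurableM (cmeasurable_snd mw) cmeasurable_dual_kernel.
apply: ae_ge0_le_integral => //.
- apply: measurableT_comp => //; apply/measurable_EFinP.
  by apply: measurable_weighted; exact: measurable_normc.
- by move=> y _; apply: integral_ge0 => x _; rewrite lee_fin normc_ge0.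
- apply: (measurable_fun_fubini_tonelli_G (fun z => (normc (weight z.2 * dual_kernel z))%:E)).
    exact: emeasurable_normc mk.
  by move=> z; rewrite lee_fin normc_ge0.
- apply: filterS cintegrable_dual_kernel => eta ceta _.
  have E : normc (cintegral (fun xi => weight eta * dual_kernel (xi, eta))) =
      normc (adjoint eta) * japanese eta `^ (- r1).
    by rewrite cintegralZ// normcM normc_real ger0_norm ?powR_ge0// mulrC.
  rewrite gee0_abs; last by rewrite lee_fin mulr_ge0 ?normc_ge0 ?powR_ge0.
  rewrite -[leLHS]/((normc (adjoint eta) * japanese eta `^ (- r1))%:E) -E.
  exact: (normc_cintegral_le (cmeasurable_pair2 eta mk)).
Qed.

(** Fubini's theorem, which applies because the dominating integral is essentially
    bounded and h is integrable. *)
Lemma TF_adjoint f : Lqr +oo r1 f ->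
  cintegral (fun xi => TF F f g xi * h xi) = cintegral (fun eta => f eta * adjoint eta).
Proof.
move=> Lf; have [mf _] := Lf.
have mk := cmeasurableM (cmeasurable_snd mf) cmeasurable_dual_kernel.
transitivity (cintegral (fun xi => cintegral (fun eta => f eta * dual_kernel (xi, eta)))).
  apply: ae_eq_cintegral.
  - by apply: cmeasurableM => //; exact: cmeasurable_TF.
  - exact: cmeasurable_cintegral mk.
  - apply: filterS (cintegrable_integrand (leey 1%E) HF Lf Lg) => xi Ixi.
    rewrite mulrC -[LHS](cintegralZ (h xi) Ixi); apply: eq_cintegral => eta.
    by rewrite /integrand /dual_kernel/=; ring.
rewrite (cFubini mk (dual_integral_lty Lf)).
apply: ae_eq_cintegral.
- apply: (cmeasurable_cintegral (K := fun z => f z.1 * dual_kernel (z.2, z.1))).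
  apply: (cmeasurable_comp mk (h := fun z => (z.2, z.1))).
  by apply/measurable_fun_pairP; split; [exact: measurable_snd|exact: measurable_fst].
- by apply: cmeasurableM => //; exact: cmeasurable_adjoint.
- by apply: filterS cintegrable_dual_kernel => eta ceta; rewrite /= cintegralZ.
Qed.

End weakstar.

Lemma TF_weakstar_continuous r1 r2 K F g : bounded_kernel +oo r1 r2 K F ->
  Lqr +oo r2 g -> forall (u : (V -> R[i])^nat) f, (forall n, Lqr +oo r1 (u n)) ->
  Lqr +oo r1 f -> weakstar_cvg r1 u f ->
  weakstar_cvg 0 (fun n => TF F (u n) g) (TF F f g).
Proof.
move=> HF Lg u f Lu Lf uf h Lh.
rewrite (_ : (fun n => _) = (fun n => normc
    (cintegral (fun x => u n x * adjoint F g h x) -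
     cintegral (fun x => f x * adjoint F g h x)))).
  exact: uf (Lqr_adjoint HF Lg Lh).
by apply/funext => n; rewrite !(TF_adjoint HF Lg Lh).
Qed.

End extension.

(** * Uniqueness of the extension *)

Section uniqueness.
Context {R : realType} {d : nat}.
Hypothesis d_gt0 : (0 < d)%N.
Local Notation V := 'rV[R]_d.
Local Notation leb := (@leb R d).
Implicit Types (F : V * V -> R[i]) (f g h : V -> R[i]).

(** What dominated pointwise convergence yields in L^q: norm convergence for finite
    q, but no more than weak-* convergence for q = oo, as bounded pointwise
    convergence need not be uniform. *)
Definition Lq_cvg (q : \bar R) (u : (V -> R[i])^nat) f : Prop :=
  if q == +oo%E then weakstar_cvg 0 u f else forall e : R, 0 < e ->
    \forall n \near \oo, (normLq q (fun x => u n x - f x)%R < e%:E)%E.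

Definition dominated_continuous (q : \bar R) (r : R)
    (A : (V -> R[i]) -> V -> R[i]) : Prop :=
  forall (u : (V -> R[i])^nat) f G, (forall n, cmeasurable (u n)) ->
    cmeasurable f -> majorant q r G -> (forall n x, normc (u n x) <= G x) ->
    (forall x, normc (u n x - f x) @[n --> \oo] --> (0 : R)) ->
    Lq_cvg q (fun n => A (u n)) (A f).

(** One tests with the conjugate of the difference w = f - g times an integrable
    weight, which turns the pairing into the integral of |w|^2 times a positive
    function. *)
Lemma weakstar_separation f g : Lq +oo f -> Lq +oo g ->
  (forall h, Lqr 1 (- 0) h -> cintegral (fun x => f x * h x) =
     cintegral (fun x => g x * h x)) -> ae_equal f g.
Proof.
move=> Lf Lg fg; have [mf nf] := Lf; have [mg ng] := Lg.
pose w x := f x - g x; have mw : cmeasurable w by exact: cmeasurableB.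
have [_ nw] : Lq +oo w by rewrite -Lqr0; apply: LqrB => //; rewrite ?leey// Lqr0.
pose j (x : V) := japanese x `^ (- d.+1%:R).
have j0 x : 0 < j x by rewrite powR_gt0// japanese_gt0.
have mj : measurable_fun setT j by exact: measurable_japanese_powR.
pose h x : R[i] := ((complex.Re (w x) * j x) +i* (- complex.Im (w x) * j x))%C.
have hE x : normc (h x) = normc (w x) * j x.
  rewrite !normcE2 /= !exprMn sqrrN -mulrDl sqrtrM ?addr_ge0 ?sqr_ge0//.
  by rewrite sqrtr_sqr gtr0_norm.
have mh : cmeasurable h.
  case: mw => w1 w2; split => /=; first exact: measurable_funM.
  by apply: measurable_funM => //; exact: measurableT_comp.
have bound (k : V -> R[i]) : Lq +oo k -> exists2 M, 0 <= M &
    {ae leb, forall x, normc (k x) <= M}.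
  move=> [mk nk]; exists (fine (normLq +oo k)); first by rewrite fine_ge0// Lnorm_ge0.
  have := ae_le_Lnormy (fun x => (normc (k x))%:E); apply: filterS => x.
  rewrite gee0_abs ?lee_fin ?normc_ge0// -lee_fin fineK// ge0_fin_numE//.
  exact: Lnorm_ge0.
have [M M0 wM] := bound w (conj mw nw).
have ij : (\int[leb]_x (j x)%:E < +oo)%E.
  by apply: integral_japanese_lty => //; rewrite ltr_nat.
have ih (k : V -> R[i]) : Lq +oo k -> cintegrable (fun x => k x * h x).
  move=> Lk; have [N N0 kN] := bound k Lk; have [mk _] := Lk.
  split; first exact: cmeasurableM.
  apply: (@le_lt_trans _ _ (\int[leb]_x ((N * M)%:E * (j x)%:E))%E).
    apply: ae_ge0_le_integral => //.
    - by move=> x _; rewrite lee_fin normc_ge0.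
    - by apply: emeasurable_normc; exact: cmeasurableM.
    - by move=> x _; rewrite mule_ge0 ?lee_fin ?mulr_ge0 ?(ltW (j0 x)).
    - by apply: measurable_funeM; exact/measurable_EFinP.
    - apply: filterS2 kN wM => x kx wx _; rewrite -EFinM lee_fin normcM hE mulrA.
      by rewrite ler_wpM2r ?(ltW (j0 x))// ler_pM ?normc_ge0.
  rewrite ge0_integralZl//.
  - by rewrite lte_mul_pinfty ?lee_fin ?mulr_ge0.
  - exact/measurable_EFinP.
  - by move=> x _; rewrite lee_fin ltW.
  - by rewrite lee_fin mulr_ge0.
have Lh : Lqr 1 (- 0) h.
  split => //; rewrite normLqrE Lnorm1.
  have L1 : Lq +oo (fun _ : V => 1 : R[i]).
    split; first exact: cmeasurable_cst.
    apply: (@le_lt_trans _ _ 1%E); last exact: ltry.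
    by apply: Lnormy_le; apply: aeW => x; rewrite normc1 abse_EFin normr1.
  have [_] := ih _ L1; congr (_ < _)%E; apply: eq_integral => x _.
  by rewrite mul1r /= oppr0 powRr0 mulr1 ger0_norm ?normc_ge0.
have E0 : cintegral (fun x => w x * h x) = 0.
  have /eqP := fg h Lh; rewrite -subr_eq0 -cintegralB; [|exact: ih..].
  by move/eqP => <-; apply: eq_cintegral => x; rewrite mulrBl.
have whE x : w x * h x = (((normc (w x) ^+ 2) * j x)%:C)%C.
  rewrite /h; case: (w x) => a b; apply: complex_eqP => /=; last by ring.
  by rewrite sqr_sqrtr ?addr_ge0 ?sqr_ge0//; ring.
have Iw := cintegrable_Re (ih w (conj mw nw)).
have I0 : (\int[leb]_x `|((normc (w x) ^+ 2) * j x)%:E| = 0)%E.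
  have := congr1 (@complex.Re R) E0; rewrite [complex.Re 0]/= [complex.Re (cintegral _)]/=.
  rewrite /Rintegral => h0; have := congr1 EFin h0; rewrite fineK; last exact: integrable_fin_num Iw.
  move=> E1; rewrite -[RHS]E1; apply: eq_integral => x _; rewrite whE gee0_abs//.
  by rewrite lee_fin mulr_ge0 ?sqr_ge0// ltW.
have mwj : measurable_fun setT (fun x => ((normc (w x) ^+ 2) * j x)%:E).
  by apply/measurable_EFinP; apply: measurable_funM => //; apply: measurable_funX;
     exact: measurable_normc.
have := (ae_eq_integral_abs leb measurableT mwj).1 I0.
apply: filterS => x /(_ I) [] /eqP.
rewrite mulf_eq0 (gt_eqF (j0 x)) orbF expf_eq0/= normc_eq0 subr_eq0.
by move/eqP.
Qed.

(** The set where two such maps agree is closed under dominated limits, since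
    their limits are unique in the norm or weak-* sense. *)
Lemma dominated_continuous_unique (q : \bar R) (r : R) (A B : (V -> R[i]) -> V -> R[i]) :
  (1 <= q)%E ->
  (forall f, Lqr q r f -> Lq q (A f)) -> (forall f, Lqr q r f -> Lq q (B f)) ->
  dominated_continuous q r A -> dominated_continuous q r B ->
  (forall f, test_function f -> Lqr q r f -> ae_equal (A f) (B f)) ->
  forall f, Lqr q r f -> ae_equal (A f) (B f).
Proof.
move=> q1 LA LB cA cB AB f Lf; have q0 : (0 < q)%E by exact: lt_le_trans q1.
have mb (b : V -> R) : bump b -> majorant q r (fun x => `|b x|) by exact: majorant_bump.
apply: (@dominated_density R d (majorant q r) _ _ mb (fun f => ae_equal (A f) (B f))
  _ _ f (fun x => normc (f x))) => //.
- by move=> G H; exact: majorantD.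
- by move=> c G; exact: majorantZ.
- move=> a b ba bb; apply: AB; first exact: test_function_bump.
  apply: (@Lqr_majorant _ _ _ _ _ (fun x => `|a x| + `|b x|)) => //.
  + by split => /=; apply: elementary_measurable; [case: ba|case: bb].
  + by apply: majorantD => //; exact: mb.
  + by move=> x; exact: normc_le.
- move=> {Lf} u {}f G mu mf uAB mG uG uf.
  have fG := dominated_limit_le uG uf.
  have Lf : Lqr q r f := Lqr_majorant q0 mf mG fG.
  have Lu n : Lqr q r (u n) := Lqr_majorant q0 (mu n) mG (uG n).
  have [mAf nAf] := LA _ Lf; have [mBf nBf] := LB _ Lf.
  have mAu n := (LA _ (Lu n)).1; have mBu n := (LB _ (Lu n)).1.
  have := cA _ _ _ mu mf mG uG uf; have := cB _ _ _ mu mf mG uG uf.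
  rewrite /Lq_cvg; case: ifPn => [/eqP qoo|qfin] cvB cvA.
    rewrite qoo in mAf nAf mBf nBf.
    apply: weakstar_separation => // h Lh.
    have [mh _] := Lh.
    have EAB n : cintegral (fun x => A (u n) x * h x) = cintegral (fun x => B (u n) x * h x).
      by apply: ae_eq_cintegral; [exact: cmeasurableM..|]; apply: filterS (uAB n) => x ->.
    apply/eqP; rewrite -subr_eq0 -normc_eq0 eq_le normc_ge0 andbT.
    have cv : normc (cintegral (fun x => A (u n) x * h x) -
          cintegral (fun x => A f x * h x)) +
        normc (cintegral (fun x => B (u n) x * h x) -
          cintegral (fun x => B f x * h x)) @[n --> \oo] --> (0 : R).
      by rewrite -[X in _ --> X]addr0; apply: cvgD; [exact: cvA|exact: cvB].
    apply: (cvgr_to_ge cv).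
    apply: nearW => n; rewrite EAB normcB.
    by apply: le_trans (normcD_le _ _); rewrite addrA subrK normcB.
  apply: (normLq_eq0_ae q0 mAf mBf); apply/eqP; rewrite eq_le Lnorm_ge0 andbT.
  apply/lee_addgt0Pr => e e0; rewrite add0e.
  have e2 : 0 < e / 2 by rewrite divr_gt0.
  near \oo => n.
  have hA : (normLq q (fun x => A (u n) x - A f x)%R < (e / 2)%:E)%E.
    by near: n; exact: cvA.
  have hB : (normLq q (fun x => B (u n) x - B f x)%R < (e / 2)%:E)%E.
    by near: n; exact: cvB.
  apply: (@le_trans _ _ (normLq q (fun x => (A f x - A (u n) x) + (B (u n) x - B f x))%R)).
    rewrite le_eqVlt; apply/orP; left; apply/eqP; apply: normLq_ae_eq => //.
    - exact: cmeasurableB.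
    - by apply: cmeasurableD; exact: cmeasurableB.
    - by apply: filterS (uAB n) => x ->; rewrite subrKA.
  rewrite -normLqr0; apply: le_trans (normLqrD 0 q1 _ _) _; [exact: cmeasurableB..|].
  rewrite normLqr0 (splitr e) EFinD; apply: leeD; last exact: ltW.
  apply: le_trans (ltW hA); rewrite -normLqr0 le_eqVlt; apply/orP; left; apply/eqP.
  by apply: normLqr_norm_eq => x; exact: normcB.
- exact: (proj1 Lf).
- exact: majorant_normc.
Unshelve. all: by end_near. Qed.

Lemma dominated_continuous_left q r F T g : (1 <= q)%E ->
  continuous_extension q r F T -> Lqr q r g ->
  dominated_continuous q 0 (fun f => T f g).
Proof.
move=> q1 [LT cT wT _] Lg u f G mu mf mG uG uf.
have q0 : (0 < q)%E by exact: lt_le_trans q1.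
have fG := dominated_limit_le uG uf.
have Lf : Lq q f by rewrite -Lqr0; exact: Lqr_majorant q0 mf mG fG.
have Lu n : Lq q (u n) by rewrite -Lqr0; exact: Lqr_majorant q0 (mu n) mG (uG n).
rewrite /Lq_cvg; case: ifPn => [/eqP qoo|qfin].
  have [w1 _] := wT qoo; subst q.
  by apply: w1 => //; exact: dominated_weakstar_cvg mG.
move=> e e0; have [del del0 H] := cT _ _ Lf Lg e e0.
case: q q1 q0 qfin mG H LT cT wT Lg Lf Lu => [p| |]// q1 q0 _ mG H LT cT wT Lg Lf Lu.
have p1 : 1 <= p by rewrite -lee_fin.
have := dominated_normLqr_cvg mu mf uG uf p1 mG del0.
apply: filterS => n hn; apply: H => //; first by rewrite -normLqr0.
by rewrite normLqr_sub0// lte_fin.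
Qed.

Lemma dominated_continuous_right q r F T f : (1 <= q)%E ->
  continuous_extension q r F T -> Lq q f ->
  dominated_continuous q r (fun g => T f g).
Proof.
move=> q1 [LT cT wT _] Lf u g G mu mg mG uG ug.
have q0 : (0 < q)%E by exact: lt_le_trans q1.
have gG := dominated_limit_le uG ug.
have Lg : Lqr q r g := Lqr_majorant q0 mg mG gG.
have Lu n : Lqr q r (u n) := Lqr_majorant q0 (mu n) mG (uG n).
rewrite /Lq_cvg; case: ifPn => [/eqP qoo|qfin].
  have [_ w2] := wT qoo; subst q.
  by apply: w2 => //; exact: dominated_weakstar_cvg mG.
move=> e e0; have [del del0 H] := cT _ _ Lf Lg e e0.
case: q q1 q0 qfin mG H LT cT wT Lg Lf Lu => [p| |]// q1 q0 _ mG H LT cT wT Lg Lf Lu.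
have p1 : 1 <= p by rewrite -lee_fin.
have := dominated_normLqr_cvg mu mg uG ug p1 mG del0.
apply: filterS => n hn; apply: H => //.
by rewrite -normLqr0 normLqr_sub0// lte_fin.
Qed.

Lemma TF_continuous_extension q r K F : (1 <= q)%E ->
  bounded_kernel q 0 r K F -> continuous_extension q r F (TF F).
Proof.
move=> q1 HF; split.
- by move=> f g; rewrite -Lqr0 => Lf Lg; rewrite Lqr0; exact: (Lq_TF q1 HF Lf Lg).
- move=> f g; rewrite -Lqr0 => Lf Lg e e0.
  have [del del0 H] := TF_norm_continuous q1 HF Lf Lg e0.
  by exists del => // f' g'; rewrite -normLqr0 => Lf' Lg' h1 h2; rewrite normLqr0; exact: H.
- move=> qoo; subst q; split.
  + move=> u f g Lu Lf Lg uf.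
    by apply: (TF_weakstar_continuous HF) => //; [move=> n|]; rewrite Lqr0.
  + move=> f u g Lf Lu Lg ug; have mF : cmeasurable F by case: HF.
    rewrite (_ : (fun n => _) = fun n => TF (flip F) (u n) f); last first.
      by apply/funext => n; rewrite TF_flip//; [case: Lf|case: (Lu n)].
    rewrite -TF_flip//; [|by case: Lf|by case: Lg].
    apply: (TF_weakstar_continuous (bounded_kernel_flip HF)) => //.
    by rewrite Lqr0.
- by move=> f g _ _; apply: aeW.
Qed.

(** Continuity is applied in one variable at a time: first in f, with g a test
    function, then in g, with f arbitrary. *)
Theorem TF_unique_continuous_extension q r K F : (1 <= q)%E ->
  bounded_kernel q 0 r K F -> unique_continuous_extension q r F (TF F).
Proof.
move=> q1 HF; have cTF := TF_continuous_extension q1 HF.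
split => // T cT f g Lf Lg.
have [LT _ _ eT] := cT; have [LTF _ _ _] := cTF.
suff test g' : test_function g' -> Lqr q r g' -> ae_equal (T f g') (TF F f g').
  apply: (@dominated_continuous_unique q r (T f) (TF F f)) => //.
  - by move=> h; exact: LT.
  - by move=> h; exact: LTF.
  - exact: dominated_continuous_right cT _.
  - exact: dominated_continuous_right cTF _.
move=> tg Lg'; apply: (@dominated_continuous_unique q 0 (T^~ g') ((TF F)^~ g')) => //.
- by move=> h; rewrite Lqr0 => Lh; exact: LT.
- by move=> h; rewrite Lqr0 => Lh; exact: LTF.
- exact: dominated_continuous_left cT _.
- exact: dominated_continuous_left cTF _.
- by move=> h th _; exact: eT.
- by rewrite Lqr0.
Qed.

End uniqueness.

(** * Inequalities of Hoelder and Tonelli type *)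

Section hoelder_geometric.
Context {R : realType} {d : nat}.
Local Notation V := 'rV[R]_d.
Local Notation leb := (@leb R d).
Local Open Scope ereal_scope.

(** Hoelder's inequality written as log-convexity. Without norms and conjugate
    exponents it iterates directly and needs no finiteness. *)
Lemma hoelder_geometric (u v : V -> R) (s t : R) :
  measurable_fun setT u -> measurable_fun setT v ->
  (forall x, 0 <= u x)%R -> (forall x, 0 <= v x)%R ->
  (0 < s)%R -> (0 < t)%R -> (s + t = 1)%R ->
  \int[leb]_x (u x `^ s * v x `^ t)%:E <=
  (\int[leb]_x (u x)%:E) `^ s * (\int[leb]_x (v x)%:E) `^ t.
Proof.
move=> mu mv u0 v0 s0 t0 st.
have mp (w : V -> R) (a : R) : measurable_fun setT w ->
    measurable_fun setT (fun x => w x `^ a)%R.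
  by move=> mw; exact: (measurableT_comp (measurable_powR a)).
have NE (w : V -> R) (a : R) : (forall x, 0 <= w x)%R -> (0 < a)%R ->
    Lnorm leb (a^-1)%:E (EFin \o (fun x => w x `^ a)%R) = (\int[leb]_x (w x)%:E) `^ a.
  move=> w0 a0; rewrite unlock invrK; congr (_ `^ _); apply: eq_integral => x _.
  rewrite /= ger0_norm ?powR_ge0// -powRrM mulfV ?gt_eqF// powRr1//.
have := @hoelder _ _ _ leb (fun x => u x `^ s)%R (fun x => v x `^ t)%R s^-1 t^-1
  (mp _ _ mu) (mp _ _ mv).
rewrite !invr_gt0 !invrK => /(_ s0 t0 st); rewrite !NE// Lnorm1; apply: le_trans.
rewrite le_eqVlt; apply/orP; left; apply/eqP; apply: eq_integral => x _ /=.
by rewrite ger0_norm ?mulr_ge0 ?powR_ge0.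
Qed.

(** The last two factors are grouped into a geometric mean of their own. *)
Lemma hoelder_geometric3 (u v w : V -> R) (r s t : R) :
  measurable_fun setT u -> measurable_fun setT v -> measurable_fun setT w ->
  (forall x, 0 <= u x)%R -> (forall x, 0 <= v x)%R -> (forall x, 0 <= w x)%R ->
  (0 < r)%R -> (0 < s)%R -> (0 < t)%R -> (r + s + t = 1)%R ->
  \int[leb]_x (u x `^ r * v x `^ s * w x `^ t)%:E <=
  (\int[leb]_x (u x)%:E) `^ r * (\int[leb]_x (v x)%:E) `^ s *
  (\int[leb]_x (w x)%:E) `^ t.
Proof.
move=> mu mv mw u0 v0 w0 r0 s0 t0 rst.
have st0 : (0 < s + t)%R by rewrite addr_gt0.
have stE : (r + (s + t) = 1)%R by rewrite addrA.
pose z x := (v x `^ (s / (s + t)) * w x `^ (t / (s + t)))%R.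
have z0 x : (0 <= z x)%R by rewrite mulr_ge0 ?powR_ge0.
have mz : measurable_fun setT z.
  by apply: measurable_funM; exact: (measurableT_comp (measurable_powR _)).
have zE x : (v x `^ s * w x `^ t = z x `^ (s + t))%R.
  by rewrite /z powRM ?powR_ge0// -!powRrM !divfK ?gt_eqF.
under eq_integral do rewrite -mulrA zE.
apply: le_trans (hoelder_geometric mu mz u0 z0 r0 st0 stE) _.
rewrite -muleA lee_wpmul2l ?poweR_ge0//.
have I0 (y : V -> R) : (forall x, 0 <= y x)%R -> 0 <= \int[leb]_x (y x)%:E.
  by move=> y0; apply: integral_ge0 => x _; rewrite lee_fin.
have [s1 t1] : (0 < s / (s + t))%R /\ (0 < t / (s + t))%R by rewrite !divr_gt0.
have e1 : (s / (s + t) + t / (s + t) = 1)%R by rewrite -mulrDl divff// gt_eqF.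
have h := hoelder_geometric mv mw v0 w0 s1 t1 e1.
apply: (@le_trans _ _ (((\int[leb]_x (v x)%:E) `^ (s / (s + t)) *
    (\int[leb]_x (w x)%:E) `^ (t / (s + t))) `^ (s + t))).
  apply: gt0_ler_poweR; [exact: ltW|..|exact: h].
    by rewrite in_itv/= leey andbT I0.
  by rewrite in_itv/= leey andbT mule_ge0 ?poweR_ge0.
by rewrite poweRM ?poweR_ge0// -!poweRrM !divfK ?gt_eqF.
Qed.

(** For extended values that are almost everywhere finite, as partial integrals of
    integrable functions are. *)
Lemma hoelder_geometric_ereal (X Y : V -> \bar R) (s t : R) :
  measurable_fun setT X -> measurable_fun setT Y ->
  (forall x, 0 <= X x) -> (forall x, 0 <= Y x) ->
  (0 < s)%R -> (0 < t)%R -> (s + t = 1)%R ->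
  \int[leb]_x X x < +oo -> \int[leb]_x Y x < +oo ->
  \int[leb]_x (X x `^ s * Y x `^ t) <=
  (\int[leb]_x X x) `^ s * (\int[leb]_x Y x) `^ t.
Proof.
move=> mX mY X0 Y0 s0 t0 st IX IY.
have aefin (Z : V -> \bar R) : measurable_fun setT Z -> (forall x, 0 <= Z x) ->
    \int[leb]_x Z x < +oo -> {ae leb, forall x, Z x \is a fin_num}.
  move=> mZ Z0 IZ; have : leb.-integrable setT Z.
    by apply/integrableP; split=> //; under eq_integral do rewrite gee0_abs//.
  by move/(integrable_ae measurableT); apply: filterS => x /(_ I).
have fX := aefin _ mX X0 IX; have fY := aefin _ mY Y0 IY.
have mfine (Z : V -> \bar R) : measurable_fun setT Z -> measurable_fun setT (fine \o Z).
  by move=> mZ; apply: measurableT_comp => //; exact: fine_measurable.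
have := hoelder_geometric (mfine _ mX) (mfine _ mY) (fun x => fine_ge0 (X0 x))
  (fun x => fine_ge0 (Y0 x)) s0 t0 st.
have IE (Z : V -> \bar R) : measurable_fun setT Z ->
    {ae leb, forall x, Z x \is a fin_num} ->
    \int[leb]_x ((fine \o Z) x)%:E = \int[leb]_x Z x.
  move=> mZ fZ; apply: ae_eq_integral => //; first by apply/measurable_EFinP; exact: mfine.
  by apply: filterS fZ => x Zx _ /=; rewrite fineK.
rewrite !IE//; apply: le_trans; rewrite le_eqVlt; apply/orP; left; apply/eqP.
apply: ae_eq_integral => //.
- by apply: emeasurable_funM; exact: (measurableT_comp (measurable_poweR _)).
- apply/measurable_EFinP; apply: measurable_funM;
    by apply: (measurableT_comp (measurable_powR _)); exact: mfine.
- apply: filterS2 fX fY => x Xx Yx _ /=.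
  by rewrite -(fineK Xx) -(fineK Yx) !poweR_EFin -EFinM.
Qed.

End hoelder_geometric.

Section tonelli_estimates.
Context {R : realType} {d : nat}.
Local Notation V := 'rV[R]_d.
Local Notation leb := (@leb R d).
Local Open Scope ereal_scope.

Lemma measurable_inner (k : V * V -> R) : measurable_fun setT k ->
  (forall z, 0 <= k z)%R ->
  measurable_fun setT (fun x => \int[leb]_y (k (x, y))%:E).
Proof.
move=> mk k0; apply: (measurable_fun_fubini_tonelli_F (EFin \o k)).
  exact/measurable_EFinP.
by move=> z; rewrite /= lee_fin.
Qed.

Lemma measurable_tensor (u v : V -> R) : measurable_fun setT u ->
  measurable_fun setT v -> measurable_fun setT (fun z : V * V => u z.2 * v (z.1 - z.2))%R.
Proof.
move=> mu mv; apply: measurable_funM.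
  by apply: (measurableT_comp mu); exact: measurable_snd.
apply: (measurableT_comp mv).
by apply: measurable_rV_sub; [exact: measurable_fst|exact: measurable_snd].
Qed.

Lemma integral_convolution (u v : V -> R) : measurable_fun setT u ->
  measurable_fun setT v -> (forall x, 0 <= u x)%R -> (forall x, 0 <= v x)%R ->
  \int[leb]_x \int[leb]_y (u y * v (x - y))%:E =
  \int[leb]_y (u y)%:E * \int[leb]_x (v x)%:E.
Proof.
move=> mu mv u0 v0.
have mk := measurable_tensor mu mv.
rewrite (fubini_tonelli (fun z : V * V => (u z.2 * v (z.1 - z.2)%R)%:E)); last 2 first.
- exact/measurable_EFinP.
- by move=> z; rewrite lee_fin mulr_ge0.
have Iv0 : 0 <= \int[leb]_x (v x)%:E.
  by apply: integral_ge0 => x _; rewrite lee_fin.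
rewrite -ge0_integralZr//; [|exact/measurable_EFinP|by move=> x _; rewrite lee_fin].
apply: eq_integral => y _ /=.
rewrite -(@ge0_integral_translate _ _ y (fun x => (v x)%:E)); last 2 first.
- exact/measurable_EFinP.
- by move=> x; rewrite lee_fin.
rewrite -ge0_integralZl//.
- apply/measurable_EFinP; apply: (measurableT_comp mv).
  exact: measurable_rV_sub.
- by move=> x _; rewrite lee_fin.
- by rewrite lee_fin.
Qed.

(** Exchanging the integrals brings the hypothesis on the sections of k into
    play. *)
Lemma integral_fiber_le (k : V * V -> R) (u : V -> R) (M : R) :
  measurable_fun setT k -> measurable_fun setT u ->
  (forall z, 0 <= k z)%R -> (forall x, 0 <= u x)%R -> (0 <= M)%R ->
  {ae leb, forall y, \int[leb]_x (k (x, y))%:E <= M%:E} ->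
  \int[leb]_x \int[leb]_y (k (x, y) * u y)%:E <= M%:E * \int[leb]_y (u y)%:E.
Proof.
move=> mk mu k0 u0 M0 kM.
have mku : measurable_fun setT (fun z : V * V => (k z * u z.2)%R).
  by apply: measurable_funM => //; apply: (measurableT_comp mu); exact: measurable_snd.
rewrite (fubini_tonelli (fun z : V * V => (k z * u z.2)%:E)); last 2 first.
- exact/measurable_EFinP.
- by move=> z; rewrite lee_fin mulr_ge0.
rewrite -ge0_integralZl//; [|exact/measurable_EFinP|by move=> x _; rewrite lee_fin].
apply: ae_ge0_le_integral => //.
- by move=> y _; apply: integral_ge0 => x _; rewrite lee_fin mulr_ge0.
- apply: (measurable_fun_fubini_tonelli_G (fun z : V * V => (k z * u z.2)%:E)).
    exact/measurable_EFinP.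
  by move=> z; rewrite lee_fin mulr_ge0.
- by move=> y _; rewrite -EFinM lee_fin mulr_ge0.
- by apply: measurable_funeM; exact/measurable_EFinP.
- apply: filterS kM => y kMy _ /=.
  rewrite (eq_integral (fun x => (k (x, y))%:E * (u y)%:E)) => [|x _]; last by rewrite EFinM.
  rewrite ge0_integralZr// ?lee_fin//.
  + by rewrite lee_wpmul2r ?lee_fin.
  + by apply/measurable_EFinP; apply: (measurableT_comp mk); exact: pair2_measurable.
  + by move=> x _; rewrite lee_fin.
Qed.

(** By Tonelli's theorem the exceptional set is null in the product, which can be
    read off from the sections in either direction. *)
Lemma ae_swap (k : V * V -> R) (M : R) : measurable_fun setT k ->
  {ae leb, forall y, {ae leb, forall x, (k (x, y) <= M)%R}} ->
  {ae leb, forall x, {ae leb, forall y, (k (x, y) <= M)%R}}.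
Proof.
move=> mk kM.
pose e (z : V * V) : R := if (k z <= M)%R then 0%R else 1%R.
have me : measurable_fun setT e.
  by apply: measurable_fun_ifT => //; exact: measurable_fun_ler.
have e0 z : (0 <= e z)%R by rewrite /e; case: ifP.
have mE : measurable_fun setT (EFin \o e) by exact/measurable_EFinP.
have E0 z : 0 <= (EFin \o e) z by rewrite /= lee_fin.
have swap := fubini_tonelli (m1 := leb) (m2 := leb) (EFin \o e) mE E0.
have I0 : \int[leb]_y \int[leb]_x (e (x, y))%:E = 0.
  rewrite (ae_eq_integral (cst 0)) ?integral0//.
    exact: (measurable_fun_fubini_tonelli_G (EFin \o e)).
  apply: filterS kM => y kMy _.
  rewrite (ae_eq_integral (cst 0)) ?integral0//.
    by apply/measurable_EFinP; apply: (measurableT_comp me); exact: pair2_measurable.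
  by apply: filterS kMy => x kx _; rewrite /e kx.
have J0 : \int[leb]_x `|\int[leb]_y (e (x, y))%:E| = 0.
  rewrite -[RHS]I0 -[RHS]swap; apply: eq_integral => x _.
  by rewrite gee0_abs//; apply: integral_ge0 => y _; rewrite lee_fin.
have mi := measurable_inner me e0.
have := (ae_eq_integral_abs leb measurableT mi).1 J0; apply: filterS => x /(_ I) /= ex0.
have mex : measurable_fun setT (fun y => (e (x, y))%:E).
  by apply/measurable_EFinP; apply: (measurableT_comp me); exact: pair1_measurable.
have ex1 : \int[leb]_y `|(e (x, y))%:E| = 0.
  by rewrite -[RHS]ex0; apply: eq_integral => y _; rewrite gee0_abs// lee_fin.
have := (ae_eq_integral_abs leb measurableT mex).1 ex1; apply: filterS => y /(_ I) /=.
by rewrite /e; case: ifP => // _ [] /eqP; rewrite oner_eq0.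
Qed.

End tonelli_estimates.

(** * Bounds for the trilinear integral *)

Section trilinear_bounds.
Context {R : realType} {d : nat}.
Local Notation V := 'rV[R]_d.
Local Notation leb := (@leb R d).
Local Open Scope ereal_scope.

Variables (a : V * V -> R) (b c : V -> R).
Hypothesis ma : measurable_fun setT a.
Hypothesis mb : measurable_fun setT b.
Hypothesis mc : measurable_fun setT c.
Hypothesis a0 : forall z, (0 <= a z)%R.
Hypothesis b0 : forall y, (0 <= b y)%R.
Hypothesis c0 : forall y, (0 <= c y)%R.

Definition trilinear (xi : V) : \bar R :=
  \int[leb]_eta (a (xi, eta) * b eta * c (xi - eta)%R)%:E.

Let ma1 (xi : V) : measurable_fun setT (fun eta : V => a (xi, eta)).
Proof. by apply: (measurableT_comp ma); exact: pair1_measurable. Qed.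

Let mcr (xi : V) : measurable_fun setT (fun eta : V => c (xi - eta)).
Proof. by apply: (measurableT_comp mc); exact: measurable_rV_sub. Qed.

Let mpow d1 (T : measurableType d1) (u : T -> R) (t : R) : measurable_fun setT u ->
  measurable_fun setT (fun x => u x `^ t)%R.
Proof. by move=> mu; exact: (measurableT_comp (measurable_powR t)). Qed.

Let m_abs (xi : V) : measurable_fun setT
  (fun eta : V => (a (xi, eta) * b eta * c (xi - eta)%R)%:E).
Proof.
by apply/measurable_EFinP; apply: measurable_funM => //; exact: measurable_funM.
Qed.

Let abc0 (xi eta : V) : (0 <= a (xi, eta) * b eta * c (xi - eta))%R.
Proof. by rewrite !mulr_ge0. Qed.

Let T0 xi : 0 <= trilinear xi.
Proof. by apply: integral_ge0 => y _; rewrite lee_fin. Qed.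

Let mT : measurable_fun setT trilinear.
Proof.
apply: (@measurable_inner _ _ (fun z : V * V => a z * b z.2 * c (z.1 - z.2))%R).
  rewrite (_ : (fun z => _) = (fun z : V * V => a z * (b z.2 * c (z.1 - z.2)))%R).
    by apply: measurable_funM => //; exact: measurable_tensor.
  by apply/funext => z; rewrite mulrA.
by move=> z; rewrite !mulr_ge0.
Qed.

Let mTpow (p : R) : measurable_fun setT (fun xi => trilinear xi `^ p).
Proof. exact: (measurableT_comp (measurable_poweR _)). Qed.

Let poweR_mono (p : R) (x y : \bar R) : (0 <= p)%R -> 0 <= x -> x <= y ->
  x `^ p <= y `^ p.
Proof.
move=> p0 x0 xy; apply: gt0_ler_poweR => //; rewrite in_itv/= leey andbT//.
exact: le_trans xy.
Qed.

Let int0 (u : V -> R) (t : R) : 0 <= \int[leb]_y (u y `^ t)%:E.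
Proof. by apply: integral_ge0 => y _; rewrite lee_fin powR_ge0. Qed.

Let m_conv (s t : R) :
  measurable_fun setT (fun xi : V => \int[leb]_eta (b eta `^ s * c (xi - eta)%R `^ t)%:E).
Proof.
apply: (measurable_inner (measurable_tensor (mpow s mb) (mpow t mc))) => z.
by rewrite mulr_ge0 ?powR_ge0.
Qed.

Let m_fiber (s t : R) :
  measurable_fun setT (fun xi : V => \int[leb]_eta (a (xi, eta) `^ s * b eta `^ t)%:E).
Proof.
apply: (@measurable_inner _ _ (fun z : V * V => a z `^ s * b z.2 `^ t)%R) => [|z].
  apply: measurable_funM; first exact: mpow.
  by apply: mpow; apply: (measurableT_comp mb); exact: measurable_snd.
by rewrite mulr_ge0 ?powR_ge0.
Qed.

Let conv0 (s t : R) (xi : V) : 0 <= \int[leb]_eta (b eta `^ s * c (xi - eta)%R `^ t)%:E.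
Proof. by apply: integral_ge0 => y _; rewrite lee_fin mulr_ge0 ?powR_ge0. Qed.

Let fiber0 (s t : R) (xi : V) : 0 <= \int[leb]_eta (a (xi, eta) `^ s * b eta `^ t)%:E.
Proof. by apply: integral_ge0 => y _; rewrite lee_fin mulr_ge0 ?powR_ge0. Qed.

Let conv_le (p v w : R) :
  \int[leb]_y (b y `^ p)%:E <= (v `^ p)%:E ->
  \int[leb]_y (c y `^ p)%:E <= (w `^ p)%:E ->
  \int[leb]_xi \int[leb]_eta (b eta `^ p * c (xi - eta)%R `^ p)%:E <=
    (v `^ p * w `^ p)%:E.
Proof.
move=> Hb Hc.
rewrite (integral_convolution (mpow p mb) (mpow p mc)); last 2 first.
  by move=> x; exact: powR_ge0.
  by move=> x; exact: powR_ge0.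
by rewrite EFinM lee_pmul.
Qed.

(** The common end of the arguments that bound the trilinear integral pointwise by
    a convolution of b^p and c^p. *)
Lemma trilinear_le_convolution (p M v w : R) : (0 < p)%R ->
  (0 <= M)%R -> (0 <= v)%R -> (0 <= w)%R ->
  \int[leb]_y (b y `^ p)%:E <= (v `^ p)%:E ->
  \int[leb]_y (c y `^ p)%:E <= (w `^ p)%:E ->
  {ae leb, forall xi, trilinear xi `^ p <=
    (M `^ p)%:E * \int[leb]_eta (b eta `^ p * c (xi - eta)%R `^ p)%:E} ->
  \int[leb]_xi (trilinear xi `^ p) <= ((M * v * w) `^ p)%:E.
Proof.
move=> p0 M0 v0 w0 Hb Hc H.
apply: (@le_trans _ _ (\int[leb]_xi ((M `^ p)%:E *
    \int[leb]_eta (b eta `^ p * c (xi - eta)%R `^ p)%:E))).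
  apply: ae_ge0_le_integral => //.
  - by move=> x _; exact: poweR_ge0.
  - by move=> x _; rewrite mule_ge0 ?lee_fin ?powR_ge0.
  - exact: measurable_funeM.
  - by apply: filterS H => x h _.
rewrite ge0_integralZl ?lee_fin ?powR_ge0//.
rewrite !powRM ?mulr_ge0// -mulrA EFinM lee_wpmul2l ?lee_fin ?powR_ge0//.
exact: conv_le.
Qed.

(** Hoelder's inequality in eta between a and the product b c. *)
Lemma trilinear_le_fiber (p M : R) : (1 < p)%R -> (0 <= M)%R ->
  {ae leb, forall xi,
    \int[leb]_eta (a (xi, eta) `^ (p / (p - 1)))%:E <= (M `^ (p / (p - 1)))%:E} ->
  {ae leb, forall xi, trilinear xi `^ p <=
    (M `^ p)%:E * \int[leb]_eta (b eta `^ p * c (xi - eta)%R `^ p)%:E}.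
Proof.
move=> p1 M0; have p0 : (0 < p)%R by exact: lt_trans p1.
have p10 : (0 < p - 1)%R by rewrite subr_gt0.
set p' := (p / (p - 1))%R.
have p'0 : (0 < p')%R by rewrite divr_gt0.
have pp : (p'^-1 + p^-1 = 1)%R by rewrite /p'; field; rewrite !gt_eqF.
apply: filterS => xi H.
have [ip0 ip'0] : (0 < p^-1)%R /\ (0 < p'^-1)%R by rewrite !invr_gt0.
have J0 := int0 (fun eta => a (xi, eta)) p'.
have := @hoelder_geometric _ _ (fun eta => a (xi, eta) `^ p')%R
  (fun eta : V => b eta `^ p * c (xi - eta) `^ p)%R p'^-1 p^-1 (mpow p' (ma1 xi))
  (measurable_funM (mpow p mb) (mpow p (mcr xi)))
  (fun x => powR_ge0 _ _) (fun x => mulr_ge0 (powR_ge0 _ _) (powR_ge0 _ _)) ip'0 ip0 pp.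
rewrite (eq_integral (fun eta => (a (xi, eta) * b eta * c (xi - eta)%R)%:E)); last first.
  move=> y _; rewrite powRM ?powR_ge0// -!powRrM !mulfV ?gt_eqF// !powRr1//.
  by rewrite mulrA.
rewrite -/(trilinear xi) => h.
apply: le_trans (poweR_mono (ltW p0) (T0 _) h) _.
rewrite poweRM ?poweR_ge0// -!poweRrM mulVf ?gt_eqF// poweRe1//.
rewrite lee_wpmul2r//.
apply: le_trans (poweR_mono _ J0 H) _; first by rewrite mulr_ge0// ltW.
by rewrite poweR_EFin -powRrM mulrA mulfV ?gt_eqF// mul1r.
Qed.

Lemma trilinear_le_fiber1 (M : R) : (0 <= M)%R ->
  {ae leb, forall xi, {ae leb, forall eta, (a (xi, eta) <= M)%R}} ->
  {ae leb, forall xi, trilinear xi `^ 1 <=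
    (M `^ 1)%:E * \int[leb]_eta (b eta `^ 1 * c (xi - eta)%R `^ 1)%:E}.
Proof.
move=> M0; apply: filterS => xi H.
rewrite poweRe1// powRr1// -ge0_integralZl//.
- apply: ae_ge0_le_integral => //.
  + by move=> x _; rewrite lee_fin abc0.
  + by move=> x _; rewrite -EFinM lee_fin !mulr_ge0 ?powR_ge0.
  + apply: measurable_funeM; apply/measurable_EFinP.
    by apply: measurable_funM; exact: mpow.
  + apply: filterS H => y ay _; rewrite -EFinM lee_fin !powRr1// mulrA.
    by rewrite !ler_wpM2r.
- by apply/measurable_EFinP; apply: measurable_funM; exact: mpow.
- by move=> x _; rewrite lee_fin !mulr_ge0 ?powR_ge0.
Qed.

(** The reflection of a null set is null: its indicator has integral zero. *)
Let ae_reflect (u : V -> R) (M : R) (xi : V) : measurable_fun setT u ->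
  {ae leb, forall y, (u y <= M)%R} -> {ae leb, forall y, (u (xi - y)%R <= M)%R}.
Proof.
move=> mu uM.
pose e (z : V) : R := if (u z <= M)%R then 0%R else 1%R.
have me : measurable_fun setT e.
  by apply: measurable_fun_ifT => //; exact: measurable_fun_ler.
have e0 z : 0 <= (e z)%:E by rewrite lee_fin /e; case: ifP.
have mer : measurable_fun setT (fun y : V => (e (xi - y)%R)%:E).
  by apply/measurable_EFinP; apply: (measurableT_comp me); exact: measurable_rV_sub.
have I0 : \int[leb]_y (e y)%:E = 0.
  rewrite (ae_eq_integral (cst 0)) ?integral0//; first exact/measurable_EFinP.
  by apply: filterS uM => y uy _; rewrite /e uy.
have J0 : \int[leb]_y `|(e (xi - y)%R)%:E| = 0.
  rewrite -[RHS]I0 -(@ge0_integral_reflect _ _ xi (fun y => (e y)%:E))//.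
    by apply: eq_integral => y _; rewrite gee0_abs.
  exact/measurable_EFinP.
have := (ae_eq_integral_abs leb measurableT mer).1 J0; apply: filterS => y /(_ I).
by rewrite /e; case: ifP => // _ [] /eqP; rewrite oner_eq0.
Qed.

Lemma trilinear_bounded_fiber (M v w : R) : (0 <= M)%R -> (0 <= v)%R -> (0 <= w)%R ->
  {ae leb, forall y, (b y <= v)%R} -> {ae leb, forall y, (c y <= w)%R} ->
  {ae leb, forall xi, \int[leb]_eta (a (xi, eta))%:E <= M%:E} ->
  {ae leb, forall xi, trilinear xi <= (M * v * w)%:E}.
Proof.
move=> M0 v0 w0 Hb Hc; apply: filterS => xi H.
apply: (@le_trans _ _ (\int[leb]_eta ((v * w)%:E * (a (xi, eta))%:E))).
  apply: ae_ge0_le_integral => //.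
  - by move=> x _; rewrite lee_fin abc0.
  - by move=> x _; rewrite -EFinM lee_fin !mulr_ge0.
  - by apply: measurable_funeM; exact/measurable_EFinP.
  - apply: filterS2 Hb (ae_reflect xi mc Hc) => y by_ cy _.
    by rewrite -EFinM lee_fin -mulrA [leRHS]mulrC ler_wpM2l// ler_pM.
rewrite ge0_integralZl//; [|exact/measurable_EFinP| |].
- apply: (@le_trans _ _ ((v * w)%:E * M%:E)).
    by rewrite lee_wpmul2l ?lee_fin ?mulr_ge0.
  by rewrite -EFinM lee_fin mulrC mulrA.
- by move=> x _; rewrite lee_fin.
- by rewrite lee_fin mulr_ge0.
Qed.

Lemma trilinear_bounded_integrable (M v w : R) :
  (0 <= M)%R -> (0 <= v)%R -> (0 <= w)%R ->
  {ae leb, forall y, (b y <= v)%R} -> \int[leb]_x (c x)%:E <= w%:E ->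
  {ae leb, forall xi, {ae leb, forall eta, (a (xi, eta) <= M)%R}} ->
  {ae leb, forall xi, trilinear xi <= (M * v * w)%:E}.
Proof.
move=> M0 v0 w0 Hb Hc; apply: filterS => xi H.
apply: (@le_trans _ _ (\int[leb]_eta ((M * v)%:E * (c (xi - eta)%R)%:E))).
  apply: ae_ge0_le_integral => //.
  - by move=> x _; rewrite lee_fin abc0.
  - by move=> x _; rewrite -EFinM lee_fin !mulr_ge0.
  - by apply: measurable_funeM; exact/measurable_EFinP.
  - apply: filterS2 Hb H => y by_ ay _.
    by rewrite -EFinM lee_fin ler_wpM2r// ler_pM.
rewrite ge0_integralZl//; [|exact/measurable_EFinP| |].
- rewrite (@ge0_integral_reflect _ _ xi (fun y => (c y)%:E))//; last exact/measurable_EFinP.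
  by rewrite [leRHS]EFinM lee_wpmul2l ?lee_fin ?mulr_ge0.
- by move=> x _; rewrite lee_fin.
- by rewrite lee_fin mulr_ge0.
Qed.

(** Hoelder's inequality in eta between the product a b and c. The factor that
    contains c no longer depends on xi, and the other is integrated in xi along
    the sections on which a is controlled. *)
Lemma trilinear_le_hoelder (p M v w : R) : (1 < p)%R ->
  (0 <= M)%R -> (0 <= v)%R -> (0 <= w)%R ->
  {ae leb, forall eta, \int[leb]_xi (a (xi, eta) `^ p)%:E <= (M `^ p)%:E} ->
  \int[leb]_y (b y `^ p)%:E <= (v `^ p)%:E ->
  \int[leb]_y (c y `^ (p / (p - 1)))%:E <= (w `^ (p / (p - 1)))%:E ->
  \int[leb]_xi (trilinear xi `^ p) <= ((M * v * w) `^ p)%:E.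
Proof.
move=> p1 M0 v0 w0 Ha Hb; have p0 : (0 < p)%R by exact: lt_trans p1.
have p10 : (0 < p - 1)%R by rewrite subr_gt0.
set p' := (p / (p - 1))%R => Hc.
have p'0 : (0 < p')%R by rewrite divr_gt0.
have pp : (p^-1 + p'^-1 = 1)%R by rewrite /p'; field; rewrite !gt_eqF.
have [ip0 ip'0] : (0 < p^-1)%R /\ (0 < p'^-1)%R by rewrite !invr_gt0.
have point xi : trilinear xi `^ p <=
    (w `^ p)%:E * \int[leb]_eta (a (xi, eta) `^ p * b eta `^ p)%:E.
  have := @hoelder_geometric _ _ (fun eta : V => a (xi, eta) `^ p * b eta `^ p)%R
    (fun eta : V => c (xi - eta) `^ p')%R p^-1 p'^-1
    (measurable_funM (mpow p (ma1 xi)) (mpow p mb)) (mpow p' (mcr xi))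
    (fun x => mulr_ge0 (powR_ge0 _ _) (powR_ge0 _ _)) (fun x => powR_ge0 _ _) ip0 ip'0 pp.
  rewrite (eq_integral (fun eta => (a (xi, eta) * b eta * c (xi - eta)%R)%:E)); last first.
    by move=> y _; rewrite powRM ?powR_ge0// -!powRrM !mulfV ?gt_eqF// !powRr1.
  rewrite -/(trilinear xi) (@ge0_integral_reflect _ _ xi (fun y => (c y `^ p')%:E)); last 2 first.
    by apply/measurable_EFinP; exact: mpow.
    by move=> x; rewrite lee_fin powR_ge0.
  move=> h; apply: le_trans (poweR_mono (ltW p0) (T0 _) h) _.
  rewrite poweRM ?poweR_ge0// -!poweRrM mulVf ?gt_eqF// poweRe1// muleC.
  rewrite lee_wpmul2r//.
  have q0 : (0 <= p'^-1 * p)%R by rewrite mulr_ge0// ltW.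
  apply: le_trans (poweR_mono q0 (int0 _ _) Hc) _.
  by rewrite poweR_EFin -powRrM mulrA mulfV ?gt_eqF// mul1r.
apply: (@le_trans _ _ (\int[leb]_xi ((w `^ p)%:E *
    \int[leb]_eta (a (xi, eta) `^ p * b eta `^ p)%:E))).
  apply: ge0_le_integral => //.
  - by move=> x _; exact: poweR_ge0.
  - by apply: measurable_funeM.
rewrite ge0_integralZl ?lee_fin ?powR_ge0//.
rewrite [(M * v * w)%R]mulrC powRM ?mulr_ge0// EFinM lee_wpmul2l ?lee_fin ?powR_ge0//.
rewrite powRM//.
have := @integral_fiber_le _ _ (fun z => a z `^ p)%R (fun y => b y `^ p)%R (M `^ p)
  (mpow p ma) (mpow p mb) (fun=> powR_ge0 _ _) (fun=> powR_ge0 _ _) (powR_ge0 _ _) Ha.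
move=> h; apply: le_trans h _.
by rewrite EFinM lee_wpmul2l ?lee_fin ?powR_ge0.
Qed.

(** Interpolation between the two previous ways of grouping. With s = 1/p' and
    t = 2/p - 1 one has 2 s + t = 1, and
      a b c = (a^p' b^p)^s (b^p c^p)^t (c^p)^s.
    The third factor has an integral independent of xi. After raising to the
    power p the other two carry the exponents p - 1 and 2 - p, which again sum to
    1 and allow Hoelder's inequality in xi. *)
Lemma trilinear_le_hoelder3 (p M v w : R) : (1 < p)%R -> (p < 2)%R ->
  (0 <= M)%R -> (0 <= v)%R -> (0 <= w)%R ->
  {ae leb, forall eta, \int[leb]_xi (a (xi, eta) `^ (p / (p - 1)))%:E <=
    (M `^ (p / (p - 1)))%:E} ->
  \int[leb]_y (b y `^ p)%:E <= (v `^ p)%:E ->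
  \int[leb]_y (c y `^ p)%:E <= (w `^ p)%:E ->
  \int[leb]_xi (trilinear xi `^ p) <= ((M * v * w) `^ p)%:E.
Proof.
move=> p1 p2 M0 v0 w0; have p0 : (0 < p)%R by exact: lt_trans p1.
have p10 : (0 < p - 1)%R by rewrite subr_gt0.
have p20 : (0 < 2 - p)%R by rewrite subr_gt0.
set p' := (p / (p - 1))%R => Ha Hb Hc.
have p'0 : (0 < p')%R by rewrite divr_gt0.
have pn : p != 0%R by rewrite gt_eqF.
have pn1 : (p - 1)%R != 0%R by rewrite gt_eqF.
pose s := ((p - 1) / p)%R; pose t := ((2 - p) / p)%R.
have s0 : (0 < s)%R by rewrite divr_gt0.
have t0 : (0 < t)%R by rewrite divr_gt0.
have sts : (s + t + s = 1)%R by rewrite /s /t; field.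
have p's : (p' * s = 1)%R by rewrite /s /p'; field; apply/andP.
have psE : (p * s + p * t = 1)%R by rewrite /s /t; field.
have ptE : (p * t + p * s = 1)%R by rewrite addrC.
have psp : (s * p = p - 1)%R by rewrite /s; field.
have ptp : (t * p = 2 - p)%R by rewrite /t; field.
have st1 : (p - 1 + (2 - p) = 1)%R by ring.
have powD (x y z : R) : (0 <= x)%R -> (0 < y)%R -> (0 < z)%R -> (y + z = 1)%R ->
    (x `^ y * x `^ z = x)%R.
  move=> x0 y0 z0 yz; rewrite -powRD ?yz ?powRr1//.
  by rewrite oner_eq0.
have ps0 : (0 < p * s)%R by rewrite mulr_gt0.
have pt0 : (0 < p * t)%R by rewrite mulr_gt0.
pose X xi := \int[leb]_eta (a (xi, eta) `^ p' * b eta `^ p)%:E.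
pose Y xi := \int[leb]_eta (b eta `^ p * c (xi - eta)%R `^ p)%:E.
have IX : \int[leb]_xi X xi <= (M `^ p' * v `^ p)%:E.
  have := @integral_fiber_le _ _ (fun z => a z `^ p')%R (fun y => b y `^ p)%R (M `^ p')
    (mpow p' ma) (mpow p mb) (fun=> powR_ge0 _ _) (fun=> powR_ge0 _ _) (powR_ge0 _ _) Ha.
  move=> h; apply: le_trans h _.
  by rewrite EFinM lee_wpmul2l ?lee_fin ?powR_ge0.
have IY : \int[leb]_xi Y xi <= (v `^ p * w `^ p)%:E by exact: conv_le.
have point xi : trilinear xi `^ p <=
    ((w `^ p) `^ (p - 1))%:E * (X xi `^ (p - 1) * Y xi `^ (2 - p)).
  have := @hoelder_geometric3 _ _ (fun eta : V => a (xi, eta) `^ p' * b eta `^ p)%R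
    (fun eta : V => b eta `^ p * c (xi - eta) `^ p)%R
    (fun eta : V => c (xi - eta) `^ p)%R s t s
    (measurable_funM (mpow p' (ma1 xi)) (mpow p mb))
    (measurable_funM (mpow p mb) (mpow p (mcr xi))) (mpow p (mcr xi))
    (fun x => mulr_ge0 (powR_ge0 _ _) (powR_ge0 _ _))
    (fun x => mulr_ge0 (powR_ge0 _ _) (powR_ge0 _ _)) (fun x => powR_ge0 _ _)
    s0 t0 s0 sts.
  rewrite (eq_integral (fun eta => (a (xi, eta) * b eta * c (xi - eta)%R)%:E)); last first.
    move=> y _; rewrite !powRM ?powR_ge0// -!powRrM p's powRr1//; congr EFin.
    transitivity (a (xi, y) * (b y `^ (p * s) * b y `^ (p * t)) *
      (c (xi - y) `^ (p * t) * c (xi - y) `^ (p * s)))%R; first by ring.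
    by rewrite !powD.
  rewrite -/(trilinear xi) -/(X xi) -/(Y xi).
  rewrite (@ge0_integral_reflect _ _ xi (fun y => (c y `^ p)%:E)); last 2 first.
    by apply/measurable_EFinP; exact: mpow.
    by move=> x; rewrite lee_fin powR_ge0.
  move=> h; apply: le_trans (poweR_mono (ltW p0) (T0 _) h) _.
  rewrite !poweRM ?poweR_ge0 ?mule_ge0 ?poweR_ge0// -!poweRrM psp ptp muleC.
  rewrite lee_wpmul2r ?mule_ge0 ?poweR_ge0//.
  by rewrite -poweR_EFin; apply: poweR_mono => //; exact: ltW.
have mX : measurable_fun setT X by exact: m_fiber.
have mY : measurable_fun setT Y by exact: m_conv.
have mXY : measurable_fun setT (fun xi => X xi `^ (p - 1) * Y xi `^ (2 - p)).
  have mZ Z k : measurable_fun setT Z -> measurable_fun setT (fun xi : V => Z xi `^ k).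
    exact: (measurableT_comp (measurable_poweR k)).
  by apply: emeasurable_funM; exact: mZ.
apply: (@le_trans _ _ (\int[leb]_xi (((w `^ p) `^ (p - 1))%:E *
    (X xi `^ (p - 1) * Y xi `^ (2 - p))))).
  apply: ge0_le_integral => //.
  - by move=> x _; exact: poweR_ge0.
  - exact: measurable_funeM.
rewrite ge0_integralZl ?lee_fin ?powR_ge0//; last first.
  by move=> x _; rewrite mule_ge0 ?poweR_ge0.
have h := hoelder_geometric_ereal mX mY (fiber0 _ _) (conv0 _ _) p10 p20 st1
  (le_lt_trans IX (ltry _)) (le_lt_trans IY (ltry _)).
apply: (@le_trans _ _ (((w `^ p) `^ (p - 1))%:E *
   (((M `^ p' * v `^ p) `^ (p - 1))%:E * ((v `^ p * w `^ p) `^ (2 - p))%:E))).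
  rewrite lee_wpmul2l ?lee_fin ?powR_ge0//; apply: le_trans h _.
  apply: lee_pmul; rewrite ?poweR_ge0// -poweR_EFin.
    by apply: poweR_mono IX; [exact: ltW|apply: integral_ge0 => x _; exact: fiber0].
  by apply: poweR_mono IY; [exact: ltW|apply: integral_ge0 => x _; exact: conv0].
rewrite -!EFinM lee_fin !powRM ?mulr_ge0 ?powR_ge0// -(powRrM M).
rewrite (_ : p' * (p - 1) = p)%R; last by rewrite /p'; field.
rewrite le_eqVlt; apply/orP; left; apply/eqP.
have := powD (v `^ p)%R _ _ (powR_ge0 _ _) p10 p20 st1.
have := powD (w `^ p)%R _ _ (powR_ge0 _ _) p10 p20 st1.
move: (M `^ p)%R (v `^ p)%R (w `^ p)%R => m x y.
move: (x `^ (p - 1))%R (x `^ (2 - p))%R (y `^ (p - 1))%R (y `^ (2 - p))%R.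
by move=> x1 x2 y1 y2 <- <-; ring.
Qed.

End trilinear_bounds.

(** * Mixed norms and the bounds for the operator *)

Section mixed_norms.
Context {R : realType} {d : nat}.
Local Notation V := 'rV[R]_d.
Local Notation leb := (@leb R d).
Local Open Scope ereal_scope.
Implicit Types (F : V * V -> R[i]) (f g h : V -> R[i]).

Lemma integral_le_of_Lnorm (p M : R) (u : V -> R) : (0 < p)%R ->
  (forall x, 0 <= u x)%R -> Lnorm leb p%:E (EFin \o u) <= M%:E ->
  \int[leb]_x (u x `^ p)%:E <= (M `^ p)%:E.
Proof.
move=> p0 u0 h; rewrite -LnormEp// -poweR_EFin.
apply: gt0_ler_poweR => //; first exact: ltW.
- by rewrite in_itv/= leey andbT Lnorm_ge0.
- by rewrite in_itv/= leey andbT (le_trans (Lnorm_ge0 _ _ _) h).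
Qed.

Lemma ae_le_of_Lnormy (M : R) (u : V -> R) : (forall x, 0 <= u x)%R ->
  Lnorm leb +oo (EFin \o u) <= M%:E -> {ae leb, forall x, (u x <= M)%R}.
Proof.
move=> u0 h; have := ae_le_Lnormy (EFin \o u); apply: filterS => x.
by move=> /le_trans /(_ h); rewrite /= ger0_norm// lee_fin.
Qed.

Lemma ae_fiber_le (M : R) (U : V -> \bar R) : (forall x, 0 <= U x) ->
  Lnorm leb +oo U = M%:E -> {ae leb, forall x, U x <= M%:E}.
Proof.
move=> U0 h; have := ae_le_Lnormy U; rewrite h; apply: filterS => x.
by rewrite gee0_abs.
Qed.

Section fibers.
Variables (F : V * V -> R[i]) (M : R).

Lemma normL1_fiber (p : R) : (0 < p)%R -> normL1 p%:E +oo F = M%:E ->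
  {ae leb, forall eta, \int[leb]_xi (normc (F (xi, eta)) `^ p)%:E <= (M `^ p)%:E}.
Proof.
move=> p0 /ae_fiber_le h; have {h} : {ae leb, forall eta,
    Lnorm leb p%:E (fun xi => (normc (F (xi, eta)))%:E) <= M%:E}.
  by apply: h => eta; exact: Lnorm_ge0.
apply: filterS => eta.
apply: (@integral_le_of_Lnorm p M (fun xi => normc (F (xi, eta)))) => //.
by move=> xi; exact: normc_ge0.
Qed.

Lemma normL2_fiber (p : R) : (0 < p)%R -> normL2 +oo p%:E F = M%:E ->
  {ae leb, forall xi, \int[leb]_eta (normc (F (xi, eta)) `^ p)%:E <= (M `^ p)%:E}.
Proof.
move=> p0 /ae_fiber_le h; have {h} : {ae leb, forall xi,
    Lnorm leb p%:E (fun eta => (normc (F (xi, eta)))%:E) <= M%:E}.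
  by apply: h => xi; exact: Lnorm_ge0.
apply: filterS => xi.
apply: (@integral_le_of_Lnorm p M (fun eta => normc (F (xi, eta)))) => //.
by move=> eta; exact: normc_ge0.
Qed.

Lemma normL2y_fiber : normL2 +oo +oo F = M%:E ->
  {ae leb, forall xi, {ae leb, forall eta, (normc (F (xi, eta)) <= M)%R}}.
Proof.
move=> /ae_fiber_le h; have {h} : {ae leb, forall xi,
    Lnorm leb +oo (fun eta => (normc (F (xi, eta)))%:E) <= M%:E}.
  by apply: h => xi; exact: Lnorm_ge0.
apply: filterS => xi.
apply: (@ae_le_of_Lnormy M (fun eta => normc (F (xi, eta)))).
by move=> eta; exact: normc_ge0.
Qed.

(** The norm controls the sections xi |-> F(xi, eta), whereas the operator
    integrates along the others. *)
Lemma normL1y_fiber : cmeasurable F -> normL1 +oo +oo F = M%:E ->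
  {ae leb, forall xi, {ae leb, forall eta, (normc (F (xi, eta)) <= M)%R}}.
Proof.
move=> mF /ae_fiber_le h.
apply: (@ae_swap _ _ (fun z => normc (F z)) M (measurable_normc mF)).
have {h} : {ae leb, forall eta,
    Lnorm leb +oo (fun xi => (normc (F (xi, eta)))%:E) <= M%:E}.
  by apply: h => eta; exact: Lnorm_ge0.
apply: filterS => eta.
apply: (@ae_le_of_Lnormy M (fun xi => normc (F (xi, eta)))).
by move=> xi; exact: normc_ge0.
Qed.

End fibers.

Lemma integral_normLq (h : V -> R[i]) (p v : R) : (0 < p)%R ->
  normLq p%:E h = v%:E -> \int[leb]_x (normc (h x) `^ p)%:E <= (v `^ p)%:E.
Proof.
move=> p0 E; apply: (@integral_le_of_Lnorm p v (fun x => normc (h x))) => //.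
  by move=> x; exact: normc_ge0.
by rewrite -/(normLq p%:E h) E.
Qed.

Lemma ae_normLqy (h : V -> R[i]) (v : R) : normLq +oo h = v%:E ->
  {ae leb, forall y, (normc (h y) <= v)%R}.
Proof.
move=> E; apply: (@ae_le_of_Lnormy v (fun x => normc (h x))) => //.
  by move=> x; exact: normc_ge0.
by rewrite -/(normLq +oo h) E.
Qed.

(** Hoelder's inequality with the weight: c^p' is the geometric mean of (c <x>^r)^p
    and <x>^-t with exponents 1/(p - 1) and (p - 2)/(p - 1), for
    t = r p / (p - 2). The hypothesis on r says exactly that t > d, which makes
    the second function integrable. *)
Lemma integral_weighted_embedding (p r : R) : (0 < d)%N -> (2 < p)%R ->
  (d%:R * (1 - 2 / p) < r)%R ->
  exists2 C : R, (0 <= C)%R & forall g (w : R), cmeasurable g -> (0 <= w)%R ->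
    normLqr p%:E r g = w%:E ->
    \int[leb]_x (normc (g x) `^ (p / (p - 1)))%:E <= ((C * w) `^ (p / (p - 1)))%:E.
Proof.
move=> d0 p2 hr.
have p0 : (0 < p)%R by exact: lt_trans p2.
have p1 : (0 < p - 1)%R by lra.
have p20 : (0 < p - 2)%R by rewrite subr_gt0.
have [pn pn1 pn2] : [/\ p != 0, p - 1 != 0 & p - 2 != 0]%R by split; rewrite gt_eqF.
set p' := (p / (p - 1))%R.
have p'0 : (0 < p')%R by rewrite divr_gt0.
pose t := (r * p / (p - 2))%R.
have dt : (d%:R < t)%R.
  rewrite /t ltr_pdivlMr// -ltr_pdivrMr//; apply: le_lt_trans hr.
  by rewrite -mulrA mulrBl divff.
have Dfin := integral_japanese_lty (R := R) d0 dt.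
have D0 : 0 <= \int[leb]_x (japanese x `^ (- t))%:E.
  by apply: integral_ge0 => x _; rewrite lee_fin powR_ge0.
pose D := fine (\int[leb]_x (japanese x `^ (- t))%:E).
have DE : \int[leb]_x (japanese x `^ (- t))%:E = D%:E.
  by rewrite fineK// ge0_fin_numE.
exists (D `^ ((p - 2) / p))%R; first exact: powR_ge0.
move=> g w mg w0 E.
pose s := ((p - 1)^-1)%R; pose u := ((p - 2) / (p - 1))%R.
have s0 : (0 < s)%R by rewrite invr_gt0.
have u0 : (0 < u)%R by rewrite divr_gt0.
have su : (s + u = 1)%R by rewrite /s /u; field.
have mn := measurable_normc mg.
have mG := measurable_weighted r mn.
have IG : \int[leb]_x ((normc (g x) * japanese x `^ r) `^ p)%:E <= (w `^ p)%:E.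
  apply: (@integral_le_of_Lnorm p w (fun x => normc (g x) * japanese x `^ r)%R) => //.
    by move=> x; exact: weighted_ge0.
  by move: E; rewrite normLqrE => ->.
have := @hoelder_geometric _ _ (fun x : V => (normc (g x) * japanese x `^ r) `^ p)%R
  (fun x : V => japanese x `^ (- t))%R s u
  (measurableT_comp (measurable_powR p) mG) (measurable_japanese_powR _)
  (fun x => powR_ge0 _ _) (fun x => powR_ge0 _ _) s0 u0 su.
rewrite (eq_integral (fun x => (normc (g x) `^ p')%:E)); last first.
  move=> x _; have jx := japanese_gt0 x.
  rewrite powRM ?normc_ge0 ?powR_ge0// powRM ?powR_ge0// -!powRrM.
  rewrite -mulrA -powRD; last by rewrite (gt_eqF jx) implybT.
  rewrite (_ : (r * (p * s) + - t * u = 0)%R); last by rewrite /t /s /u; field; apply/andP.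
  by rewrite powRr0 mulr1.
move=> h; apply: le_trans h _.
rewrite DE poweR_EFin powRM ?powR_ge0// -powRrM.
rewrite (_ : (p - 2) / p * p' = u)%R; last by rewrite /p' /u; field; apply/andP.
rewrite [(_ * w `^ p')%R]mulrC [leRHS]EFinM lee_wpmul2r ?lee_fin ?powR_ge0//.
rewrite (_ : p' = p * s)%R// powRrM -[leRHS]poweR_EFin.
apply: gt0_ler_poweR => //; first exact: ltW.
- rewrite in_itv/= leey andbT; apply: integral_ge0 => x _.
  by rewrite lee_fin powR_ge0.
- by rewrite in_itv/= leey andbT lee_fin powR_ge0.
Qed.

(** The limiting case: |g| <= w <x>^-r almost everywhere, and r > d. *)
Lemma integral_weighted_embeddingy (r : R) : (0 < d)%N -> (d%:R < r)%R ->
  exists2 C : R, (0 <= C)%R & forall g (w : R), cmeasurable g -> (0 <= w)%R ->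
    normLqr +oo r g = w%:E -> \int[leb]_x (normc (g x))%:E <= (C * w)%:E.
Proof.
move=> d0 dr; have Dfin := integral_japanese_lty (R := R) d0 dr.
have D0 : 0 <= \int[leb]_x (japanese x `^ (- r))%:E.
  by apply: integral_ge0 => x _; rewrite lee_fin powR_ge0.
exists (fine (\int[leb]_x (japanese x `^ (- r))%:E)); first exact: fine_ge0.
move=> g w mg w0 E.
rewrite EFinM fineK ?ge0_fin_numE// -ge0_integralZr//; last 2 first.
- by apply/measurable_EFinP; exact: measurable_japanese_powR.
- by move=> x _; rewrite lee_fin powR_ge0.
have G0 x : 0 <= (normc (g x))%:E by rewrite lee_fin normc_ge0.
apply: ae_ge0_le_integral => //.
- exact: emeasurable_normc.
- by move=> x _; rewrite mule_ge0// lee_fin powR_ge0.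
- rewrite (_ : (fun x => _) = (fun x : V => w%:E * (japanese x `^ (- r))%:E)); last first.
    by apply/funext => x; rewrite muleC.
  by apply: measurable_funeM; apply/measurable_EFinP; exact: measurable_japanese_powR.
- have : {ae leb, forall x, (normc (g x) * japanese x `^ r <= w)%R}.
    apply: (@ae_le_of_Lnormy w (fun x => normc (g x) * japanese x `^ r)%R) => //.
      by move=> x; exact: weighted_ge0.
    by move: E; rewrite normLqrE => ->.
  apply: filterS => x gx _; rewrite -EFinM lee_fin powRN mulrC ler_pdivlMr//.
  by rewrite powR_gt0// japanese_gt0.
Qed.

End mixed_norms.

Section bounded_kernels.
Context {R : realType} {d : nat}.
Local Notation V := 'rV[R]_d.
Local Notation leb := (@leb R d).
Local Open Scope ereal_scope.
Implicit Types (F : V * V -> R[i]) (f g h : V -> R[i]).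

Lemma absTF_trilinear F f g : absTF F f g =
  trilinear (fun z => normc (F z)) (fun y => normc (f y)) (fun y => normc (g y)).
Proof. by []. Qed.

Lemma bounded_kernel_intro (q : \bar R) (r K : R) F : cmeasurable F -> (0 <= K)%R ->
  (forall f g v w, cmeasurable f -> cmeasurable g -> (0 <= v)%R -> (0 <= w)%R ->
    normLq q f = v%:E -> normLqr q r g = w%:E ->
    Lnorm leb q (absTF F f g) <= (K * v * w)%:E) ->
  bounded_kernel q 0 r K F.
Proof.
move=> mF K0 H; split => // f g; rewrite Lqr0 normLqr0 => -[mf Lf] [mg Lg].
have Ef : normLq q f = (fine (normLq q f))%:E.
  by rewrite fineK// ge0_fin_numE// Lnorm_ge0.
have Eg : normLqr q r g = (fine (normLqr q r g))%:E.
  by rewrite fineK// ge0_fin_numE// Lnorm_ge0.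
rewrite Ef Eg -!EFinM; apply: H => //; apply: fine_ge0; exact: Lnorm_ge0.
Qed.

Lemma Lnorm_absTF_le (p M : R) F f g : (0 < p)%R -> (0 <= M)%R ->
  \int[leb]_xi (absTF F f g xi `^ p) <= (M `^ p)%:E ->
  Lnorm leb p%:E (absTF F f g) <= M%:E.
Proof.
move=> p0 M0 h; apply: le_LnormP => //; rewrite poweR_EFin; apply: le_trans h.
rewrite le_eqVlt; apply/orP; left; apply/eqP; apply: eq_integral => xi _.
by rewrite gee0_abs ?absTF_ge0.
Qed.

Lemma Lnormy_absTF_le (M : R) F f g :
  {ae leb, forall xi, absTF F f g xi <= M%:E} -> Lnorm leb +oo (absTF F f g) <= M%:E.
Proof.
move=> h; apply: Lnormy_le; apply: filterS h => xi h.
by rewrite gee0_abs ?absTF_ge0.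
Qed.

Lemma hoelder_conjugate_fin (p : R) : (1 < p)%R ->
  hoelder_conjugate p%:E = (p / (p - 1))%:E.
Proof.
move=> p1; rewrite /hoelder_conjugate/= eqe gt_eqF ?(lt_trans ltr01)//.
by rewrite inver subr_eq0 gt_eqF.
Qed.

(** For q = 1 the first and the third bound coincide, since both mixed norms are
    then essential suprema. *)
Let bounded_kernel1 F (M : R) : cmeasurable F -> (0 <= M)%R ->
  {ae leb, forall xi, {ae leb, forall eta, (normc (F (xi, eta)) <= M)%R}} ->
  bounded_kernel 1 0 0 M F.
Proof.
move=> mF M0 h; apply: bounded_kernel_intro => // f g v w mf mg v0 w0 Ef.
rewrite normLqr0 => Eg; apply: Lnorm_absTF_le; rewrite ?mulr_ge0//.
rewrite absTF_trilinear; apply: trilinear_le_convolution => //;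
  try by [exact: measurable_normc|move=> ?; exact: normc_ge0|exact: integral_normLq].
apply: trilinear_le_fiber1 => //;
  try by [exact: measurable_normc|move=> ?; exact: normc_ge0].
Qed.

Lemma bounded_kernel_L2 (q : \bar R) (M : R) F : 1 <= q -> cmeasurable F -> (0 <= M)%R ->
  normL2 +oo (hoelder_conjugate q) F = M%:E -> bounded_kernel q 0 0 M F.
Proof.
case: q => [p| |//] q1 mF M0.
- have {}q1 : (1 <= p)%R by rewrite -lee_fin.
  have p0 : (0 < p)%R by exact: lt_le_trans q1.
  have [<-|pn1] := eqVneq 1%R p.
    by rewrite hoelder_conjugate1 => /normL2y_fiber; exact: bounded_kernel1.
  have p1 : (1 < p)%R by rewrite lt_neqAle pn1.
  have p10 : (0 < p - 1)%R by rewrite subr_gt0.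
  rewrite hoelder_conjugate_fin// => /normL2_fiber h.
  apply: bounded_kernel_intro => // f g v w mf mg v0 w0 Ef.
  rewrite normLqr0 => Eg; apply: Lnorm_absTF_le; rewrite ?mulr_ge0//.
  rewrite absTF_trilinear; apply: trilinear_le_convolution => //;
    try by [exact: measurable_normc|move=> ?; exact: normc_ge0|exact: integral_normLq].
  apply: trilinear_le_fiber => //;
    try by [exact: measurable_normc|move=> ?; exact: normc_ge0].
  by apply: h; rewrite divr_gt0.
- rewrite hoelder_conjugatey => /normL2_fiber h.
  apply: bounded_kernel_intro => // f g v w mf mg v0 w0 Ef.
  rewrite normLqr0 => Eg; apply: Lnormy_absTF_le.
  rewrite absTF_trilinear; apply: trilinear_bounded_fiber => //;
    try by [exact: measurable_normc|move=> ?; exact: normc_ge0|exact: ae_normLqy].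
  have := h ltr01; apply: filterS => xi; rewrite powRr1//; apply: le_trans.
  rewrite le_eqVlt; apply/orP; left; apply/eqP; apply: eq_integral => y _.
  by rewrite powRr1// normc_ge0.
Qed.

Lemma bounded_kernel_L1_le2 (q : \bar R) (M : R) F : 1 <= q -> q <= 2%:E ->
  cmeasurable F -> (0 <= M)%R ->
  normL1 (hoelder_conjugate q) +oo F = M%:E -> bounded_kernel q 0 0 M F.
Proof.
case: q => [p| |//] q1 q2 mF M0; last by move: q2; rewrite leNgt ltry.
have {}q1 : (1 <= p)%R by rewrite -lee_fin.
have p0 : (0 < p)%R by exact: lt_le_trans q1.
have [<-|pn1] := eqVneq 1%R p.
  by rewrite hoelder_conjugate1 => /(normL1y_fiber mF); exact: bounded_kernel1.
have p1 : (1 < p)%R by rewrite lt_neqAle pn1.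
have p10 : (0 < p - 1)%R by rewrite subr_gt0.
have p'0 : (0 < p / (p - 1))%R by rewrite divr_gt0.
rewrite hoelder_conjugate_fin// => /(normL1_fiber p'0) h.
apply: bounded_kernel_intro => // f g v w mf mg v0 w0 Ef.
rewrite normLqr0 => Eg; apply: Lnorm_absTF_le; rewrite ?mulr_ge0//.
have [p2|p2] := eqVneq p 2%R.
  (* At p = 2 the middle factor of the threefold splitting degenerates, and p' = p. *)
  have pp : (p / (p - 1) = p)%R by rewrite p2; field.
  rewrite pp in h.
  rewrite absTF_trilinear; apply: trilinear_le_hoelder; rewrite ?pp//;
    try by [exact: measurable_normc|move=> ?; exact: normc_ge0|exact: integral_normLq].
have {}p2 : (p < 2)%R by rewrite lt_neqAle p2 -lee_fin.
rewrite absTF_trilinear; apply: trilinear_le_hoelder3 => //;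
  try by [exact: measurable_normc|move=> ?; exact: normc_ge0|exact: integral_normLq].
Qed.

Lemma bounded_kernel_L1_gt2 (q : \bar R) (r : R) : (0 < d)%N -> 2%:E < q ->
  d%:R%:E * (1 - 2%:E / q) < r%:E ->
  exists2 C : R, (0 <= C)%R & forall (M : R) F, cmeasurable F -> (0 <= M)%R ->
    normL1 q +oo F = M%:E -> bounded_kernel q 0 r (C * M) F.
Proof.
move=> d0; case: q => [p| |//] q2 hr.
- have p2 : (2 < p)%R by rewrite -lte_fin.
  have p0 : (0 < p)%R by exact: lt_trans p2.
  move: hr; rewrite inver gt_eqF//.
  rewrite (_ : 1 - 2%:E * (p^-1)%:E = (1 - 2 / p)%:E)// -EFinM lte_fin => hr.
  have [C C0 HC] := integral_weighted_embedding d0 p2 hr.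
  exists C => // M F mF M0 /(normL1_fiber p0) h.
  apply: bounded_kernel_intro; rewrite ?mulr_ge0// => f g v w mf mg v0 w0 Ef Eg.
  apply: Lnorm_absTF_le; rewrite ?mulr_ge0//.
  (* The constant of the embedding is absorbed into the norm of g. *)
  rewrite (_ : C * M * v * w = M * v * (C * w))%R; last by ring.
  rewrite absTF_trilinear; apply: trilinear_le_hoelder; rewrite ?mulr_ge0//;
    try by [exact: measurable_normc|move=> ?; exact: normc_ge0|exact: integral_normLq|exact: HC].
  lra.
- move: hr; rewrite invey mule0 sube0 mule1 lte_fin => hr.
  have [C C0 HC] := integral_weighted_embeddingy d0 hr.
  exists C => // M F mF M0 /(normL1y_fiber mF) h.
  apply: bounded_kernel_intro; rewrite ?mulr_ge0// => f g v w mf mg v0 w0 Ef Eg.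
  apply: Lnormy_absTF_le.
  rewrite (_ : C * M * v * w = M * v * (C * w))%R; last by ring.
  rewrite absTF_trilinear; apply: trilinear_bounded_integrable; rewrite ?mulr_ge0//;
    try by [exact: measurable_normc|move=> ?; exact: normc_ge0|exact: ae_normLqy|exact: HC].
Qed.

End bounded_kernels.

(** * The extension theorem *)

Section kernel_operator.
Context {R : realType} {d : nat}.
Local Notation V := 'rV[R]_d.
Local Open Scope ereal_scope.

Lemma bounded_kernel_extension (q : \bar R) (r K : R) (F : V * V -> R[i]) :
  (0 < d)%N -> 1 <= q -> bounded_kernel q 0 r K F ->
  unique_continuous_extension q r F (TF F) /\
  forall f g, Lq q f -> Lqr q r g ->
    normLq q (TF F f g) <= K%:E * normLq q f * normLqr q r g.
Proof.
move=> d0 q1 HF; split; first exact: TF_unique_continuous_extension HF.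
by have := normLq_TF_le q1 HF; rewrite Lqr0 normLqr0.
Qed.

End kernel_operator.

Theorem proposition4p2 (R : realType) (d : nat) (d_gt0 : (0 < d)%N)
    (q : \bar R) (q_ge1 : (1 <= q)%E) :
  let q' := hoelder_conjugate q in
  [/\ (forall F : 'rV[R]_d * 'rV[R]_d -> R[i], L2pq +oo%E q' F ->
        exists T : ('rV[R]_d -> R[i]) -> ('rV[R]_d -> R[i]) -> 'rV[R]_d -> R[i],
          unique_continuous_extension q 0 F T /\
          forall f g, Lq q f -> Lq q g ->
            (normLq q (T f g) <= normL2 +oo%E q' F * normLq q f * normLq q g)%E),
      ((2%:E < q)%E -> forall r : R,
        (d%:R%:E * (1 - 2%:E / q) < r%:E)%E ->
        exists C : R,
        forall F : 'rV[R]_d * 'rV[R]_d -> R[i], L1pq q +oo%E F ->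
        exists T : ('rV[R]_d -> R[i]) -> ('rV[R]_d -> R[i]) -> 'rV[R]_d -> R[i],
          unique_continuous_extension q r F T /\
          forall f g, Lq q f -> Lqr q r g ->
            (normLq q (T f g) <=
               C%:E * normL1 q +oo%E F * normLq q f * normLqr q r g)%E) &
      ((q <= 2%:E)%E ->
        forall F : 'rV[R]_d * 'rV[R]_d -> R[i], L1pq q' +oo%E F ->
        exists T : ('rV[R]_d -> R[i]) -> ('rV[R]_d -> R[i]) -> 'rV[R]_d -> R[i],
          unique_continuous_extension q 0 F T /\
          forall f g, Lq q f -> Lq q g ->
            (normLq q (T f g) <= normL1 q' +oo%E F * normLq q f * normLq q g)%E)].
Proof.
move=> q'; split.
- move=> F [[mF _] fF]; exists (TF F).
  have N0 : (0 <= normL2 +oo q' F)%E by exact: Lnorm_ge0.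
  have E : normL2 +oo q' F = (fine (normL2 +oo q' F))%:E by rewrite fineK// ge0_fin_numE.
  have HF := bounded_kernel_L2 q_ge1 mF (fine_ge0 N0) E.
  by have := bounded_kernel_extension d_gt0 q_ge1 HF; rewrite Lqr0 normLqr0 -E.
- move=> q2 r hr; have [C C0 HC] := bounded_kernel_L1_gt2 d_gt0 q2 hr.
  exists C => F [[mF _] fF]; exists (TF F).
  have N0 : (0 <= normL1 q +oo F)%E by exact: Lnorm_ge0.
  have E : normL1 q +oo F = (fine (normL1 q +oo F))%:E by rewrite fineK// ge0_fin_numE.
  have HF := HC _ _ mF (fine_ge0 N0) E.
  by have := bounded_kernel_extension d_gt0 q_ge1 HF; rewrite EFinM -E.
- move=> q2 F [[mF _] fF]; exists (TF F).
  have N0 : (0 <= normL1 q' +oo F)%E by exact: Lnorm_ge0.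
  have E : normL1 q' +oo F = (fine (normL1 q' +oo F))%:E by rewrite fineK// ge0_fin_numE.
  have HF := bounded_kernel_L1_le2 q_ge1 q2 mF (fine_ge0 N0) E.
  by have := bounded_kernel_extension d_gt0 q_ge1 HF; rewrite Lqr0 normLqr0 -E.
Qed.
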